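(* Let $q\in(0,1)$, let $k\ge2$ be an integer, $x\in\mathbb Z$, $\mathbf r,\mathbf s\in\mathbb Z^k$ and $\mathbf n\in\mathbb Z^{k+2}$. For a vector $\mathbf v$ let $\mathbf v'$ denote the vector obtained from $\mathbf v$ by leaving out the first component. Then $$R_{\mathbf r,\mathbf s}^{x,\mathbf n}=\sum_{\mathbf t\in\mathbb Z^{k-1}}S_{(\mathbf t,r_1),\mathbf s}^{x,\mathbf n}\,R_{\mathbf r',\mathbf t}^{r_1,\mathbf n'}.$$ In terms of multivariate $q$-Bessel functions, $$J_{\boldsymbol\nu(x,\mathbf n)}(\mathbf r,\mathbf s)=\sum_{\mathbf t\in\mathbb Z^{k-1}}A_{\mathbf t,\mathbf s}^{r_1}\,J_{\boldsymbol\nu(r_1,\mathbf n')}(\mathbf r',\mathbf t),$$ where, with $t_0=n_2$, $t_k=r_1$, $s_{k+1}=x$, $$A_{\mathbf t,\mathbf s}^{r_1}=(-q^{\frac12})^{|\mathbf t|+|\mathbf s|-|\mathbf n|-(k-2)n_1-s_k+r_2+t_{k-1}}\prod_{j=1}^kJ_{s_{j+1}-n_1+t_{j-1}-n_{j+2}}\big(q^{s_j+t_j-n_1-n_{j+2}};q\big).$$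
   Context: Notation: $\mathbb N=\{0,1,2,\ldots\}$, $(a;q)_k=\prod_{i=0}^{k-1}(1-aq^i)$, $(a;q)_\infty=\prod_{i\ge0}(1-aq^i)$; $|\mathbf v|$ is the sum of the components of $\mathbf v$ (so $|\mathbf t|=t_1+\cdots+t_{k-1}$); $(-q^{1/2})^E=(-1)^Eq^{E/2}$; $\{e_n\}_{n\in\mathbb N}$ is the standard orthonormal basis of $\ell^2(\mathbb N)$. Clebsch-Gordan coefficients. For $x,m,n\in\mathbb N$ put $\mu=\min(m,n)$, $p=|n-m|$ and $$C_{x,m,n}=(-1)^{\mu+x}\sqrt{\frac{q^{2(p+1)(x-\mu)}(q^{2p+2};q^2)_\infty(q^{2p+2};q^2)_\mu}{(q^2;q^2)_\mu(q^2;q^2)_x}}\;\sum_{j=0}^{\mu}\frac{(q^{-2\mu};q^2)_j}{(q^2;q^2)_j(q^{2p+2};q^2)_j}q^{2(x+1)j};$$ $C_{x,m,n}=0$ if one of the indices is a negative integer. Tree vectors. Consider a binary tree with $K\ge 2$ leaves, with integer labels on all nodes; the leaves carry labels $n_1,\ldots,n_K$ from left to right and the root carries a label $x\in\mathbb N$. To it corresponds the vector in $\ell^2(\mathbb N)^{\otimes K}$ $$\sum_{\ell}\Big(\prod_{v}C_{\ell(v),\ell(v_L),\ell(v_R)}\Big)\,e_{\ell_1}\otimes\cdots\otimes e_{\ell_K},$$ where $v$ runs over the internal nodes, including the root, $v_L,v_R$ are the left and right child of $v$, $\ell_1,\dots,\ell_K$ are the leaf labels of $\ell$, and the sum is over all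 labelings $\ell$ of the nodes by elements of $\mathbb N$ with root label $x$ for which the following quantities have the same values as for the given labeling: (a) (right child of root) $-$ (left child of root); (b) for each non-root internal node $y$ with parent $z$, sibling $w$, left child $a$ and right child $b$ (writing nodes for their labels): $z-w+a-b$ if $y$ is a right child, $z-w-a+b$ if $y$ is a left child. For a fixed tree these vectors are orthonormal (labelings with the same values of $x$, (a), (b) give the same vector). $3nj$-symbols. Let $k\ge1$, $\mathbf r,\mathbf s\in\mathbb Z^k$, $\mathbf n\in\mathbb Z^{k+2}$, $x\in\mathbb N$. The right comb has internal nodes $r_0=x,r_1,\ldots,r_k$, where $r_{j-1}$ has left child the leaf $n_j$ and right child $r_j$ ($1\le j\le k+1$, $r_{k+1}:=n_{k+2}$). The left comb has internal nodes $s_{k+1}=x,s_k,\ldots,s_1$, where $s_j$ has left child $s_{j-1}$ and right child the leaf $n_{j+1}$ ($1\le j\le k+1$, $s_0:=n_1$). The mixed tree has root $x$ with left child the leaf $n_1$ and right child $r_k$, and $r_j$ has left child $r_{j-1}$ and right child the leaf $n_{j+2}$ ($1\le j\le k$, $r_0:=n_2$). $R^{x,\mathbf n}_{\mathbf r,\mathbf s}$ is the inner product of the right comb vector (labels $x,\mathbf r,\mathbf n$) and the left comb vector (labels $x,\mathbf s,\mathbf n$); $S^{x,\mathbf n}_{\mathbf r,\mathbf s}$ is the inner product of the mixed tree vector (labels $x,\mathbf r,\mathbf n$) and the left comb vector (labels $x,\mathbf s,\mathbf n$). Thus the right comb (resp. mixed tree) vector equals $\sum_{\mathbf s\in\mathbb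 Z^k}R^{x,\mathbf n}_{\mathbf r,\mathbf s}$ (resp. $S^{x,\mathbf n}_{\mathbf r,\mathbf s}$) times the left comb vector. These inner products are unchanged when the same integer is added to $x$ and to all components of $\mathbf r,\mathbf s,\mathbf n$ (as long as the root label stays in $\mathbb N$); for $x<0$ the symbols are defined by this invariance. $q$-Bessel functions. For $x\ge 0$ and $\nu\notin\mathbb Z_{\le -1}$, $$J_\nu(x;q)=x^{\nu/2}\frac{(q^{\nu+1};q)_\infty}{(q;q)_\infty}\sum_{k=0}^\infty\frac{(-1)^kq^{k(k-1)/2}(qx)^k}{(q;q)_k(q^{\nu+1};q)_k},$$ and $J_{-n}(x;q)=(-1)^nq^{n/2}J_n(xq^n;q)$ for $n\in\mathbb N$. For $d\ge1$, $\nu=(\nu_0,\ldots,\nu_{d+1})\in\mathbb Z^{d+2}$, $x,\lambda\in\mathbb Z^d$, $$J_\nu(x,\lambda)=\prod_{j=1}^dJ_{\nu_j-x_{j+1}-\lambda_{j-1}}\big(q^{x_j-x_{j+1}+\lambda_j-\lambda_{j-1}};q\big),\qquad\lambda_0:=\nu_0,\quad x_{d+1}:=\nu_{d+1}.$$ For $y\in\mathbb Z$ and $\mathbf m=(m_1,\ldots,m_{l+2})\in\mathbb Z^{l+2}$, $\boldsymbol\nu(y,\mathbf m)=(m_1,y+m_2,\ldots,y+m_{l+1},m_{l+2})$. *)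

(* Defs.v *)
From HB Require Import structures.
From mathcomp Require Import all_boot all_order all_algebra.
From mathcomp Require Import all_classical all_reals all_analysis.
Set Implicit Arguments.
Unset Strict Implicit.
Unset Printing Implicit Defensive.
Import Order.TTheory GRing.Theory Num.Theory.
Import numFieldNormedType.Exports.
Local Open Scope classical_set_scope.
Local Open Scope ring_scope.

(* Sums of real families over an arbitrary index type. [rsum f] is meaningful
   when f is absolutely summable; [has_sum f l] says that it is, and that its
   sum is l. *)
Definition rsum (R : realType) (I : choiceType) (f : I -> R) : R :=
  fine (\esum_(i in [set: I]) (f^\+ i)%:E) -
  fine (\esum_(i in [set: I]) (f^\- i)%:E).

Definition has_sum (R : realType) (I : choiceType) (f : I -> R) (l : R) : Prop :=
  summable [set: I] (EFin \o f) /\ rsum f = l.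

(* (a; q)_k and (a; q)_oo *)
Definition qpoch (R : realType) (a q : R) (k : nat) : R :=
  \prod_(i < k) (1 - a * q ^+ i).

Definition qpoch_inf (R : realType) (a q : R) : R := limn (qpoch a q).

(* C_{x,m,n}. Only natural indices occur in the tree vectors, so the convention
   that C vanishes when an index is negative is not needed. *)
Definition clebsch (R : realType) (q : R) (x m n : nat) : R :=
  let mu := minn m n in
  let p := `|n%:Z - m%:Z|%N in
  let a := q ^+ (2 * p + 2) in
  (-1) ^+ (mu + x) *
  Num.sqrt (q ^ ((2 * (p%:Z + 1)) * (x%:Z - mu%:Z)) *
            qpoch_inf a (q ^+ 2) * qpoch a (q ^+ 2) mu /
            (qpoch (q ^+ 2) (q ^+ 2) mu * qpoch (q ^+ 2) (q ^+ 2) x)) *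
  \sum_(j < mu.+1)
    qpoch (q ^- (2 * mu)) (q ^+ 2) j /
    (qpoch (q ^+ 2) (q ^+ 2) j * qpoch a (q ^+ 2) j) *
    q ^+ (2 * (x + 1) * j).

(* Binary trees with a label on every node. *)
Inductive tree (T : Type) : Type :=
  | Leaf of T
  | Node of T & tree T & tree T.

HB.instance Definition _ (T : Type) := gen_eqMixin (tree T).
HB.instance Definition _ (T : Type) := gen_choiceMixin (tree T).

Definition root_label (T : Type) (t : tree T) : T :=
  match t with Leaf y => y | Node y _ _ => y end.

Fixpoint tmap (T U : Type) (f : T -> U) (t : tree T) : tree U :=
  match t with
  | Leaf y => Leaf (f y)
  | Node y a b => Node (f y) (tmap f a) (tmap f b)
  end.

Definition tree_shape (T : Type) (t : tree T) : tree unit := tmap (fun=> tt) t.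

Fixpoint leaves (T : Type) (t : tree T) : seq T :=
  match t with
  | Leaf y => [:: y]
  | Node _ a b => leaves a ++ leaves b
  end.

(* The quantities (b) of a subtree, in preorder, where z and w are the labels of
   the parent and of the sibling of its root. *)
Fixpoint inner_diffs (is_right : bool) (z w : int) (t : tree int) : seq int :=
  match t with
  | Leaf _ => [::]
  | Node y a b =>
      (if is_right then z - w + root_label a - root_label b
       else z - w - root_label a + root_label b)
      :: inner_diffs false y (root_label b) a ++ inner_diffs true y (root_label a) b
  end.

(* The quantity (a), followed by the quantities (b). *)
Definition diffs (t : tree int) : seq int :=
  match t with
  | Leaf _ => [::]
  | Node x a b =>
      (root_label b - root_label a)
      :: inner_diffs false x (root_label b) a ++ inner_diffs true x (root_label a) b
  end.

(* The labelings by natural numbers that occur in the vector of [t]. *)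
Definition labelings (t : tree int) : set (tree nat) :=
  [set l | [/\ tree_shape l = tree_shape t,
               root_label (tmap Posz l) = root_label t &
               diffs (tmap Posz l) = diffs t]].

Fixpoint clebsch_prod (R : realType) (q : R) (l : tree nat) : R :=
  match l with
  | Leaf _ => 1
  | Node x a b =>
      clebsch q x (root_label a) (root_label b) * clebsch_prod q a * clebsch_prod q b
  end.

(* A vector of the K-fold tensor power of l^2(N) is represented by its
   coefficients in the basis e_{a_1} (x) ... (x) e_{a_K}. A labeling in
   [labelings t] is determined by its leaves, so the sum below has at most one
   term. *)
Definition tree_vector (R : realType) (q : R) (K : nat) (t : tree int)
    (a : K.-tuple nat) : R :=
  \sum_(l \in labelings t `&` [set l | leaves l = a]) clebsch_prod q l.

Definition dotp (R : realType) (K : nat) (u v : K.-tuple nat -> R) : R :=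
  rsum (fun a => u a * v a).

(* The combs and the mixed tree: vectors are indexed from 1 in the mathematics,
   and n has two more components than r and s. [left_spine s n] has internal
   nodes s_1, s_2, ... from the bottom up; s_1 has left child n_1, and s_j has
   right child n_{j+1}. *)
Definition left_spine (s n : seq int) : tree int :=
  foldl (fun t p => Node p.1 t (Leaf p.2)) (Leaf (head 0 n)) (zip s (behead n)).

Definition left_comb (x : int) (s n : seq int) : tree int :=
  left_spine (rcons s x) n.

Definition right_comb (x : int) (r n : seq int) : tree int :=
  foldr (fun p t => Node p.1 (Leaf p.2) t) (Leaf (last 0 n)) (zip (x :: r) n).

Definition mixed_tree (x : int) (r n : seq int) : tree int :=
  Node x (Leaf (head 0 n)) (left_spine r (behead n)).

(* Inner product of the vectors of two trees with K leaves and the same root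
   label x. When x < 0, all labels are first increased by -x, which is the
   extension to negative x by translation invariance. *)
Definition tree_dotp (R : realType) (q : R) (K : nat) (x : int)
    (t1 t2 : tree int) : R :=
  let c := Num.max 0 (- x) in
  dotp (@tree_vector R q K (tmap (fun y => y + c) t1))
       (@tree_vector R q K (tmap (fun y => y + c) t2)).

(* R^{x,n}_{r,s} *)
Definition symbolR (R : realType) (q : R) (x : int) (n r s : seq int) : R :=
  tree_dotp q (size n) x (right_comb x r n) (left_comb x s n).

(* S^{x,n}_{r,s} *)
Definition symbolS (R : realType) (q : R) (x : int) (n r s : seq int) : R :=
  tree_dotp q (size n) x (mixed_tree x r n) (left_comb x s n).

(* J_nu(y; q) for real nu other than -1, -2, ... *)
Definition qbessel (R : realType) (q nu y : R) : R :=
  y `^ (nu / 2) * (qpoch_inf (q `^ (nu + 1)) q / qpoch_inf q q) *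
  limn (series (fun k : nat =>
    (-1) ^+ k * q ^+ (k * k.-1)./2 * (q * y) ^+ k /
    (qpoch q q k * qpoch (q `^ (nu + 1)) q k))).

(* J_nu(y; q) for integer nu; [Negz m] is -(m + 1). *)
Definition qbesselz (R : realType) (q : R) (nu : int) (y : R) : R :=
  match nu with
  | Posz m => qbessel q m%:R y
  | Negz m => (-1) ^+ m.+1 * q `^ (m.+1%:R / 2) *
              qbessel q m.+1%:R (y * q ^+ m.+1)
  end.

(* J_nu(x, lambda), with d the size of x and nu = (nu_0, ..., nu_{d+1}). The
   extended vectors are X = (x_1, ..., x_{d+1}), so that x_j is X`_j.-1, and
   L = (lambda_0, ..., lambda_d). *)
Definition multi_qbessel (R : realType) (q : R) (nu x lam : seq int) : R :=
  let d := size x in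
  let X := rcons x nu`_d.+1 in
  let L := nu`_0 :: lam in
  \prod_(1 <= j < d.+1)
    qbesselz q (nu`_j - X`_j - L`_j.-1) (q ^ (X`_j.-1 - X`_j + L`_j - L`_j.-1)).

(* bold nu (y, m): y is added to all components but the first and the last. *)
Definition bnu (y : int) (m : seq int) : seq int :=
  mkseq (fun i => if (0 < i < (size m).-1)%N then y + m`_i else m`_i) (size m).

(* 1-based components *)
Definition entry (v : seq int) (j : nat) : int := v`_j.-1.

(* A^{r_1}_{t,s}; T = (t_0, ..., t_k) and S = (s_1, ..., s_{k+1}). *)
Definition coefA (R : realType) (q : R) (k : nat) (x : int)
    (n r s t : seq int) : R :=
  let T := entry n 2 :: rcons t (entry r 1) in
  let S := rcons s x in
  (- Num.sqrt q) ^ (\sum_(a <- t) a + \sum_(a <- s) a - \sum_(a <- n) a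
                    - (k%:Z - 2) * entry n 1 - entry s k + entry r 2
                    + entry t k.-1) *
  \prod_(1 <= j < k.+1)
    qbesselz q (entry S j.+1 - entry n 1 + T`_j.-1 - entry n j.+2)
      (q ^ (entry S j + T`_j - entry n 1 - entry n j.+2)).

(* Main.v *)
(* Let h(nu, y) = (-q)^y J_nu(q^(2y); q^2). The Clebsch-Gordan coefficients
   satisfy the coupling relation
     C(x,a,r) C(r,b,c) = sum_s h(x+b-a-c, r+s-a-c) C(x,s,c) C(s,a,b),
   which follows by induction on the labels from first order q-difference
   relations, and sum_a C(x,a,a+p) C(y,a,a+p) = [x = y]. By these two facts,
   contracting two adjacent leaves in the inner product of two trees splits off
   one factor h. Hence the symbols R and S are products of functions h, that is,
   multivariate q-Bessel functions up to a power of -q. Since C(x+N,a+N,b+N)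
   tends to h(b-a, x-a), the coupling relation becomes, for large labels, a
   pentagon identity that expresses a product of two functions h as a sum of
   products of three. The convolution identity follows from the pentagon identity
   by induction on k; sum_y h(nu, y)^2 <= 1 gives the absolute convergence. The
   second identity is the same one with q replaced by its square root. *)

Require Import Defs.
From mathcomp Require Import all_boot all_order all_algebra.
From mathcomp Require Import all_classical all_reals all_analysis.
From mathcomp Require Import finmap ring lra zify.
Set Implicit Arguments.
Unset Strict Implicit.
Unset Printing Implicit Defensive.
Import Order.TTheory GRing.Theory Num.Theory.
Import numFieldNormedType.Exports.
Local Open Scope classical_set_scope.
Local Open Scope ring_scope.

(** * Absolutely convergent sums *)

Section Sums.
Variable R : realType.

(** The main obstacle is that a contraction changes the tree, while the labels summed over differ
    from the prescribed ones. Since (b) is the parent minus the sibling, plus or minus the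
    difference of the children, the surroundings of a subtree act on it only through its root label
    and through a shift of its own quantity (a). [dev_vector] carries these two parameters, and this
    makes induction on trees possible. Along a left spine they are passed down independently of the
    tree at the bottom, so a cherry there can be exchanged for a leaf. The coupling relation at x =
    a = 0 is a q-Laplace transform of h, evaluated by Euler's two expansions. The inductions on
    labels use [cg_poly], a form of the coefficients without square roots. Interchanges of sums rest
    on two kinds of domination: h decays geometrically in both directions, and tree vectors and
    products of h have l^2 norm at most 1. The base Q = q^2 is kept as a variable of its own,
    because the same results are used for the pairs (q, q^2) and (sqrt q, q). *)

Definition nsum (I : choiceType) (f : I -> R) : \bar R :=
  \esum_(i in [set: I]) (f i)%:E.

Lemma nsum_ge0 (I : choiceType) (f : I -> R) :
  (forall i, 0 <= f i) -> (0 <= nsum f)%E.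
Proof. by move=> f0; apply: esum_ge0 => i _; rewrite lee_fin. Qed.

Lemma le_nsum (I : choiceType) (f g : I -> R) :
  (forall i, f i <= g i) -> (nsum f <= nsum g)%E.
Proof. by move=> fg; apply: le_esum => i _; rewrite lee_fin. Qed.

Lemma nsumD (I : choiceType) (f g : I -> R) :
  (forall i, 0 <= f i) -> (forall i, 0 <= g i) ->
  nsum (fun i => f i + g i) = (nsum f + nsum g)%E.
Proof. by move=> f0 g0; rewrite /nsum -esumD// => i _; rewrite lee_fin. Qed.

Lemma nsum_fin (I : choiceType) (f : I -> R) (b : \bar R) :
  (forall i, 0 <= f i) -> (nsum f <= b)%E -> (b < +oo)%E ->
  nsum f = (fine (nsum f))%:E.
Proof.
move=> f0 fb boo; rewrite fineK// ge0_fin_numE ?nsum_ge0//.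
exact: le_lt_trans boo.
Qed.

(** Positive and negative parts are not additive in f. The identity f^+ + g2 = f^- + g1 involves
    non-negative families only, for which [nsum] is additive, so any splitting of f may be used.
    Linearity of [has_sum] rests on this. *)
Lemma has_sum_parts (I : choiceType) (f g1 g2 : I -> R) (l1 l2 : R) :
  (forall i, f i = g1 i - g2 i) ->
  (forall i, 0 <= g1 i) -> (forall i, 0 <= g2 i) ->
  nsum g1 = l1%:E -> nsum g2 = l2%:E -> has_sum f (l1 - l2).
Proof.
move=> fE g10 g20 s1 s2.
have p0 i : 0 <= f^\+ i by exact: funrpos_ge0.
have n0 i : 0 <= f^\- i by exact: funrneg_ge0.
have p1 i : f^\+ i <= g1 i.
  by rewrite /funrpos fE ge_max g10 andbT gerBl.
have n2 i : f^\- i <= g2 i.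
  by rewrite /funrneg fE ge_max g20 andbT opprB gerBl.
have sp := nsum_fin p0 (le_nsum p1); rewrite s1 ltry in sp.
have {}sp := sp isT.
have sn := nsum_fin n0 (le_nsum n2); rewrite s2 ltry in sn.
have {}sn := sn isT.
have key : (nsum (funrpos f) + nsum g2 = nsum (funrneg f) + nsum g1)%E.
  rewrite -!nsumD//; congr nsum; apply/funext => i.
  have := fE i; rewrite /funrpos /funrneg.
  by have [h|h] := leP 0 (f i); [rewrite max_r|rewrite max_l]; lra.
split; last first.
  move: key; rewrite sp sn s1 s2 -!EFinD => -[].
  by rewrite /rsum -/(nsum f^\+) -/(nsum f^\-); lra.
rewrite /summable.
apply: (@le_lt_trans _ _ (nsum (fun i => g1 i + g2 i))).
  apply: le_esum => i _; rewrite /= lee_fin fE.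
  by rewrite (le_trans (ler_normB _ _))// !ger0_norm.
by rewrite nsumD// s1 s2 -EFinD ltry.
Qed.

Lemma has_sumE (I : choiceType) (f : I -> R) (l : R) : has_sum f l ->
  exists a b, [/\ nsum f^\+ = a%:E, nsum f^\- = b%:E & l = a - b].
Proof.
move=> [sf <-]; exists (fine (nsum f^\+)), (fine (nsum f^\-)).
have e : (\esum_(i in [set: I]) `| (EFin \o f) i |)%E = nsum (fun i => `|f i|).
  by apply: eq_esum.
rewrite /summable e in sf.
have p0 i : 0 <= f^\+ i by exact: funrpos_ge0.
have n0 i : 0 <= f^\- i by exact: funrneg_ge0.
split => //.
- apply: (nsum_fin p0 _ sf); apply: le_nsum => i.
  by rewrite /funrpos ge_max ler_norm normr_ge0.
- apply: (nsum_fin n0 _ sf); apply: le_nsum => i.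
  by rewrite /funrneg ge_max normr_ge0 -normrN ler_norm.
Qed.

Lemma has_sum_unique (I : choiceType) (f : I -> R) (l l' : R) :
  has_sum f l -> has_sum f l' -> l = l'.
Proof. by move=> [_ <-] [_ <-]. Qed.

Lemma has_sum_rsum (I : choiceType) (f : I -> R) (l : R) :
  has_sum f l -> has_sum f (rsum f).
Proof. by case. Qed.

Lemma eq_has_sum (I : choiceType) (f g : I -> R) (l : R) :
  has_sum f l -> f =1 g -> has_sum g l.
Proof. by move=> + /funext <-. Qed.

Lemma has_sum_val (I : choiceType) (f : I -> R) (l l' : R) :
  has_sum f l -> l = l' -> has_sum f l'.
Proof. by move=> + <-. Qed.

Lemma has_sum_nsum (I : choiceType) (f : I -> R) (l : R) :
  (forall i, 0 <= f i) -> has_sum f l <-> nsum f = l%:E.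
Proof.
move=> f0; split.
  move=> /has_sumE [a [b [sa sb ->]]].
  have fp : f^\+ = f by apply/funext => i; rewrite /funrpos max_l.
  have fn : f^\- = fun=> 0.
    by apply/funext => i; rewrite /funrneg max_r// oppr_le0.
  move: sa sb; rewrite fp fn => -> ; rewrite /nsum esum1// => -[<-].
  by rewrite subr0.
move=> s; rewrite -[l]subr0.
apply: (has_sum_parts (g1 := f) (g2 := fun=> 0)) => //.
  by move=> i; rewrite subr0.
by rewrite /nsum esum1.
Qed.

Lemma has_sum_ge0 (I : choiceType) (f : I -> R) (l : R) :
  (forall i, 0 <= f i) -> has_sum f l -> 0 <= l.
Proof.
move=> f0 /(has_sum_nsum _ f0) s.
by rewrite -lee_fin -s nsum_ge0.
Qed.

Lemma has_sumD (I : choiceType) (f g : I -> R) (l m : R) :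
  has_sum f l -> has_sum g m -> has_sum (fun i => f i + g i) (l + m).
Proof.
move=> /has_sumE [a [b [sa sb ->]]] /has_sumE [c [d [sc sd ->]]].
rewrite (_ : _ + _ = (a + c) - (b + d)); last lra.
have p0 (h : I -> R) i : 0 <= h^\+ i by exact: funrpos_ge0.
have n0 (h : I -> R) i : 0 <= h^\- i by exact: funrneg_ge0.
apply: (@has_sum_parts _ _ (fun i => f^\+ i + g^\+ i)
                         (fun i => f^\- i + g^\- i)).
- move=> i; rewrite /funrpos /funrneg.
  by case: (leP 0 (f i)) => ?; case: (leP 0 (g i)) => ?;
    do ?[rewrite (@max_l _ _ (f i)); last lra];
    do ?[rewrite (@max_r _ _ (f i)); last lra];
    do ?[rewrite (@max_l _ _ (g i)); last lra];
    do ?[rewrite (@max_r _ _ (g i)); last lra];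
    do ?[rewrite (@max_l _ _ (- f i)); last lra];
    do ?[rewrite (@max_r _ _ (- f i)); last lra];
    do ?[rewrite (@max_l _ _ (- g i)); last lra];
    do ?[rewrite (@max_r _ _ (- g i)); last lra]; lra.
- by move=> i; rewrite addr_ge0.
- by move=> i; rewrite addr_ge0.
- by rewrite nsumD// sa sc.
- by rewrite nsumD// sb sd.
Qed.

Lemma has_sumN (I : choiceType) (f : I -> R) (l : R) :
  has_sum f l -> has_sum (fun i => - f i) (- l).
Proof.
move=> /has_sumE [a [b [sa sb ->]]]; rewrite opprB.
apply: (@has_sum_parts _ _ f^\- f^\+) => // i.
- rewrite /funrpos /funrneg.
  by have [h|h] := leP 0 (f i); [rewrite max_r|rewrite max_l]; lra.
Qed.

Lemma nsumZ (I : choiceType) (f : I -> R) (c : R) : 0 <= c ->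
  (forall i, 0 <= f i) -> nsum (fun i => c * f i) = (c%:E * nsum f)%E.
Proof.
move=> c0 f0; have [->|cn0] := eqVneq c 0.
  by rewrite mul0e /nsum esum1// => i _; rewrite mul0r.
have cp : 0 < c by rewrite lt_def cn0.
rewrite /nsum /esum.
rewrite -ereal_supZl//; last first.
  apply/set0P; exists (\sum_(x \in set0) (f x)%:E)%E; exists set0.
  by apply: fsets_set0. by [].
congr ereal_sup; apply/seteqP; split => x /=.
  move=> [X [finX XI] <-]; exists (\sum_(x \in X) (f x)%:E)%E.
    by exists X.
  rewrite !fsbig_finite//= ge0_sume_distrr//.
  by move=> i _; rewrite lee_fin.
move=> [_ [X [finX XI] <-] <-]; exists X => //.
rewrite !fsbig_finite//= ge0_sume_distrr//.
by move=> i _; rewrite lee_fin.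
Qed.

Lemma has_sumZ (I : choiceType) (f : I -> R) (c l : R) :
  has_sum f l -> has_sum (fun i => c * f i) (c * l).
Proof.
wlog c0 : c / 0 <= c => [wl|].
  have [/wl//|c0] := leP 0 c; move=> fl.
  have /wl/(_ fl)/has_sumN : 0 <= - c by lra.
  rewrite mulNr opprK => /eq_has_sum; apply => i.
  by rewrite mulNr opprK.
move=> /has_sumE [a [b [sa sb ->]]]; rewrite mulrBr.
apply: (@has_sum_parts _ _ (fun i => c * f^\+ i) (fun i => c * f^\- i)).
- move=> i; rewrite -mulrBr; congr (_ * _); rewrite /funrpos /funrneg.
  by have [h|h] := leP 0 (f i); [rewrite max_r|rewrite max_l]; lra.
- by move=> i; rewrite mulr_ge0//; exact: funrpos_ge0.
- by move=> i; rewrite mulr_ge0//; exact: funrneg_ge0.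
- by rewrite nsumZ// ?sa// => i; exact: funrpos_ge0.
- by rewrite nsumZ// ?sb// => i; exact: funrneg_ge0.
Qed.

Lemma has_sumB (I : choiceType) (f g : I -> R) (l m : R) :
  has_sum f l -> has_sum g m -> has_sum (fun i => f i - g i) (l - m).
Proof. by move=> fl /has_sumN gm; exact: has_sumD. Qed.

Lemma has_sum0 (I : choiceType) : has_sum (fun _ : I => 0 : R) 0.
Proof. by apply/has_sum_nsum => //; rewrite /nsum esum1. Qed.

Lemma ler_has_sum (I : choiceType) (f g : I -> R) (l m : R) :
  (forall i, f i <= g i) -> has_sum f l -> has_sum g m -> l <= m.
Proof.
move=> fg fl gm; rewrite -subr_ge0.
by apply: has_sum_ge0 (has_sumB gm fl) => i; rewrite subr_ge0.
Qed.

Lemma has_sum_dom_nneg (I : choiceType) (f g : I -> R) (m : R) :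
  (forall i, 0 <= f i <= g i) -> has_sum g m -> has_sum f (rsum f).
Proof.
move=> fg; have f0 i : 0 <= f i by case/andP: (fg i).
have g0 i : 0 <= g i by case/andP: (fg i) => /le_trans; exact.
move=> /(has_sum_nsum _ g0) sg.
have : nsum f = (fine (nsum f))%:E.
  by apply: (@nsum_fin _ _ m%:E) => //; rewrite ?ltry// -sg;
     apply: le_nsum => i; case/andP: (fg i).
by move/(has_sum_nsum _ f0)/has_sum_rsum.
Qed.

Lemma has_sum_dom (I : choiceType) (f g : I -> R) (m : R) :
  (forall i, `|f i| <= g i) -> has_sum g m -> has_sum f (rsum f).
Proof.
move=> fg gm.
suff [l] : exists l, has_sum f l by exact: has_sum_rsum.
(* Since 0 <= g + f <= 2 g, the non-negative case applies; subtracting g recovers f. *)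
have h1 : has_sum (fun i => g i + f i) (rsum (fun i => g i + f i)).
  apply: (@has_sum_dom_nneg _ _ (fun i => 2 * g i) (2 * m)).
    by move=> i; have := fg i; rewrite ler_norml; lra.
  exact: has_sumZ.
exists (rsum (fun i => g i + f i) - m).
by apply: eq_has_sum (has_sumB h1 gm) _ => i /=; lra.
Qed.

Lemma has_sum_norm (I : choiceType) (f : I -> R) (l : R) :
  has_sum f l -> has_sum (fun i => `|f i|) (rsum (fun i => `|f i|)).
Proof.
move=> /has_sumE [a [b [sa sb _]]].
have := @has_sumD _ f^\+ f^\- a b.
have p0 i : 0 <= f^\+ i by exact: funrpos_ge0.
have n0 i : 0 <= f^\- i by exact: funrneg_ge0.
move=> /(_ (proj2 (has_sum_nsum _ p0) sa) (proj2 (has_sum_nsum _ n0) sb)).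
move=> s; apply: has_sum_rsum; apply: eq_has_sum s _ => i.
rewrite /funrpos /funrneg.
have [h|h] := leP 0 (f i); first by rewrite max_r ?ger0_norm//; lra.
by rewrite max_l ?ltr0_norm//; lra.
Qed.

Lemma ler_norm_has_sum (I : choiceType) (f g : I -> R) (l m : R) :
  (forall i, `|f i| <= g i) -> has_sum f l -> has_sum g m -> `|l| <= m.
Proof.
move=> fg fl gm; rewrite ler_norml; apply/andP; split.
  by apply: ler_has_sum (has_sumN gm) fl => i; have := fg i; rewrite ler_norml; lra.
by apply: ler_has_sum fl gm => i; have := fg i; rewrite ler_norml; lra.
Qed.

Lemma nsum_inj (I J : choiceType) (e : J -> I) (f : I -> R) :
  injective e -> (forall i, (forall j, e j <> i) -> f i = 0) ->
  nsum f = nsum (f \o e).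
Proof.
move=> inje f0; rewrite /nsum -(esum_image [set: J] e (fun i => (f i)%:E)).
  rewrite [RHS]esum_mkcond; apply: eq_esum => i _; case: ifPn => //.
  rewrite notin_setE => ni; rewrite f0// => j ej; apply: ni.
  by exists j.
by move=> x y _ _; exact: inje.
Qed.

(** Serves all changes of index: shifts of Z, N inside Z, diagonals, and coordinates split off from
    a tuple. *)
Lemma has_sum_inj (I J : choiceType) (e : J -> I) (f : I -> R) (l : R) :
  injective e -> (forall i, (forall j, e j <> i) -> f i = 0) ->
  has_sum f l <-> has_sum (f \o e) l.
Proof.
move=> inje f0.
have P : nsum f^\+ = nsum (f \o e)^\+.
  by rewrite (nsum_inj inje)// => i /f0 fi; rewrite /funrpos fi maxxx.
have N : nsum f^\- = nsum (f \o e)^\-.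
  by rewrite (nsum_inj inje)// => i /f0 fi; rewrite /funrneg fi oppr0 maxxx.
have p0 (T : choiceType) (h : T -> R) i : 0 <= h^\+ i by exact: funrpos_ge0.
have n0 (T : choiceType) (h : T -> R) i : 0 <= h^\- i by exact: funrneg_ge0.
have pn (T : choiceType) (h : T -> R) i : h i = h^\+ i - h^\- i.
  rewrite /funrpos /funrneg.
  by have [h0|h0] := leP 0 (h i); [rewrite max_r|rewrite max_l]; lra.
split => /has_sumE [a [b [sa sb ->]]];
  apply: has_sum_parts (@pn _ _) (@p0 _ _) (@n0 _ _) _ _.
- by rewrite -P.
- by rewrite -N.
- by rewrite P.
- by rewrite N.
Qed.

Lemma has_sum1 (I : choiceType) (i0 : I) (f : I -> R) :
  (forall i, i <> i0 -> f i = 0) -> has_sum f (f i0).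
Proof.
move=> f0; apply/(has_sum_inj (e := fun _ : unit => i0)).
- by case=> -[].
- by move=> i h; apply: f0 => ?; apply: (h tt).
have -> : f \o (fun=> i0) = fun _ : unit => f i0 by [].
wlog fi0 : f {f0} / 0 <= f i0.
  move=> wl; have [/wl//|fi0] := leP 0 (f i0).
  have /= := @wl (fun i => - f i); rewrite oppr_ge0 => /(_ (ltW fi0))/has_sumN.
  by rewrite opprK.
apply/has_sum_nsum => //.
rewrite /nsum (_ : [set: unit] = [set tt]); last first.
  by apply/seteqP; split => // -[].
by rewrite esum_set1.
Qed.

Lemma has_sum_nfubini (I J : choiceType) (f : I * J -> R) (g : I -> R) (l : R) :
  (forall i, 0 <= f i) -> (forall i, has_sum (fun j => f (i, j)) (g i)) ->
  has_sum f l <-> has_sum g l.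
Proof.
move=> f0 fg.
have g0 i : 0 <= g i by exact: has_sum_ge0 (fg i).
have e : nsum g = nsum f.
  transitivity (\esum_(i in [set: I]) \esum_(j in [set: J]) (f (i, j))%:E)%E.
    by apply: eq_esum => i _; by rewrite -(proj1 (has_sum_nsum _ (fun j => f0 (i, j))) (fg i)).
  rewrite (@esum_esum _ _ _ [set: I] (fun=> [set: J]) (fun i j => (f (i, j))%:E)).
    rewrite /nsum (_ : _ `*`` _ = [set: I * J]); last by apply/seteqP; split.
    by apply: eq_esum => -[].
  by move=> i j _ _; rewrite lee_fin.
by rewrite !has_sum_nsum// e.
Qed.

(** Tonelli for the non-negative families |f| and |f| + f, followed by subtraction. *)
Lemma has_sum_fubini (I J : choiceType) (f : I * J -> R) (g : I -> R) (l : R) :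
  has_sum f l -> (forall i, has_sum (fun j => f (i, j)) (g i)) -> has_sum g l.
Proof.
move=> fl fg; have sa := has_sum_norm fl.
have fa i : has_sum (fun j => `|f (i, j)|) (rsum (fun j => `|f (i, j)|)).
  exact: has_sum_norm (fg i).
have s1 : has_sum (fun i => rsum (fun j => `|f (i, j)|))
    (rsum (fun i => `|f i|)).
  exact: (proj1 (@has_sum_nfubini _ _ (fun z => `|f z|) _ _
    (fun z => normr_ge0 _) fa)).
have s2 : has_sum (fun z => `|f z| + f z) (rsum (fun i => `|f i|) + l).
  exact: has_sumD.
have p0 z : 0 <= `|f z| + f z by have := ler_norm (- f z); rewrite normrN; lra.
have s3 := proj1 (has_sum_nfubini _ p0 (fun i => has_sumD (fa i) (fg i))) s2.
apply: has_sum_val (eq_has_sum (has_sumB s3 s1) _) _ => [i|] /=; lra.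
Qed.

Lemma has_sum_swap (I J : choiceType) (f : I * J -> R) (l : R) :
  has_sum f l -> has_sum (fun z : J * I => f (z.2, z.1)) l.
Proof.
move=> fl; apply/(has_sum_inj (e := fun z : I * J => (z.2, z.1))).
- by move=> [a b] [c d] /= [-> ->].
- by move=> [j i] h; exfalso; apply: (h (i, j)).
- by apply: eq_has_sum fl _ => -[].
Qed.

Lemma has_sum_seq (I : choiceType) (s : seq I) (f : I -> R) : uniq s ->
  has_sum (fun i => if i \in s then f i else 0) (\sum_(i <- s) f i).
Proof.
elim: s => [_|j s ih /= /andP[js us]].
  by rewrite big_nil; apply: eq_has_sum (@has_sum0 _) _.
rewrite big_cons; have h1 := @has_sum1 _ j (fun i => if i == j then f i else 0).
have /h1 {}h1 : forall i, i <> j -> (if i == j then f i else 0) = 0.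
  by move=> i /eqP/negPf ->.
rewrite eqxx in h1; apply: eq_has_sum (has_sumD h1 (ih us)) _ => i /=.
rewrite inE; have [->|ij] := eqVneq i j; first by rewrite (negPf js) addr0.
by rewrite add0r.
Qed.

(** The finite set depends on g alone and serves all families dominated by g at once; [tannery]
    needs this uniformity. *)
Lemma has_sum_tail (I : choiceType) (g : I -> R) (G eps : R) :
  (forall i, 0 <= g i) -> has_sum g G -> 0 < eps ->
  exists s : seq I, forall (f : I -> R), (forall i, `|f i| <= g i) ->
    `|rsum f - \sum_(i <- s) f i| <= eps.
Proof.
move=> g0 gG e0; have /(has_sum_nsum _ g0) sg := gG.
have : ((G - eps)%:E < nsum g)%E by rewrite sg lte_fin; lra.
move=> /ereal_sup_gt[_ [X [finX _] <-]].
rewrite fsbig_finite//= sumEFin lte_fin => hX.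
set s := fset_set X in hX; exists s => f fg.
have us : uniq s by exact: fset_uniq.
have ff := has_sum_dom fg gG.
apply: (@le_trans _ _ (G - \sum_(i <- s) g i)); last lra.
apply: (@ler_norm_has_sum _ (fun i => f i - (if i \in (s : seq I) then f i else 0))
   (fun i => g i - (if i \in (s : seq I) then g i else 0)) _
   (G - \sum_(i <- s) g i)) => [i||].
- by case: ifP => _; rewrite ?subrr ?normr0// !subr0.
- exact: has_sumB ff (has_sum_seq _ us).
- exact: has_sumB gG (has_sum_seq _ us).
Qed.

Lemma tannery (I : choiceType) (f : nat -> I -> R) (f' : I -> R)
    (g : I -> R) (G : R) :
  has_sum g G -> (forall n i, `|f n i| <= g i) ->
  (forall i, f n i @[n --> \oo] --> f' i) ->
  (rsum (f n) @[n --> \oo] --> rsum f') /\ has_sum f' (rsum f').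
Proof.
move=> gG fg ff'.
have f'g i : `|f' i| <= g i.
  have fn : `|f n i| @[n --> \oo] --> `|f' i| by exact: cvg_norm.
  by apply: (cvgr_to_le fn); apply: nearW => n; exact: fg.
split; last exact: has_sum_dom gG.
have g0 i : 0 <= g i by exact: le_trans (fg 0%N i).
apply/cvgrPdist_le => /= e e0.
have e3 : 0 < e / 3 by rewrite divr_gt0.
have [s hs] := has_sum_tail g0 gG e3.
have cs : \sum_(i <- s) f n i @[n --> \oo] --> \sum_(i <- s) f' i.
  by apply: cvg_big => [|i _]; [exact: add_continuous|exact: ff'].
move/cvgrPdist_le : cs => /(_ _ e3); apply: filterS => n /= hn.
have h1 := hs _ (fg n); have h2 := hs _ f'g.
move: hn h1 h2; rewrite !ler_norml; lra.
Qed.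

Lemma has_sum_series (f : nat -> R) (l : R) :
  has_sum f l -> series f @ \oo --> l.
Proof.
move=> fl; have sn := has_sum_norm fl.
(* Partial sums are the sums of the truncations of f, which are dominated by |f|. *)
have [] := @tannery _ (fun n i => if (i < n)%N then f i else 0) f _ _ sn.
- by move=> n i; case: ifP => _; rewrite ?normr0.
- move=> i; apply/cvgrPdist_le => /= e e0; exists i.+1 => // n /= ni.
  by rewrite ni subrr normr0 ltW.
have <- : l = rsum f by case: fl.
have e : (fun n => rsum (fun i => if (i < n)%N then f i else 0)) = series f.
  apply/funext => n.
  have := has_sum_seq f (iota_uniq 0 n).
  rewrite -{1 2}[n]subn0 -/(index_iota 0 n) /series /= => -[_ <-].
  by congr rsum; apply/funext => i; rewrite mem_index_iota.
by rewrite -e => H _; exact: H.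
Qed.

Lemma has_sum_geometric (z : R) : 0 <= z < 1 ->
  has_sum (fun n : nat => z ^+ n) (1 - z)^-1.
Proof.
move=> /andP[z0 z1]; apply/has_sum_nsum => [n|]; first exact: exprn_ge0.
rewrite /nsum -nneseries_esumT => [|n]; last by rewrite lee_fin exprn_ge0.
apply/cvg_lim => //.
rewrite (_ : (fun n => _) = EFin \o series (geometric 1 z)); last first.
  apply/funext => n; rewrite /= /series /= sumEFin; congr _%:E.
  by apply: eq_bigr => i _; rewrite mul1r.
apply: cvg_EFin; first by apply: nearW.
rewrite -[X in _ --> X]mul1r; apply: cvg_geometric_series.
by rewrite ger0_norm.
Qed.

Lemma has_sum_geometric_int (z : R) : 0 <= z < 1 ->
  exists l, has_sum (fun y : int => z ^+ `|y|%N) l.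
Proof.
move=> /has_sum_geometric sz.
have h1 : has_sum (fun y : int => if (0 <= y) then z ^+ `|y|%N else 0) (1 - z)^-1.
  apply/(has_sum_inj (e := Posz)) => //.
  - by move=> m n [].
  - by case=> // n h; exfalso; apply: (h n).
have h2 : has_sum (fun y : int => if (0 <= y) then 0 else z ^+ `|y|%N)
   (z * (1 - z)^-1).
  apply/(has_sum_inj (e := Negz)) => //.
  - by move=> m n [].
  - by case=> // n h; exfalso; apply: (h n).
  - by apply: eq_has_sum (has_sumZ z sz) _ => n /=; rewrite exprS.
exists ((1 - z)^-1 + z * (1 - z)^-1).
by apply: eq_has_sum (has_sumD h1 h2) _ => y /=; case: ifP => _; lra.
Qed.

End Sums.

Lemma bin2S (k : nat) : ((k.+1 * k.+1.-1)./2 = k + (k * k.-1)./2)%N.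
Proof. by rewrite -!bin2 binS bin1 addnC. Qed.

Lemma bin2D (k l : nat) :
  (((k + l) * (k + l).-1)./2 = (k * k.-1)./2 + (l * l.-1)./2 + k * l)%N.
Proof.
by elim: k => [|k ih]; rewrite ?addn0 // addSn !bin2S ih mulSn; lia.
Qed.

(** * Shifts of the summation index *)

Section Reindexing.
Variable R : realType.

Lemma has_sumS (f : nat -> R) (l : R) : f 0%N = 0 ->
  has_sum f l <-> has_sum (fun n => f n.+1) l.
Proof.
move=> f0; apply: (has_sum_inj (e := S)); first by move=> m n [].
by case=> // n h; exfalso; apply: (h n).
Qed.

Lemma has_sum_addn (f : nat -> R) (m : nat) (l : R) :
  (forall k, (k < m)%N -> f k = 0) ->
  has_sum f l <-> has_sum (fun n => f (m + n)%N) l.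
Proof.
move=> f0; apply: (has_sum_inj (e := addn m)); first exact: addnI.
move=> k h; apply: f0; rewrite ltnNge; apply/negP => mk.
by apply: (h (k - m)%N); rewrite subnKC.
Qed.

Lemma has_sum_shift (f : int -> R) (c : int) (l : R) :
  has_sum f l -> has_sum (fun s => f (s + c)) l.
Proof.
move=> fl; apply: (proj1 (has_sum_inj _ (e := fun s => s + c) _ _)) fl.
  by move=> x y /addIr.
by move=> i h; exfalso; apply: (h (i - c)); rewrite subrK.
Qed.

Lemma has_sum_nat_int (f : int -> R) (l : R) :
  (forall k, f (Negz k) = 0) ->
  has_sum f l <-> has_sum (fun n : nat => f n) l.
Proof.
move=> f0; apply: (has_sum_inj (e := Posz)); first by move=> m n [].
by case=> // n h; exfalso; apply: (h n).
Qed.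

End Reindexing.

(** * q-Pochhammer symbols and Euler's expansions *)

Section QBasics.
Variables (R : realType) (q Q : R).
Hypothesis hq : 0 < q < 1.
Hypothesis hQ : Q = q ^+ 2.
Local Notation pq := (qpoch Q Q).

Let q_gt0 : 0 < q. Proof. by case/andP: hq. Qed.
Let q_lt1 : q < 1. Proof. by case/andP: hq. Qed.
Let q_neq0 : q != 0. Proof. by rewrite gt_eqF. Qed.

Lemma Q_bounds : 0 < Q < 1.
Proof. by rewrite hQ exprn_gt0// exprn_ilt1// ?ltW. Qed.

Let Q_gt0 : 0 < Q. Proof. by case/andP: Q_bounds. Qed.
Let Q_lt1 : Q < 1. Proof. by case/andP: Q_bounds. Qed.

Let Q_ge0 : 0 <= Q. Proof. exact: ltW. Qed.
Let q_ge0 : 0 <= q. Proof. exact: ltW. Qed.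

Lemma qpochS (a : R) (n : nat) : qpoch a Q n.+1 = qpoch a Q n * (1 - a * Q ^+ n).
Proof. by rewrite /qpoch big_ord_recr. Qed.

Lemma pq0 : pq 0 = 1.
Proof. by rewrite /qpoch big_ord0. Qed.

Lemma pqS (n : nat) : pq n.+1 = pq n * (1 - Q ^+ n.+1).
Proof. by rewrite qpochS exprS. Qed.

Lemma pq_gt0 (n : nat) : 0 < pq n.
Proof.
elim: n => [|n ih]; first by rewrite pq0.
by rewrite pqS mulr_gt0// subr_gt0 exprn_ilt1.
Qed.

Lemma pq_neq0 (n : nat) : pq n != 0.
Proof. by rewrite gt_eqF// pq_gt0. Qed.

Lemma pq_noninc (m n : nat) : (m <= n)%N -> pq n <= pq m.
Proof.
move=> /subnKC <-; elim: (n - m)%N => [|k ih]; first by rewrite addn0.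
rewrite addnS pqS (le_trans _ ih)// ler_piMr ?ltW ?pq_gt0//.
by rewrite ltrBlDr ltrDl exprn_gt0.
Qed.

Definition qfac_inf : R := qpoch_inf Q Q.
Local Notation P := qfac_inf.

Lemma pq_cvg : pq n @[n --> \oo] --> P.
Proof.
suff : cvgn pq by [].
apply: nonincreasing_is_cvgn; first by move=> m n; exact: pq_noninc.
by exists 0 => _ [n _ <-]; rewrite ltW// pq_gt0.
Qed.

Lemma P_le (n : nat) : P <= pq n.
Proof.
apply: (cvgr_to_le pq_cvg); exists n => // m /=; exact: pq_noninc.
Qed.

Lemma P_gt0 : 0 < P.
Proof.
(* Beyond N the powers of Q add up to at most 1/2. As a product of factors 1 - c_i is at least 1
   minus the sum of the c_i, the factors beyond N contribute at least 1/2. *)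
have [N hN] : exists N, Q ^+ N.+1 / (1 - Q) <= 2^-1.
  have : Q ^+ n @[n --> \oo] --> 0 by apply: cvg_expr; rewrite ger0_norm ?ltW.
  move/cvgrPdist_le/(_ ((1 - Q) / 2)).
  have h0 : 0 < (1 - Q) / 2 by rewrite divr_gt0// subr_gt0.
  move=> /(_ h0) [N _ hN]; exists N.
  have /= := hN N.+1 (leqnSn _); rewrite sub0r normrN ger0_norm ?exprn_ge0//.
  by rewrite ler_pdivrMr ?subr_gt0// mulrC.
suff h k : pq N * (1 - \sum_(i < k) Q ^+ (N + i).+1) <= pq (N + k).
  apply: (@lt_le_trans _ _ (pq N * 2^-1)); first by rewrite mulr_gt0 ?pq_gt0.
  have c : pq (n + N)%N @[n --> \oo] --> P by rewrite cvg_shiftn; exact: pq_cvg.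
  apply: (cvgr_to_ge c); apply: nearW => k; rewrite addnC.
  apply: le_trans (h k); rewrite ler_pM2l ?pq_gt0//.
  suff : \sum_(i < k) Q ^+ (N + i).+1 <= Q ^+ N.+1 / (1 - Q) by lra.
  have := @geometric_le_lim R k (Q ^+ N.+1) Q.
  rewrite exprn_ge0// ger0_norm// => /(_ isT Q_gt0 Q_lt1); apply: le_trans.
  rewrite /series /= big_mkord le_eqVlt; apply/orP; left; apply/eqP.
  by apply: eq_bigr => i _; rewrite -exprD addSn.
elim: k => [|k ih]; first by rewrite big_ord0 subr0 mulr1 addn0.
rewrite addnS pqS big_ord_recr /=.
have a0 : 0 <= Q ^+ (N + k).+1 by rewrite exprn_ge0 ?ltW.
have b0 := ltW (pq_gt0 N); have b1 := ltW (pq_gt0 (N + k)).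
have c : pq (N + k) <= pq N by apply: pq_noninc; rewrite leq_addr.
nra.
Qed.

Lemma P_neq0 : P != 0. Proof. by rewrite gt_eqF// P_gt0. Qed.

(* [1 / (Q; Q)_i], extended by [0] to negative [i]. *)
Definition inv_qfac (i : int) : R := if i is Posz n then (pq n)^-1 else 0.
Local Notation iq := inv_qfac.

#[global] Arguments inv_qfac : simpl never.

Lemma iq_ge0 (i : int) : 0 <= iq i.
Proof. by case: i => n //=; rewrite /iq invr_ge0 ltW// pq_gt0. Qed.

Lemma iq_le (i : int) : iq i <= P^-1.
Proof.
case: i => n; rewrite /iq; last by rewrite invr_ge0 ltW// P_gt0.
by rewrite lef_pV2 ?posrE ?P_gt0 ?pq_gt0 ?P_le.
Qed.

Lemma iq0 : iq 0 = 1. Proof. by rewrite /iq /= pq0 invr1. Qed.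

Lemma iq_lt0 (i : int) : i < 0 -> iq i = 0.
Proof. by case: i. Qed.

Lemma iq_cvg : iq n @[n --> \oo] --> P^-1.
Proof. by apply: cvgV pq_cvg; exact: P_neq0. Qed.

Definition qpow (i : int) : R := q ^ i.
Local Notation e := qpow.
Definition mqpow (i : int) : R := (- q) ^ i.
Local Notation m := mqpow.

Lemma eD i j : e (i + j) = e i * e j. Proof. exact: expfzDr. Qed.
Lemma eN i : e (- i) = (e i)^-1. Proof. by rewrite /e invr_expz. Qed.
Lemma e0 : e 0 = 1. Proof. by []. Qed.
Lemma e1 : e 1 = q. Proof. exact: expr1z. Qed.
Lemma e_nat (n : nat) : e n = q ^+ n. Proof. by []. Qed.
Lemma e_gt0 i : 0 < e i. Proof. exact: exprz_gt0. Qed.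
Lemma e_ge0 i : 0 <= e i. Proof. exact: ltW (e_gt0 i). Qed.
Lemma e_neq0 i : e i != 0. Proof. by rewrite gt_eqF// e_gt0. Qed.
Lemma eM (i : int) (k : nat) : e (i * k%:Z) = e i ^+ k.
Proof. by rewrite /e exprnP exprz_exp. Qed.
Lemma e_le1 i : 0 <= i -> e i <= 1.
Proof. by case: i => // n _; rewrite e_nat exprn_ile1// ltW. Qed.
Lemma e_antitone i j : i <= j -> e j <= e i.
Proof.
move=> ij; rewrite -[j](subrK i) eD ler_piMl ?e_ge0// e_le1//.
by rewrite subr_ge0.
Qed.

Let mq_neq0 : - q != 0. Proof. by rewrite oppr_eq0. Qed.
Lemma mD i j : m (i + j) = m i * m j. Proof. exact: expfzDr. Qed.
Lemma mN i : m (- i) = (m i)^-1. Proof. by rewrite /m invr_expz. Qed.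
Lemma m0 : m 0 = 1. Proof. by []. Qed.
Lemma m1 : m 1 = - q. Proof. exact: expr1z. Qed.
Lemma m_neq0 i : m i != 0. Proof. exact: expfz_neq0. Qed.
Lemma m_nat (n : nat) : m n = (-1) ^+ n * e n.
Proof. exact: exprNn. Qed.
Lemma m_norm i : `|m i| = e i.
Proof. by case: i => n; rewrite /m /e /exprz ?normfV normrX normrN gtr0_norm. Qed.

Lemma e_sqr (n : nat) : e n ^+ 2 = Q ^+ n.
Proof. by rewrite hQ -!exprM mulnC. Qed.

(** At i = 0 both sides vanish, as [inv_qfac] is 0 at -1. The relation thus holds on all of Z, and
    shifts of summation indices leave no boundary terms. *)
Lemma iq_rec (i : int) : (1 - e i ^+ 2) * iq i = iq (i - 1).
Proof.
case: i => [[|n]|n].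
- by rewrite expr1n subrr mul0r.
- rewrite (_ : n.+1%:Z - 1 = n); last lia.
  rewrite e_sqr /iq pqS invfM [_^-1 * _]mulrC mulrA mulfV ?mul1r//.
  by rewrite gt_eqF// subr_gt0 exprn_ilt1.
- by rewrite mulr0 iq_lt0//; lia.
Qed.

Lemma gauss_sum (z : R) : 0 <= z ->
  exists l, has_sum (fun k : nat => Q ^+ (k * k.-1)./2 * z ^+ k) l.
Proof.
move=> z0; pose a k := Q ^+ (k * k.-1)./2 * z ^+ k.
have a0 k : 0 <= a k by rewrite mulr_ge0 ?exprn_ge0.
have aS k : a k.+1 = Q ^+ k * z * a k.
  by rewrite /a bin2S exprD exprS; ring.
have [N hN] : exists N, forall k, (N <= k)%N -> Q ^+ k * z <= 2^-1.
  have : Q ^+ n * z @[n --> \oo] --> 0 * z.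
    by apply: cvgMl; apply: cvg_expr; rewrite ger0_norm ?ltW.
  rewrite mul0r => /cvgrPdist_le/(_ 2^-1).
  rewrite invr_gt0 ltr0n => /(_ isT) [N _ hN]; exists N => k Nk.
  have /= := hN k Nk.
  by rewrite sub0r normrN ger0_norm// mulr_ge0 ?exprn_ge0.
(* M bounds every a_k 2^k: from k = N on, these numbers do not increase, because the ratio 2 Q^k z
   is at most 1. *)
pose M := \sum_(i < N.+1) a i * 2 ^+ i.
have aM k : a k * 2 ^+ k <= M.
  have [kN|/ltnW Nk] := leqP k N.
    rewrite /M (bigD1 (inord k : 'I_N.+1))//= inordK ?ltnS// lerDl.
    by apply: sumr_ge0 => i _; rewrite mulr_ge0 ?exprn_ge0.
  rewrite -(subnKC Nk); elim: (k - N)%N => [|j ih].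
    rewrite addn0 /M big_ord_recr /= lerDr.
    by apply: sumr_ge0 => i _; rewrite mulr_ge0 ?exprn_ge0.
  rewrite addnS aS exprS; apply: le_trans ih.
  have := hN (N + j)%N (leq_addr _ _).
  have : 0 <= a (N + j)%N * 2 ^+ (N + j) by rewrite mulr_ge0 ?exprn_ge0.
  have -> : Q ^+ (N + j) * z * a (N + j)%N * (2 * 2 ^+ (N + j)) =
    2 * (Q ^+ (N + j) * z) * (a (N + j)%N * 2 ^+ (N + j)) by ring.
  nra.
have g := @has_sum_geometric R 2^-1.
have /g {}g : 0 <= (2^-1 : R) < 1 by lra.
exists (rsum a); apply: (has_sum_dom _ (has_sumZ M g)) => k.
rewrite /= -/(a k).
by rewrite ger0_norm// exprVn ler_pdivlMr ?exprn_gt0.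
Qed.

(** The coefficients of the power series of (z; Q)_oo. *)
Definition euler_coef (k : nat) : R := (-1) ^+ k * Q ^+ (k * k.-1)./2 * iq k.
Local Notation tk := euler_coef.

Lemma tk0 : tk 0 = 1.
Proof. by rewrite /tk iq0 !expr0 !mulr1. Qed.

(** The equation (z; Q)_oo = (1 - z) (zQ; Q)_oo, read on coefficients. It drives [euler2] and
    [Phi_rec]. *)
Lemma tkS (k : nat) : (1 - Q ^+ k.+1) * tk k.+1 = - Q ^+ k * tk k.
Proof.
have := iq_rec k.+1; rewrite (_ : k.+1%:Z - 1 = k); last lia.
by rewrite /tk bin2S exprD e_sqr [(-1) ^+ _]exprS => <-; ring.
Qed.

Lemma tk_norm (k : nat) : `|tk k| <= P^-1 * Q ^+ (k * k.-1)./2.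
Proof.
rewrite /tk !normrM normrX normrN1 expr1n mul1r mulrC.
rewrite (ger0_norm (iq_ge0 _)) ger0_norm ?exprn_ge0//.
by rewrite ler_wpM2r ?iq_le// exprn_ge0.
Qed.

Lemma tk_sum (z : R) (b : nat -> R) (B : R) : (forall k, `|b k| <= B) ->
  exists l, has_sum (fun k => tk k * z ^+ k * b k) l.
Proof.
move=> hb; have [l hl] := gauss_sum (normr_ge0 z).
exists (rsum (fun k => tk k * z ^+ k * b k)).
apply: (has_sum_dom _ (has_sumZ (P^-1 * B) hl)) => k.
rewrite 2!normrM normrX.
rewrite [leRHS](_ : _ = P^-1 * Q ^+ (k * k.-1)./2 * `|z| ^+ k * B); last first.
  by rewrite /=; ring.
apply: ler_pM => //.
by apply: ler_wpM2r; [exact: exprn_ge0|exact: tk_norm].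
Qed.

Lemma cvg_Qpow (k : nat) : Q ^+ (n.+1 * k) @[n --> \oo] --> ((k == 0%N)%:R : R).
Proof.
case: k => [|k].
  by under eq_fun do rewrite muln0 expr0; exact: cvg_cst.
under eq_fun do rewrite mulnC exprM exprS.
rewrite (_ : (k.+1 == 0%N)%:R = Q ^+ k.+1 * 0 :> R); last by rewrite mulr0.
  apply: cvgMr; apply: cvg_expr.
by rewrite ger0_norm ?exprn_ge0// exprn_ilt1.
Qed.

(* Euler's expansion of [1 / (Q^(k+1); Q)_oo]. *)
Lemma euler1 (k : nat) :
  has_sum (fun s : nat => Q ^+ (k.+1 * s) * iq s) (pq k / P).
Proof.
pose f k s := Q ^+ (k.+1 * s) * iq s.
have g : has_sum (fun s : nat => P^-1 * Q ^+ s) (P^-1 * (1 - Q)^-1).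
  by apply: has_sumZ; apply: has_sum_geometric; rewrite Q_ge0.
have fg j s : `|f j s| <= P^-1 * Q ^+ s.
  rewrite ger0_norm ?mulr_ge0 ?exprn_ge0 ?iq_ge0//.
  rewrite mulrC ler_pM ?exprn_ge0 ?iq_ge0 ?iq_le//.
  by rewrite ler_wiXn2l ?(ltW Q_lt1)//; lia.
have fs j : has_sum (f j) (rsum (f j)) by exact: has_sum_dom (fg j) g.
have rec j : rsum (f j.+1) = (1 - Q ^+ j.+1) * rsum (f j).
  have h1 := has_sumB (fs j) (fs j.+1).
  have h2 : has_sum (fun s => f j s - f j.+1 s) (Q ^+ j.+1 * rsum (f j)).
    apply/has_sumS; first by rewrite /f !muln0 subrr.
    apply: eq_has_sum (has_sumZ (Q ^+ j.+1) (fs j)) _ => s.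
    have := iq_rec s.+1; rewrite (_ : s.+1%:Z - 1 = s); last lia.
    rewrite /f e_sqr => <-.
    by rewrite [(j.+2 * _)%N]mulSn exprD [(j.+1 * s.+1)%N]mulnS exprD; ring.
  by have := has_sum_unique h1 h2; lra.
have rE j : rsum (f j) = pq j * rsum (f 0%N).
  by elim: j => [|j ih]; rewrite ?pq0 ?mul1r// rec ih pqS; ring.
(* The recurrence determines the sums up to the factor [rsum (f 0)]. As n tends to infinity only the
   term s = 0 survives, which fixes this factor as 1 / P. *)
have fl s : f n s @[n --> \oo] --> (s == 0%N)%:R * iq s.
  by apply: cvgMl; exact: cvg_Qpow.
have [c _] := tannery g fg fl.
have l1 : rsum (fun s : nat => (s == 0%N)%:R * iq s) = 1.
  have := @has_sum1 R _ 0%N (fun s : nat => (s == 0%N)%:R * iq s).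
  rewrite iq0 mulr1 => h; apply: has_sum_unique (has_sum_rsum (h _)) (h _).
    by case=> // j _; rewrite mul0r.
  by case=> // j _; rewrite mul0r.
have c2 : rsum (f n) @[n --> \oo] --> P * rsum (f 0%N).
  by under eq_fun do rewrite rE; apply: cvgMl; exact: pq_cvg.
have E : 1 = P * rsum (f 0%N).
  by rewrite -l1; apply: cvg_unique c c2.
apply: has_sum_val (fs k) _; rewrite rE; congr (_ * _).
by rewrite -[LHS](mulKf P_neq0) -E mulr1.
Qed.

(* Euler's expansion of [(Q^(i+1); Q)_oo], which is [0] for [i < 0]. *)
Lemma euler2 (i : int) :
  has_sum (fun k : nat => tk k * (e (i + 1) ^+ 2) ^+ k) (P * iq i).
Proof.
pose f i k := tk k * (e (i + 1) ^+ 2) ^+ k.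
have fs j : has_sum (f j) (rsum (f j)).
  have [l hl] := @tk_sum (e (j + 1) ^+ 2) (fun=> 1) 1 (fun=> ltac:(by rewrite normr1)).
  by apply: has_sum_rsum; apply: eq_has_sum hl _ => k; rewrite mulr1.
have rec j : rsum (f (j - 1)) = (1 - e j ^+ 2) * rsum (f j).
  have h1 := has_sumB (fs (j - 1)) (fs j).
  have h2 : has_sum (fun k => f (j - 1) k - f j k) (- e j ^+ 2 * rsum (f j)).
    apply/has_sumS; first by rewrite /f !expr0 subrr.
    apply: eq_has_sum (has_sumZ (- e j ^+ 2) (fs j)) _ => k.
    rewrite /f subrK; have -> : e (j + 1) ^+ 2 = e j ^+ 2 * Q.
      by rewrite eD e1 exprMn hQ.
    set w := e j ^+ 2; rewrite ![(w * Q) ^+ _]exprMn.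
    transitivity (w ^+ k.+1 * ((1 - Q ^+ k.+1) * tk k.+1)); last by ring.
    by rewrite tkS [w ^+ k.+1]exprS; ring.
  by have := has_sum_unique h1 h2; lra.
have rE (n : nat) : rsum (f n) = rsum (f 0) * iq n.
  elim: n => [|n ih]; first by rewrite iq0 mulr1.
  have := rec n.+1; have := iq_rec n.+1; rewrite (_ : n.+1%:Z - 1 = n); last lia.
  rewrite ih => <- h; have u : 1 - e n.+1 ^+ 2 != 0.
    by rewrite e_sqr gt_eqF// subr_gt0 exprn_ilt1.
  by apply: (mulfI u); rewrite -h; ring.
(* At j = 0 the factor 1 - Q^j in [rec] is 0, so the sum vanishes at -1, and then at every smaller
   index. *)
have rN (n : nat) : rsum (f (Negz n)) = 0.
  elim: n => [|n ih]; first by rewrite (_ : Negz 0 = 0 - 1)// rec e0 expr1n subrr mul0r.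
  by rewrite (_ : Negz n.+1 = Negz n - 1) ?rec ?ih ?mulr0//; lia.
have g : has_sum (fun k => `|tk k|) (rsum (fun k => `|tk k|)).
  apply: has_sum_norm; apply: eq_has_sum (fs (- 1)) _ => k.
  by rewrite /f addNr e0 !expr1n mulr1.
have fg (n : nat) k : `|f n k| <= `|tk k|.
  rewrite normrM ler_piMr// ger0_norm ?exprn_ge0//.
  by rewrite e_sqr -exprM exprn_ile1// ltW.
have fl k : f (n : nat) k @[n --> \oo] --> tk k * (k == 0%N)%:R.
  have h : (e (n%:Z + 1) ^+ 2) ^+ k @[n --> \oo] --> ((k == 0%N)%:R : R).
    have -> : (fun n : nat => (e (n%:Z + 1) ^+ 2) ^+ k) =
              (fun n => Q ^+ (n.+1 * k)).
      by apply/funext => n; rewrite exprM -e_sqr intS addrC.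
    exact: cvg_Qpow.
  by rewrite /f; apply: cvgMr.
have [c _] := tannery (f := fun n : nat => f n) g fg fl.
have l1 : rsum (fun k : nat => tk k * (k == 0%N)%:R) = 1.
  have := @has_sum1 R _ 0%N (fun k : nat => tk k * (k == 0%N)%:R).
  rewrite tk0 mulr1 => h; apply: has_sum_unique (has_sum_rsum (h _)) (h _).
    by case=> // k _; rewrite mulr0.
  by case=> // k _; rewrite mulr0.
have c2 : rsum (f (n : nat)) @[n --> \oo] --> rsum (f 0) * P^-1.
  have -> : (fun n : nat => rsum (f n)) = (fun n : nat => rsum (f 0) * iq n).
    by apply/funext => n; exact: rE.
  by apply: cvgMr; exact: iq_cvg.
have E : 1 = rsum (f 0) * P^-1 by rewrite -l1; apply: cvg_unique c c2.
apply: has_sum_val (fs i) _.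
have -> : P = rsum (f 0) by rewrite -[RHS](mulfVK P_neq0) -E mul1r.
by case: i => n; [exact: rE|rewrite rN mulr0].
Qed.

End QBasics.

Lemma has_sum_prod (R : realType) (I J : choiceType) (f : I -> R) (g : J -> R)
    (a b : R) :
  (forall i, 0 <= f i) -> (forall j, 0 <= g j) -> has_sum f a -> has_sum g b ->
  has_sum (fun z => f z.1 * g z.2) (a * b).
Proof.
move=> f0 g0 fa gb.
apply: (proj2 (@has_sum_nfubini _ _ _ (fun z => f z.1 * g z.2) (fun i => f i * b) _ _ _)).
- by move=> z; rewrite mulr_ge0.
- by move=> i /=; exact: has_sumZ.
- by rewrite mulrC; apply: eq_has_sum (has_sumZ b fa) _ => i; rewrite mulrC.
Qed.

(** * q-Bessel functions on powers of q *)

Section Bessel.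
Variables (R : realType) (q Q : R).
Hypothesis hq : 0 < q < 1.
Hypothesis hQ : Q = q ^+ 2.
Local Notation e := (qpow q).
Local Notation m := (mqpow q).
Local Notation iq := (inv_qfac Q).
Local Notation P := (qfac_inf Q).
Local Notation tk := (euler_coef Q).
Local Notation pq := (qpoch Q Q).

Let q_gt0 : 0 < q. Proof. by case/andP: hq. Qed.
Let q_lt1 : q < 1. Proof. by case/andP: hq. Qed.
Let q_neq0 : q != 0. Proof. by rewrite gt_eqF. Qed.
Let q_ge0 : 0 <= q. Proof. exact: ltW. Qed.
Let Q_gt0 : 0 < Q. Proof. by case/andP: (Q_bounds hq hQ). Qed.
Let Q_lt1 : Q < 1. Proof. by case/andP: (Q_bounds hq hQ). Qed.
Let Q_ge0 : 0 <= Q. Proof. exact: ltW. Qed.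
Let eD := eD hq.
Let mD := mD hq.
Let e_neq0 := e_neq0 hq.
Let e_ge0 := e_ge0 hq.

Definition bessel_term (nu y : int) (k : nat) : R :=
  tk k * (e (y + 1) ^+ 2) ^+ k * iq (nu + k).
Local Notation phi := bessel_term.

Definition bessel_series (nu y : int) : R := rsum (phi nu y).
Local Notation Phi := bessel_series.

(* [h nu y] is [(-q)^y J_nu(q^(2y); q^2)]; the factor [iq (nu + k)] regularizes
   the series, so that no separate definition is needed for negative [nu]. *)
Definition bessel (nu y : int) : R := m y * e (nu * y) * Phi nu y.
Local Notation h := bessel.

Lemma phi_sum (nu y : int) : has_sum (phi nu y) (Phi nu y).
Proof.
have [l hl] := @tk_sum _ _ _ hq hQ (e (y + 1) ^+ 2) (fun k => iq (nu + k)) P^-1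
  (fun k => ltac:(by rewrite ger0_norm ?(iq_ge0 hq hQ) ?(iq_le hq hQ))).
exact: has_sum_rsum hl.
Qed.

Lemma Phi_rec (nu y : int) :
  Phi (nu - 1) y - Phi (nu - 1) (y - 1) = e y ^+ 2 * Phi nu y.
Proof.
have h1 := has_sumB (phi_sum (nu - 1) y) (phi_sum (nu - 1) (y - 1)).
apply: has_sum_unique h1 _; apply/has_sumS; first by rewrite /phi !expr0 subrr.
apply: eq_has_sum (has_sumZ (e y ^+ 2) (phi_sum nu y)) _ => k.
rewrite /phi subrK (_ : nu - 1 + k.+1 = nu + k); last lia.
have -> : e (y + 1) ^+ 2 = e y ^+ 2 * Q by rewrite eD e1 exprMn hQ.
set w := e y ^+ 2; rewrite ![(w * Q) ^+ _]exprMn.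
transitivity (- w ^+ k.+1 * ((1 - Q ^+ k.+1) * tk k.+1) * iq (nu + k)); last by ring.
by rewrite (tkS hq hQ) [w ^+ k.+1]exprS; ring.
Qed.

(** Changes the order by one. It drives the induction of [coupling_base] and gives the decay of h at
    negative arguments. *)
Lemma h_rec (nu y : int) :
  h (nu - 1) y + e nu * h (nu - 1) (y - 1) = e y * h nu y.
Proof.
rewrite /h; have -> : (nu - 1) * (y - 1) = nu * y + (- nu + (- y + 1)) by ring.
have -> : (nu - 1) * y = nu * y - y by ring.
rewrite mD mN m1 !eD !eN e1.
have := Phi_rec nu y => /(canRL (subrK _)) ->.
by field; rewrite !e_neq0 q_neq0.
Qed.

Lemma Q_bin (n : nat) : Q ^+ (n * n.-1)./2 = e (n%:Z * (n%:Z - 1)).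
Proof.
elim: n => [|n ih]; first by rewrite mul0r.
rewrite bin2S exprD ih -(e_sqr hQ) -eM -eD; congr e; lia.
Qed.

(** For order -n the first n terms vanish through [inv_qfac]; the rest is the series of order n, up
    to a factor. *)
Lemma h_opp_nat (n : nat) (y : int) : h (- n%:Z) y = h n (y + n).
Proof.
suff E : Phi (- n%:Z) y =
    (-1) ^+ n * Q ^+ (n * n.-1)./2 * (e (y + 1) ^+ 2) ^+ n * Phi n (y + n).
  rewrite /h E Q_bin mD.
  have -> : (e (y + 1) ^+ 2) ^+ n = e ((y + 1) * 2%:Z * n%:Z) by rewrite !eM.
  have key : e (- n%:Z * y) * e (n%:Z * (n%:Z - 1)) * e ((y + 1) * 2%:Z * n%:Z) =
      e n * e (n%:Z * (y + n%:Z)) by rewrite -!eD; congr e; lia.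
  transitivity (m y * (-1) ^+ n * Phi n (y + n) * (e (- n%:Z * y) *
    e (n%:Z * (n%:Z - 1)) * e ((y + 1) * 2%:Z * n%:Z))); first by ring.
  by rewrite key m_nat; ring.
apply: has_sum_unique (phi_sum _ _) _.
apply/(has_sum_addn (m := n)).
  by move=> k kn; rewrite /phi iq_lt0 ?mulr0//; lia.
apply: eq_has_sum (has_sumZ _ (phi_sum n (y + n))) _ => k.
rewrite /phi (_ : - n%:Z + (n + k)%N = k); last lia.
rewrite /tk bin2D -PoszD.
have -> : e (y + n + 1) ^+ 2 = e (y + 1) ^+ 2 * Q ^+ n.
  by rewrite -(e_sqr hQ) -exprMn -eD; congr (e _ ^+ 2); ring.
by set w := e (y + 1) ^+ 2; rewrite !exprD [(w * _) ^+ k]exprMn exprM; ring.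
Qed.

Lemma h_opp (nu y : int) : h (- nu) y = h nu (y + nu).
Proof.
case: nu => n; first exact: h_opp_nat.
by rewrite NegzE opprK h_opp_nat subrK.
Qed.

Lemma h_bound0 (nu : int) : exists K, forall y, 0 <= y -> `|h nu y| <= K * e y.
Proof.
(* Negative orders become positive by [h_opp], which only increases the argument. *)
have [n hn] : exists n : nat, forall y, 0 <= y ->
    exists2 z, y <= z & h nu y = h n z.
  case: nu => n; first by exists n => y _; exists y.
  by exists n.+1 => y _; exists (y + n.+1); [lia|rewrite NegzE h_opp].
have [l hl] := @tk_sum _ _ _ hq hQ 1 (fun=> 1) 1 (fun=> ltac:(by rewrite normr1)).
have {hl} hl := has_sumZ P^-1 (has_sum_norm hl).
set L := P^-1 * _ in hl.
exists L => y y0; have [z yz ->] := hn y y0.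
have z0 : 0 <= z by exact: le_trans yz.
rewrite /h !normrM m_norm//.
have ez : e z <= e y by exact: e_antitone.
have en : `|e (n%:Z * z)| <= 1.
  by rewrite ger0_norm// e_le1//; apply: mulr_ge0.
have hP : `|Phi n z| <= L.
  apply: ler_norm_has_sum (phi_sum _ _) hl => k.
  rewrite /phi expr1n !mulr1 normrM mulrC ler_pM//.
    by rewrite ger0_norm ?(iq_ge0 hq hQ) ?(iq_le hq hQ).
  rewrite normrM ler_piMr// ger0_norm ?exprn_ge0//.
  by rewrite exprn_ile1 ?exprn_ge0// exprn_ile1// e_le1//; lia.
have L0 : 0 <= L by exact: le_trans hP.
rewrite mulrC ler_pM ?mulr_ge0//.
by rewrite -[leRHS]mulr1 ler_pM.
Qed.

Lemma h_bound (nu c : int) :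
  exists K, forall s : nat, `|h nu (s%:Z + c)| <= K * e s.
Proof.
have [K hK] := h_bound0 nu.
have K0 : 0 <= K.
  have := hK 0 (lexx _); rewrite e0 mulr1; exact: le_trans.
suff : forall c : nat, exists K, forall s : nat, `|h nu (s%:Z - c%:Z)| <= K * e s.
  case: c => [c _|c H]; last by have [L hL] := H c.+1; exists L => s; rewrite NegzE.
  exists K => s; rewrite (le_trans (hK _ _))//.
  by rewrite ler_wpM2l// e_antitone//; lia.
elim=> [|{}c [L hL]]; first by exists K => s; rewrite subr0; exact: hK.
(* The first summand covers the new point s = 0; the division by q compensates the shift of s. *)
exists (`|h nu (- c.+1%:Z)| + L / q) => -[|s].
  rewrite sub0r mulr1 lerDl divr_ge0//.
  by have := hL 0%N; rewrite mulr1; exact: le_trans.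
rewrite (_ : s.+1%:Z - c.+1%:Z = s%:Z - c%:Z); last lia.
apply: le_trans (hL s) _; rewrite mulrDl.
have -> : e s.+1 = q * e s by rewrite !e_nat exprS.
have -> : L / q * (q * e s) = L * e s by field.
by rewrite lerDr mulr_ge0// mulr_ge0.
Qed.

Lemma h_summable (nu c : int) (b : nat -> R) (B : R) : (forall s, `|b s| <= B) ->
  exists l, has_sum (fun s : nat => h nu (s%:Z + c) * b s) l.
Proof.
move=> hb; have [K hK] := h_bound nu c.
have g : has_sum (fun s : nat => K * B * q ^+ s) (K * B * (1 - q)^-1).
  by apply: has_sumZ; apply: has_sum_geometric; rewrite q_ge0.
exists (rsum (fun s : nat => h nu (s%:Z + c) * b s)).
apply: has_sum_dom _ g => s; rewrite normrM mulrAC.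
by apply: ler_pM.
Qed.

(* [h] is an eigenfunction of a q-Laplace transform. *)
Lemma h_laplace (n : nat) (r : int) :
  has_sum (fun s : nat => h n (s%:Z + r) * ((-1) ^+ s * q ^+ (s * n.+1) * iq s))
    (m r * e (n%:Z * r) * iq r).
Proof.
pose u := e (r + 1) ^+ 2.
pose F (z : nat * nat) : R :=
  (Q ^+ (n.+1 * z.2) * iq z.2) * (tk z.1 * u ^+ z.1 * Q ^+ (z.2 * z.1) * iq (n + z.1)%N).
have [l hl] := @tk_sum _ _ _ hq hQ u (fun=> 1) 1 (fun=> ltac:(by rewrite normr1)).
have {hl} hl := has_sumZ P^-1 (has_sum_norm hl).
have FT : has_sum F (rsum F).
  have := has_sum_prod _ _ hl (euler1 hq hQ n) => /=.
  move=> H; apply: has_sum_dom (H _ _) => [[k s]|k|s] /=.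
  - rewrite /F /= normrM (@ger0_norm _ (_ * iq s)); last first.
      by rewrite mulr_ge0 ?exprn_ge0// (iq_ge0 hq hQ).
    rewrite mulrC; apply: ler_wpM2r.
      by rewrite mulr_ge0 ?exprn_ge0// (iq_ge0 hq hQ).
    rewrite mulr1; set w := tk k * u ^+ k.
    rewrite 2!normrM -mulrA mulrC; apply: ler_wpM2r => //.
    rewrite -[leRHS]mul1r; apply: ler_pM => //.
      by rewrite ger0_norm ?exprn_ge0// exprn_ile1// ltW.
    by rewrite ger0_norm ?(iq_ge0 hq hQ) ?(iq_le hq hQ).
  - by rewrite mulr_ge0// invr_ge0 ltW// (P_gt0 hq hQ).
  - by rewrite mulr_ge0 ?exprn_ge0// (iq_ge0 hq hQ).
(* Summation over s first: [euler1] produces (Q; Q)_(n+k) / P, which cancels the denominator of the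
   Bessel series and leaves the series of [euler2]. *)
have s1 : has_sum (fun k : nat => P^-1 * (tk k * u ^+ k)) (rsum F).
  apply: has_sum_fubini FT _ => k.
  apply: has_sum_val (eq_has_sum (has_sumZ (tk k * u ^+ k * iq (n + k)%N)
    (euler1 hq hQ (n + k))) _) _ => [s|] /=.
    by rewrite /F /= -addSn mulnDl exprD [(k * s)%N]mulnC; ring.
  have -> : iq (n + k)%N = (pq (n + k))^-1 by [].
  by field; rewrite (pq_neq0 hq hQ) (P_neq0 hq hQ).
have s2 := has_sumZ P^-1 (euler2 hq hQ r).
have rF : rsum F = iq r.
  by rewrite (has_sum_unique s1 s2) mulKf// (P_neq0 hq hQ).
have s3 : has_sum (fun s : nat => Q ^+ (n.+1 * s) * iq s * Phi n (s%:Z + r)) (rsum F).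
  apply: has_sum_fubini (has_sum_swap FT) _ => s /=.
  apply: eq_has_sum (has_sumZ (Q ^+ (n.+1 * s) * iq s) (phi_sum n (s%:Z + r))) _ => k.
  rewrite /F /phi /=; have -> : e (s%:Z + r + 1) ^+ 2 = u * Q ^+ s.
    by rewrite /u -(e_sqr hQ) -exprMn -eD; congr (e _ ^+ 2); ring.
  rewrite [(u * _) ^+ k]exprMn [Q ^+ (s * k)]exprM -PoszD; ring.
rewrite -rF; apply: eq_has_sum (has_sumZ (m r * e (n%:Z * r)) s3) _ => s /=.
rewrite /h mD [n%:Z * (_ + _)]mulrDr eD.
rewrite m_nat e_nat.
have -> : Q ^+ (n.+1 * s) = q ^+ s * e (n%:Z * s%:Z) * q ^+ (s * n.+1).
  rewrite -(e_sqr hQ) -!(e_nat q) -!eD -eM; congr e; lia.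
have s0 : (-1) ^+ s * (-1) ^+ s = 1 :> R by rewrite -exprMn mulrNN mulr1 expr1n.
by rewrite -[LHS]mul1r -[X in X * _]s0; set g := (-1) ^+ s; ring.
Qed.

End Bessel.

(** * Clebsch-Gordan coefficients *)

Section Clebsch.
Variables (R : realType) (q Q : R).
Hypothesis hq : 0 < q < 1.
Hypothesis hQ : Q = q ^+ 2.
Local Notation e := (qpow q).
Local Notation m := (mqpow q).

Let q_gt0 : 0 < q. Proof. by case/andP: hq. Qed.
Let q_lt1 : q < 1. Proof. by case/andP: hq. Qed.
Let q_neq0 : q != 0. Proof. by rewrite gt_eqF. Qed.
Let q_ge0 : 0 <= q. Proof. exact: ltW. Qed.
Let qn_neq0 n : q ^+ n != 0. Proof. by rewrite expf_neq0. Qed.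
Let QE n : Q ^+ n = (q ^+ n) ^+ 2. Proof. by rewrite hQ -!exprM mulnC. Qed.

(* The Clebsch-Gordan coefficient is
   [(-q)^x sqrt((Q;Q)_oo / ((Q;Q)_x (Q;Q)_a (Q;Q)_b)) cg_poly x a b], where
   [cg_poly] is symmetric in its three arguments. *)
Fixpoint cg_poly (x a b : nat) : R :=
  if x is x'.+1 then
    q ^+ a * q ^+ b * cg_poly x' a b
      - q^-1 * (1 - Q ^+ a) * (1 - Q ^+ b) * cg_poly x' a.-1 b.-1
  else q ^+ (a * b).
Local Notation G := cg_poly.

Lemma GS x a b : G x.+1 a b = q ^+ a * q ^+ b * G x a b
      - q^-1 * (1 - Q ^+ a) * (1 - Q ^+ b) * G x a.-1 b.-1.
Proof. by []. Qed.

Lemma G_sym x a b : G x a b = G x b a.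
Proof.
elim: x a b => [|x ih] a b; first by rewrite /= mulnC.
by rewrite !GS (ih a b) (ih a.-1 b.-1); ring.
Qed.

Lemma G0 x b : G x 0 b = q ^+ (x * b).
Proof.
elim: x => [|x ih]; first by [].
by rewrite GS ih !expr0 subrr mulr0 !mul0r subr0 mul1r mulSn exprD.
Qed.

(** Raises one argument and lowers another. The next two relations are its images under permutations
    of x, a, b; each follows by eliminating values between the recursion and relations already
    known. *)
Lemma G_raise x a b :
  q ^+ b * G x a.+1 b + (1 - Q ^+ b) * q ^+ a * G x a b.-1 = q ^+ x * G x a b.
Proof.
elim: x a b => [|x ih] a b.
  case: b => [|b] /=; first by rewrite !muln0 !expr0; ring.
  by rewrite QE mulSn mulnS !exprD; ring.
have E1 : G x a.+1 b = (q ^+ x * G x a b - (1 - Q ^+ b) * q ^+ a * G x a b.-1) / q ^+ b.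
  by rewrite -ih; field.
rewrite !GS E1 -[a.+1.-1]/a ![_ ^+ _.+1]exprS.
case: b => [|b] in E1 *; first by rewrite !expr0; field.
case: a => [|a] in E1 *.
  by rewrite !expr0 ![_ ^+ _.+1]exprS !QE hQ; field; rewrite !qn_neq0 q_neq0.
have E2 : G x a b = (q ^+ b * G x a.+1 b + (1 - Q ^+ b) * q ^+ a * G x a b.-1) / q ^+ x.
  by rewrite ih; field.
rewrite /= E2 ![_ ^+ _.+1]exprS !QE hQ.
by field; rewrite !qn_neq0 q_neq0.
Qed.

Lemma G_raise' x a b :
  q ^+ x * G x a.+1 b + (1 - Q ^+ x) * q ^+ a * G x.-1 a b = q ^+ b * G x a b.
Proof.
case: x => [|x]; first by rewrite /= mulSn exprD !expr0; ring.
have E1 : G x a.+1 b = (q ^+ x * G x a b - (1 - Q ^+ b) * q ^+ a * G x a b.-1) / q ^+ b.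
  by rewrite -G_raise; field.
rewrite /= E1.
case: b => [|b] in E1 *.
  by rewrite !expr0 ![_ ^+ _.+1]exprS !QE hQ; field; rewrite ?qn_neq0 ?q_neq0.
have := G_raise x b a; rewrite ![G x _ a]G_sym [G x b _]G_sym => h.
have E2 : G x a b = (q ^+ a * G x a b.+1 + (1 - Q ^+ a) * q ^+ b * G x a.-1 b) / q ^+ x.
  by rewrite h; field.
rewrite /= E2 ![_ ^+ _.+1]exprS !QE hQ.
by field; rewrite !qn_neq0 q_neq0.
Qed.

Lemma G_raise'' x a b :
  q ^+ a * G x.+1 a b + (1 - Q ^+ a) * q ^+ x * G x a.-1 b = q ^+ b * G x a b.
Proof.
rewrite GS; case: a => [|a]; first by rewrite !expr0 /=; ring.
have E1 : G x a b = (q ^+ b * G x a.+1 b + (1 - Q ^+ b) * q ^+ a * G x a b.-1) / q ^+ x.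
  by rewrite G_raise; field.
rewrite /= E1 ![_ ^+ _.+1]exprS !QE hQ.
by field; rewrite !qn_neq0 q_neq0.
Qed.

(** The defining recursion with the roles of x and b exchanged. *)
Lemma G_step x a b : G x a b.+1 =
  q ^+ x * q ^+ a * G x a b - q^-1 * (1 - Q ^+ x) * (1 - Q ^+ a) * G x.-1 a.-1 b.
Proof.
case: x => [|x]; first by rewrite /= mulnS exprD !expr0 subrr; ring.
have h1 := G_raise' x.+1 b a; rewrite ![G _ _ a]G_sym -[x.+1.-1]/x in h1.
have E1 : G x.+1 a b.+1 =
   (q ^+ a * G x.+1 a b - (1 - Q ^+ x.+1) * q ^+ b * G x a b) / q ^+ x.+1.
  by rewrite -h1; field.
have E2 : G x a b = (q ^+ a * G x.+1 a b + (1 - Q ^+ a) * q ^+ x * G x a.-1 b) / q ^+ b.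
  by rewrite G_raise''; field.
rewrite -[x.+1.-1]/x E1 E2 ![_ ^+ _.+1]exprS !QE hQ.
by field; rewrite !qn_neq0 q_neq0.
Qed.

(** The adjoint of the recursion in x: paired with it in [gram_rec], it shows that raising one root
    label amounts to lowering the other. *)
Lemma G_adj x a b : G x a.+1 b.+1 - q * q ^+ a * q ^+ b * G x a b =
  - q^-1 * (1 - Q ^+ x) * G x.-1 a b.
Proof.
have E1 : G x a.+1 b = (q ^+ b * G x a b - (1 - Q ^+ x) * q ^+ a * G x.-1 a b) / q ^+ x.
  by rewrite -G_raise'; field.
rewrite G_step E1 /= ![_ ^+ _.+1]exprS !QE hQ.
by field; rewrite !qn_neq0 q_neq0.
Qed.

Let Q_ge0 : 0 <= Q. Proof. by rewrite hQ exprn_ge0. Qed.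
Let Q_le1 : Q <= 1. Proof. by rewrite hQ exprn_ile1// ltW. Qed.
Let one_sub n : `|1 - Q ^+ n| <= 1.
Proof.
have h0 : 0 <= Q ^+ n by rewrite exprn_ge0.
have h1 : Q ^+ n <= 1 by rewrite exprn_ile1.
by rewrite ger0_norm; lra.
Qed.
Let qn_ge0 n : 0 <= q ^+ n. Proof. by rewrite exprn_ge0. Qed.
Let qn_le1 n : q ^+ n <= 1. Proof. by rewrite exprn_ile1// ltW. Qed.


Lemma G_bound x : exists B, forall a b, `|G x a b| <= B.
Proof.
elim: x => [|x [B h]]; first by exists 1 => a b /=; rewrite ger0_norm.
have B0 : 0 <= B by exact: le_trans (h 0%N 0%N).
exists (B + q^-1 * B) => a b; rewrite GS; apply: le_trans (ler_normB _ _) _.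
rewrite !normrM !(ger0_norm (qn_ge0 _)) (@ger0_norm _ q^-1) ?invr_ge0//.
rewrite lerD//.
  rewrite (le_trans _ (h a b))// ler_piMl// -[leRHS]mul1r ler_pM//.
rewrite -!mulrA ler_wpM2l ?invr_ge0// (le_trans _ (h a.-1 b.-1))//.
by rewrite mulrA ler_piMl// -[leRHS]mul1r ler_pM.
Qed.

(** Provides summability along the lines b = a + p. In [G_raise'] both terms that give the value at
    a + 1 carry a factor q^a or q^b. *)
Lemma G_decay x : exists K, forall a b, `|G x a b| <= K * (q ^+ a + q ^+ b).
Proof.
have [B h] := G_bound x; have [B' h'] := G_bound x.-1.
have B0 : 0 <= B by exact: le_trans (h 0%N 0%N).
have B'0 : 0 <= B' by exact: le_trans (h' 0%N 0%N).
(* The summand 1 covers a = 0, where [cg_poly] is just a power of q. *)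
pose K := 1 + (B + B') / q ^+ x / q.
have K1 : 1 <= K by rewrite lerDl !mulr_ge0 ?invr_ge0// addr_ge0.
exists K => -[|a] b.
  rewrite G0 ger0_norm// expr0 (le_trans (qn_le1 _))//.
  by rewrite (le_trans K1)// ler_peMr ?(le_trans _ K1)// lerDl.
have -> : G x a.+1 b = (q ^+ b * G x a b - (1 - Q ^+ x) * q ^+ a * G x.-1 a b) / q ^+ x.
  by rewrite -G_raise'; field.
apply: (@le_trans _ _ ((B + B') / q ^+ x / q * (q ^+ a.+1 + q ^+ b))); last first.
  by rewrite ler_wpM2r ?addr_ge0// /K lerDr.
have -> : (B + B') / q ^+ x / q * (q ^+ a.+1 + q ^+ b) =
   ((B + B') * (q ^+ a + q ^+ b / q)) / q ^+ x.
  by rewrite exprS; field; rewrite q_neq0 qn_neq0.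
rewrite normrM (@ger0_norm _ (_^-1)) ?invr_ge0// ler_wpM2r ?invr_ge0//.
apply: le_trans (ler_normB _ _) _; rewrite !normrM !(ger0_norm (qn_ge0 _)).
have t1 : q ^+ b * `|G x a b| <= q ^+ b / q * B.
  by apply: ler_pM => //; rewrite ler_pdivlMr// ler_piMr// ltW.
have t2 : `|1 - Q ^+ x| * q ^+ a * `|G x.-1 a b| <= q ^+ a * B'.
  by apply: ler_pM => //; [exact: mulr_ge0|rewrite ler_piMl].
have u1 : 0 <= q ^+ a * B by exact: mulr_ge0.
have u2 : 0 <= q ^+ b / q * B' by rewrite !mulr_ge0 ?invr_ge0.
apply: le_trans (lerD t1 t2) _.
rewrite mulrDr !mulrDl; lra.
Qed.

(** The value 0 at negative labels turns sums over N into sums over Z, where indices can be shifted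
    freely. *)
Definition cg_core (x a b : int) : R :=
  match x, a, b with
  | Posz x', Posz a', Posz b' => m x * G x' a' b'
  | _, _, _ => 0
  end.
Local Notation cz := cg_core.

Lemma cz_x_lt0 x a b : x < 0 -> cz x a b = 0. Proof. by case: x. Qed.
Lemma cz_a_lt0 x a b : a < 0 -> cz x a b = 0. Proof. by case: x; case: a. Qed.
Lemma cz_b_lt0 x a b : b < 0 -> cz x a b = 0.
Proof. by case: x; case: a; case: b. Qed.
Lemma cz_sym x a b : cz x a b = cz x b a.
Proof. by case: x => x; case: a => a; case: b => b //=; rewrite G_sym. Qed.
Lemma czE (x a b : nat) : cz x a b = m x * G x a b. Proof. by []. Qed.

Lemma cz_step (x a b : int) : 0 <= x -> cz (x + 1) a b =
  (1 - e a ^+ 2) * (1 - e b ^+ 2) * cz x (a - 1) (b - 1)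
    - q * e a * e b * cz x a b.
Proof.
case: x => // x _; case: a => a; last first.
  by rewrite !(@cz_a_lt0 _ (Negz a))// cz_a_lt0 ?mulr0 ?subrr//; lia.
case: b => b; last first.
  by rewrite !(@cz_b_lt0 _ _ (Negz b))// cz_b_lt0 ?mulr0 ?subrr//; lia.
have -> : x%:Z + 1 = x.+1 by lia.
rewrite !czE GS intS mD// m1 !(e_sqr hQ) !e_nat.
case: a => [|a]; first by rewrite !expr0 subrr !mul0r mulr0 mul0r; ring.
case: b => [|b]; first by rewrite !expr0 subrr !mulr0 !mul0r; ring.
rewrite (_ : a.+1%:Z - 1 = a); last lia.
rewrite (_ : b.+1%:Z - 1 = b); last lia.
by rewrite czE /=; field.
Qed.

Lemma cz_raise (x a b : int) : 0 <= a ->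
  e b * cz x (a + 1) b + (1 - e b ^+ 2) * e a * cz x a (b - 1) = e x * cz x a b.
Proof.
case: a => // a _; case: x => x; last by rewrite !cz_x_lt0// !mulr0 addr0.
case: b => b; last first.
  by rewrite !(@cz_b_lt0 _ _ (Negz b))// cz_b_lt0 ?mulr0 ?addr0//; lia.
have -> : a%:Z + 1 = a.+1 by lia.
rewrite !czE !(e_sqr hQ) !e_nat.
have h := G_raise x a b.
case: b h => [|b] h.
  by move: h; rewrite !expr0 subrr !mul0r !addr0 mul1r => ->; ring.
rewrite (_ : b.+1%:Z - 1 = b); last lia.
rewrite czE; transitivity (m x * (q ^+ x * G x a b.+1)); last by ring.
by rewrite -h /=; ring.
Qed.

Lemma cz_raise_r (x a b : int) : 0 <= b ->
  e a * cz x a (b + 1) + (1 - e a ^+ 2) * e b * cz x (a - 1) b = e x * cz x a b.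
Proof. by move=> b0; rewrite ![cz x _ b]cz_sym ![cz x a _]cz_sym cz_raise// cz_sym. Qed.

Lemma cz_step_r (x a b : int) : 0 <= b -> cz x a (b + 1) =
  (1 - e x ^+ 2) * (1 - e a ^+ 2) * cz (x - 1) (a - 1) b + e x * e a * cz x a b.
Proof.
case: b => // b _; case: x => x; last first.
  by rewrite !(@cz_x_lt0 (Negz x))// cz_x_lt0 ?mulr0 ?addr0//; lia.
case: a => a; last first.
  by rewrite !(@cz_a_lt0 _ (Negz a))// cz_a_lt0 ?mulr0 ?addr0//; lia.
have -> : b%:Z + 1 = b.+1 by lia.
rewrite !czE G_step !(e_sqr hQ) !e_nat.
case: x => [|x]; first by rewrite !expr0 subrr !mulr0 !mul0r; ring.
case: a => [|a]; first by rewrite !expr0 subrr !mulr0 !mul0r; ring.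
rewrite (_ : x.+1%:Z - 1 = x); last lia.
rewrite (_ : a.+1%:Z - 1 = a); last lia.
by rewrite czE intS mD// m1 /=; field.
Qed.

Lemma cz_adj (x a b : int) : 0 <= a -> 0 <= b ->
  cz x (a + 1) (b + 1) - q * e a * e b * cz x a b
    = (1 - e x ^+ 2) * cz (x - 1) a b.
Proof.
case: a => // a _; case: b => // b _.
case: x => x; last by rewrite !(@cz_x_lt0 (Negz x))// cz_x_lt0 ?mulr0 ?subr0//; lia.
have -> : a%:Z + 1 = a.+1 by lia.
have -> : b%:Z + 1 = b.+1 by lia.
have h := G_adj x a b.
rewrite !czE (e_sqr hQ) !e_nat.
have -> : m x * G x a.+1 b.+1 - q * q ^+ a * q ^+ b * (m x * G x a b) =
  m x * (- q^-1 * (1 - Q ^+ x) * G x.-1 a b) by rewrite -h; ring.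
case: x {h} => [|x]; first by rewrite !expr0 subrr !mulr0 !mul0r mulr0.
rewrite (_ : x.+1%:Z - 1 = x); last lia.
by rewrite czE intS mD// m1 /=; field.
Qed.

Lemma cz0 (a b : nat) : cz 0 a b = q ^+ (a * b).
Proof. by rewrite (czE 0%N) m0 mul1r. Qed.

Lemma cz_0 (x b : nat) : cz x 0 b = m x * q ^+ (x * b).
Proof. by rewrite (czE x 0%N) G0. Qed.

End Clebsch.

(** * The coupling relation *)

Section Coupling.
Variables (R : realType) (q Q : R).
Hypothesis hq : 0 < q < 1.
Hypothesis hQ : Q = q ^+ 2.
Local Notation e := (qpow q).
Local Notation iq := (inv_qfac Q).
Local Notation h := (bessel q Q).
Local Notation cz := (cg_core q Q).

Let q_gt0 : 0 < q. Proof. by case/andP: hq. Qed.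
Let q_lt1 : q < 1. Proof. by case/andP: hq. Qed.
Let q_neq0 : q != 0. Proof. by rewrite gt_eqF. Qed.
Let q_ge0 : 0 <= q. Proof. exact: ltW. Qed.
Let e_neq0 := e_neq0 hq.
Let iq_rec := iq_rec hq hQ.

(** The coupling relation at x = a = 0, where a, b stand for its labels b, c. For b = 0 this is
    [h_laplace]; in the step, [h_rec] on the left matches [cz_step_r] on the right. *)
Lemma coupling_base (a b : nat) (r : int) :
  has_sum (fun s : nat => h (a%:Z - b%:Z) (s%:Z + (r - b%:Z)) *
      ((-1) ^+ s * q ^+ (s * (a + b).+1) * iq s))
    (cz r a b * iq r).
Proof.
elim: b a r => [|b ih] a r.
  rewrite !subr0 addn0; apply: has_sum_val (h_laplace hq hQ a r) _.
  case: r => r; last by rewrite !iq_lt0 ?mulr0.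
  by rewrite cz_sym cz_0// -PoszM e_nat mulnC.
pose f1 (s : nat) := h (a%:Z - b%:Z - 1) (s%:Z + (r - b%:Z) - 1) *
   ((-1) ^+ s * q ^+ (s * (a + b)) * iq s).
pose f2 (s : nat) := h (a%:Z - b%:Z) (s%:Z + (r - b%:Z)) *
   ((-1) ^+ s * q ^+ (s * (a + b).+1) * iq s).
have [l1 s1] : exists l1, has_sum f1 l1.
  have bd (s : nat) : `|(-1) ^+ s * q ^+ (s * (a + b)) * iq s| <= (qfac_inf Q)^-1.
    rewrite !normrM normrX normrN1 expr1n mul1r -[leRHS]mul1r ler_pM//.
      by rewrite ger0_norm ?exprn_ge0// exprn_ile1// ltW.
    by rewrite ger0_norm ?(iq_ge0 hq hQ) ?(iq_le hq hQ).
  have [l hl] := h_summable hq hQ (a%:Z - b%:Z - 1) (r - b%:Z - 1) bd.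
  by exists l; apply: eq_has_sum hl _ => s; rewrite /f1 addrA.
(* The induction hypothesis gives l1 for a > 0 only; at a = 0 the factor 1 - Q^a vanishes. *)
have l1E : (1 - e a ^+ 2) * l1 = (1 - e a ^+ 2) * (cz (r - 1) (a%:Z - 1) b * iq (r - 1)).
  have [a0|a0] := posnP a; first by rewrite a0 expr1n subrr !mul0r.
  congr (_ * _); rewrite (_ : a%:Z - 1 = a.-1); last lia.
  apply: has_sum_unique s1 _; apply: eq_has_sum (ih a.-1 (r - 1)) _ => s.
  rewrite /f1 -addSn prednK//; congr (h _ _ * _); lia.
have s2 : has_sum f2 (cz r a b * iq r) by exact: ih.
pose f3 (s : nat) := h (a%:Z - b.+1%:Z) (s%:Z + (r - b.+1%:Z)) *
      ((-1) ^+ s * q ^+ (s * (a + b.+1).+1) * iq s).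
(* The terms of f3 are those of f1 times Q^s. The factor 1 - Q^s turns iq s into iq (s - 1), so the
   difference starts at s = 1 and can be shifted before [h_rec] is applied. *)
have s3 : has_sum (fun s => f3 s - f1 s)
    (e a * e r * (cz r a b * iq r) - e a ^+ 2 * l1).
  apply/has_sumS.
    rewrite /f3 /f1 !mul0n; apply/eqP; rewrite subr_eq0; apply/eqP.
    by congr (h _ _ * _); lia.
  apply: eq_has_sum (has_sumB (has_sumZ (e a * e r) s2) (has_sumZ (e a ^+ 2) s1)) _ => s.
  rewrite /f1 /f2 /f3.
  have -> : a%:Z - b.+1%:Z = a%:Z - b%:Z - 1 by lia.
  have -> : s.+1%:Z + (r - b.+1%:Z) = s%:Z + (r - b%:Z) by lia.
  have -> : s.+1%:Z + (r - b%:Z) - 1 = s%:Z + (r - b%:Z) by lia.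
  have := h_rec hq hQ (a%:Z - b%:Z) (s%:Z + (r - b%:Z)).
  move=> /(canRL (addrK _)); rewrite !(eD hq) !eN => ->.
  have := iq_rec s.+1; rewrite (_ : s.+1%:Z - 1 = s); last lia.
  rewrite (e_nat _ s.+1) exprS => <-.
  rewrite !e_nat addnS [(s.+1 * (a + b))%N]mulnC [(s.+1 * _)%N]mulnC.
  rewrite [(s * (a + b).+1)%N]mulnC [(s * (a + b))%N]mulnC !mulSn !mulnS !exprD.
  by rewrite !exprS; field; rewrite expf_neq0.
apply: has_sum_val (eq_has_sum (has_sumD s1 s3) _) _ => [s|].
  by rewrite /f3 addrC subrK.
rewrite (_ : b.+1%:Z = b%:Z + 1); last lia.
rewrite (cz_step_r hq hQ)// mulrDl.
transitivity ((1 - e a ^+ 2) * l1 + e a * e r * (cz r a b * iq r)); first by ring.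
by rewrite l1E -iq_rec; ring.
Qed.

(** The factor iq (x - 1) vanishes for x < 1, which frees the recursion from its side condition. *)
Lemma cz_step_iq (x a b : int) : iq (x - 1) * cz x a b =
  iq (x - 1) * ((1 - e a ^+ 2) * (1 - e b ^+ 2) * cz (x - 1) (a - 1) (b - 1)
    - q * e a * e b * cz (x - 1) a b).
Proof.
have [x0|x0] := leP 1 x; last by rewrite iq_lt0 ?mul0r//; lia.
by rewrite -(cz_step hq hQ) ?subrK//; lia.
Qed.

Lemma cz0_raise (a b : int) : 0 <= b -> cz 0 a (b + 1) = e a * cz 0 a b.
Proof.
case: b => // b _; case: a => a; last by rewrite !cz_a_lt0// mulr0.
rewrite (_ : b%:Z + 1 = b.+1); last lia.
by rewrite !cz0 e_nat mulnS exprD.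
Qed.

(** A term of the coupling relation without square roots: the normalizations of x, a, b, c are
    common to both sides, and those of s and of r occur twice and become iq s and iq r. *)
Definition lsum (x a b c r s : int) : R :=
  h (x + b - a - c) (r + s - a - c) * (cz x s c * cz s a b * iq s).

Definition rterm (x a b c r : int) : R := cz x a r * cz r b c * iq r.

Lemma lsum0 (x a b c r : int) : (x < 0) || (a < 0) || (b < 0) || (c < 0) ->
  has_sum (lsum x a b c r) (rterm x a b c r).
Proof.
move=> n; have -> : lsum x a b c r = fun=> 0.
  apply/funext => s; rewrite /lsum.
  case/orP: n => [/orP[/orP[]|]|] n; rewrite ?(cz_x_lt0 _ _ _ _ n)//
    ?(cz_a_lt0 _ _ _ _ n) ?(cz_b_lt0 _ _ _ _ n); ring.
suff -> : rterm x a b c r = 0 by exact: has_sum0.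
rewrite /rterm; case/orP: n => [/orP[/orP[]|]|] n; rewrite ?(cz_x_lt0 _ _ _ _ n)//
    ?(cz_a_lt0 _ _ _ _ n) ?(cz_b_lt0 _ _ _ _ n); ring.
Qed.

Lemma coupling00 (b c r : int) : has_sum (lsum 0 0 b c r) (rterm 0 0 b c r).
Proof.
have [b0|b0] := ltP b 0; first by apply: lsum0; rewrite b0 !orbT.
have [c0|c0] := ltP c 0; first by apply: lsum0; rewrite c0 !orbT.
case: b b0 => // b _; case: c c0 => // c _.
apply/has_sum_nat_int => [k|]; first by rewrite /lsum (@iq_lt0 _ _ (Negz k))// !mulr0.
apply: has_sum_val (eq_has_sum (coupling_base b c r) _) _ => [s|].
  rewrite /lsum cz_0// cz0 m_nat e_nat; congr (h _ _ * _); [lia|lia|].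
  by rewrite mulnS mulnDr !exprD; ring.
rewrite /rterm; case: r => r; last by rewrite !(@iq_lt0 _ _ (Negz r))// !mulr0.
by rewrite (cz0 _ _ 0) mul0n expr0 mul1r.
Qed.

(** Induction on a: [cz_raise] expresses the coefficient at n + 1 through two coefficients at n, and
    the resulting sums share the arguments of h. *)
Lemma coupling0 (n : nat) (b c r : int) :
  has_sum (lsum 0 n b c r) (rterm 0 n b c r).
Proof.
elim: n b c r => [|n ih] b c r; first exact: coupling00.
have [b0|b0] := ltP b 0; first by apply: lsum0; rewrite b0 !orbT.
have [c0|c0] := ltP c 0; first by apply: lsum0; rewrite c0 !orbT.
rewrite intS addrC.
have s1 := ih b (c + 1) r; have s2 := ih (b - 1) c (r - 1).
have := has_sumZ (e b)^-1 (has_sumB s1 (has_sumZ ((1 - e b ^+ 2) * e n) s2)).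
move=> H; apply: has_sum_val (eq_has_sum H _) _ => [s|].
  rewrite /lsum.
  have -> : 0 + b - n%:Z - (c + 1) = 0 + b - (n%:Z + 1) - c by lia.
  have -> : r + s - n%:Z - (c + 1) = r + s - (n%:Z + 1) - c by lia.
  have -> : 0 + (b - 1) - n%:Z - c = 0 + b - (n%:Z + 1) - c by lia.
  have -> : r - 1 + s - n%:Z - c = r + s - (n%:Z + 1) - c by lia.
  rewrite cz0_raise//.
  have E := cz_raise hq hQ s b (isT : 0 <= n%:Z).
  have -> : cz s (n%:Z + 1) b =
      (e s * cz s n b - (1 - e b ^+ 2) * e n * cz s n (b - 1)) / e b.
    by rewrite -E; field.
  by field.
rewrite /rterm (cz_step_r hq hQ)// [cz 0 (n%:Z + 1) r]cz_sym cz0_raise// [cz 0 r n]cz_sym.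
have E : e n * cz 0 n (r - 1) * iq (r - 1) = cz 0 n r * iq (r - 1).
  have [r0|r0] := leP 1 r; last by rewrite iq_lt0 ?mulr0//; lia.
  have := @cz0_raise n (r - 1); rewrite subrK => -> //; lia.
transitivity ((e b)^-1 * (cz 0 n r * ((1 - e r ^+ 2) * (1 - e b ^+ 2) *
   cz (r - 1) (b - 1) c + e r * e b * cz r b c) * iq r -
   (1 - e b ^+ 2) * cz (r - 1) (b - 1) c * (e n * cz 0 n (r - 1) * iq (r - 1)))).
  by ring.
by rewrite E -iq_rec; field.
Qed.

(** Induction on x. The four instances at x are chosen so that h has the same arguments in all of
    them; what remains on either side is the recursion in x combined with a raising relation. *)
Lemma coupling (x a b c r : int) : has_sum (lsum x a b c r) (rterm x a b c r).
Proof.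
have [x0|x0] := ltP x 0; first by apply: lsum0; rewrite x0.
case: x x0 => // x _; elim: x a b c r => [|x ih] a b c r.
  have [a0|a0] := ltP a 0; first by apply: lsum0; rewrite a0 !orbT.
  by case: a a0 => // a _; exact: coupling0.
have [a0|a0] := ltP a 0; first by apply: lsum0; rewrite a0 !orbT.
have [b0|b0] := ltP b 0; first by apply: lsum0; rewrite b0 !orbT.
have [c0|c0] := ltP c 0; first by apply: lsum0; rewrite c0 !orbT.
rewrite intS addrC.
have s1 := has_sum_shift (- 1) (ih (a - 1) (b - 1) (c - 1) (r - 1)).
have s2 := has_sum_shift (- 1) (ih a b (c - 1) r).
have s3 := ih a (b + 1) c r.
have s4 := ih (a - 1) b c (r - 1).
have H := has_sumB (has_sumB (has_sumB
  (has_sumZ ((1 - e a ^+ 2) * (1 - e b ^+ 2) * (1 - e c ^+ 2)) s1)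
  (has_sumZ ((1 - e c ^+ 2) * q * e a * e b) s2))
  (has_sumZ (q * e c * e a) s3)) (has_sumZ (q * e c * (1 - e a ^+ 2) * e b) s4).
apply: has_sum_val (eq_has_sum H _) _ => [s|].
  rewrite /lsum.
  have -> : x%:Z + (b - 1) - (a - 1) - (c - 1) = x%:Z + 1 + b - a - c by lia.
  have -> : r - 1 + (s - 1) - (a - 1) - (c - 1) = r + s - a - c by lia.
  have -> : x%:Z + b - a - (c - 1) = x%:Z + 1 + b - a - c by lia.
  have -> : r + (s - 1) - a - (c - 1) = r + s - a - c by lia.
  have -> : x%:Z + (b + 1) - a - c = x%:Z + 1 + b - a - c by lia.
  have -> : x%:Z + b - (a - 1) - c = x%:Z + 1 + b - a - c by lia.
  have -> : r - 1 + s - (a - 1) - c = r + s - a - c by lia.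
  rewrite (cz_step hq hQ)//.
  transitivity (h (x%:Z + 1 + b - a - c) (r + s - a - c) *
    ((1 - e c ^+ 2) * cz x (s - 1) (c - 1) * (iq (s - 1) * cz s a b)
     - q * e c * cz x s c * iq s * (e s * cz s a b))).
    rewrite -(cz_raise_r hq hQ s a b0) cz_step_iq; ring.
  by rewrite -iq_rec; ring.
rewrite /rterm (cz_step hq hQ)//.
transitivity ((1 - e a ^+ 2) * cz x (a - 1) (r - 1) * (iq (r - 1) * cz r b c)
     - q * e a * cz x a r * iq r * (e r * cz r b c)).
  rewrite -(cz_raise hq hQ r c b0) cz_step_iq; ring.
by rewrite -iq_rec; ring.
Qed.

End Coupling.

Lemma has_sum_term (R : realType) (I : choiceType) (f : I -> R) (l : R) (i : I) :
  (forall j, 0 <= f j) -> has_sum f l -> f i <= l.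
Proof.
move=> f0 fl; have := @has_sum1 R I i (fun j => if j == i then f j else 0).
rewrite eqxx => H; apply: ler_has_sum (H _) fl => j.
  by case: ifP.
by move=> /eqP/negPf ->.
Qed.

(** * Orthonormality and hypergeometric form of the Clebsch-Gordan coefficients *)

Section Orthonormality.
Variables (R : realType) (q Q : R).
Hypothesis hq : 0 < q < 1.
Hypothesis hQ : Q = q ^+ 2.
Local Notation e := (qpow q).
Local Notation iq := (inv_qfac Q).
Local Notation P := (qfac_inf Q).
Local Notation h := (bessel q Q).
Local Notation cz := (cg_core q Q).
Local Notation pq := (qpoch Q Q).

Let q_gt0 : 0 < q. Proof. by case/andP: hq. Qed.
Let q_lt1 : q < 1. Proof. by case/andP: hq. Qed.
Let q_neq0 : q != 0. Proof. by rewrite gt_eqF. Qed.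
Let q_ge0 : 0 <= q. Proof. exact: ltW. Qed.
Let eD := eD hq.
Let e_neq0 := e_neq0 hq.
Let e_ge0 := e_ge0 hq.
Let e_le1 := e_le1 hq.
Let iq_rec := iq_rec hq hQ.
Let iq_ge0 := iq_ge0 hq hQ.
Let iq_le := iq_le hq hQ.
Let P_gt0 := P_gt0 hq hQ.
Let P_neq0 := P_neq0 hq hQ.
Let Pv_ge0 : 0 <= P^-1. Proof. by rewrite invr_ge0 ltW. Qed.

Lemma cz_bound (x : int) : exists B, forall a b, `|cz x a b| <= B.
Proof.
case: x => x; last by exists 0 => a b; rewrite cz_x_lt0 ?normr0.
have [B hB] := G_bound hq hQ x.
have B0 : 0 <= B by exact: le_trans (hB 0%N 0%N).
exists B => -[a|a] b; last by rewrite cz_a_lt0 ?normr0.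
case: b => b; last by rewrite cz_b_lt0 ?normr0.
rewrite czE normrM m_norm// -[leRHS]mul1r ler_pM//; exact: e_le1.
Qed.

Lemma cz_summable (x p : int) (b : int -> R) (B : R) : (forall a, `|b a| <= B) ->
  exists l, has_sum (fun a => iq a * iq (a + p) * cz x a (a + p) * b a) l.
Proof.
move=> hb; have B0 : 0 <= B by exact: le_trans (hb 0).
have [K [K0 hK]] : exists K, 0 <= K /\ forall a : int,
    `|iq a * iq (a + p) * cz x a (a + p)| <= K * q ^+ `|a|%N.
  case: x => x; last by exists 0; split => // a; rewrite cz_x_lt0// mulr0 normr0 mul0r.
  have [K hK] := G_decay hq hQ x.
  have K0 : 0 <= K.
    have := le_trans (normr_ge0 _) (hK 0%N 0%N).
    by rewrite pmulr_lge0// !expr0 addr_gt0.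
  exists (P^-1 * P^-1 * (K * (1 + e p))); split.
    by rewrite !mulr_ge0// addr_ge0.
  have N0 (y : int) : 0 <= P^-1 * P^-1 * (K * (1 + e p)) * q ^+ `|y|%N.
    by rewrite !mulr_ge0// ?exprn_ge0// addr_ge0.
  case=> a; last by rewrite iq_lt0// !mul0r normr0.
  case E : (a%:Z + p) => [b'|b']; last by rewrite cz_b_lt0// mulr0 normr0.
  rewrite czE normrM -[leRHS]mulrA; apply: ler_pM => //.
    by rewrite ger0_norm ?mulr_ge0// ler_pM.
  rewrite normrM m_norm// -[leRHS]mul1r ler_pM//; first exact: e_le1.
  apply: le_trans (hK a b') _.
  by rewrite -(e_nat q b') -E eD /= -mulrA ler_wpM2l// mulrDl mul1r mulrC.
have := @has_sum_geometric_int R q; rewrite q_ge0 => /(_ q_lt1) [l hl].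
exists (rsum (fun a => iq a * iq (a + p) * cz x a (a + p) * b a)).
apply: has_sum_dom _ (has_sumZ (K * B) hl) => a /=.
by rewrite normrM [leRHS]mulrAC ler_pM.
Qed.

Definition gram (x y p a : int) : R :=
  iq a * iq (a + p) * cz x a (a + p) * cz y a (a + p).

Lemma gramC (x y p : int) : gram x y p = gram y x p.
Proof. by apply/funext => a; rewrite /gram mulrAC. Qed.

Lemma gram_sum (x y p : int) : has_sum (gram x y p) (rsum (gram x y p)).
Proof.
have [B hB] := cz_bound y.
have [l] := @cz_summable x p (fun a => cz y a (a + p)) B (fun a => hB _ _).
exact: has_sum_rsum.
Qed.

(** [cz_step] in x, a shift of a, and [cz_adj] in y. With the symmetry of the Gram matrix this leads
    down to x = y = 0, and the factor 1 - Q^0 kills the off-diagonal entries. *)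
Lemma gram_rec (x y p : int) : 0 <= x ->
  rsum (gram (x + 1) y p) = (1 - e y ^+ 2) * rsum (gram x (y - 1) p).
Proof.
move=> x0; have [B hB] := cz_bound y.
have [l1 s1] := @cz_summable x p (fun a => cz y (a + 1) (a + p + 1)) B
  (fun a => hB _ _).
have hB' a : `|q * e a * e (a + p) * cz y a (a + p)| <= B.
  have B0 : 0 <= B by exact: le_trans (hB 0 0).
  have [a0|a0] := ltP a 0; first by rewrite cz_a_lt0// mulr0 normr0.
  have [b0|b0] := ltP (a + p) 0; first by rewrite cz_b_lt0// mulr0 normr0.
  rewrite normrM -[leRHS]mul1r ler_pM// ger0_norm ?mulr_ge0//.
  rewrite -[leRHS]mul1r ler_pM ?mulr_ge0 ?e_le1//.
  by rewrite -[leRHS]mul1r ler_pM ?e_le1// ltW.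
have [l2 s2] := cz_summable x p hB'.
have d : l1 - l2 = (1 - e y ^+ 2) * rsum (gram x (y - 1) p).
  apply: has_sum_unique (has_sumB s1 s2) _.
  apply: eq_has_sum (has_sumZ _ (gram_sum x (y - 1) p)) _ => a.
  rewrite /gram -mulrBr.
  have [a0|a0] := ltP a 0; first by rewrite cz_a_lt0// ?mulr0 ?mul0r ?mulr0.
  have [b0|b0] := ltP (a + p) 0; first by rewrite cz_b_lt0// ?mulr0 ?mul0r ?mulr0.
  by rewrite (cz_adj hq hQ)//; ring.
rewrite -d; apply: has_sum_unique (gram_sum _ _ _) _.
apply: eq_has_sum (has_sumB (has_sum_shift (- 1) s1) s2) _ => a.
rewrite /gram subrK (_ : a - 1 + p + 1 = a + p); last lia.
rewrite (_ : a - 1 + p = a + p - 1); last lia.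
by rewrite (cz_step hq hQ)// -!iq_rec; ring.
Qed.

(** The terms of Cauchy's identity: the sum over a of Q^(a(a+p)) / ((Q; Q)_a (Q; Q)_(a+p)) is 1 /
    (Q; Q)_oo. *)
Let z (p a : int) : R := iq a * iq (a + p) * e (a * (a + p)) ^+ 2.

Let gram00 p : gram 0 0 p = z p.
Proof.
apply/funext => a; rewrite /gram /z.
case: a => a; last by rewrite iq_lt0// !mul0r.
case: (a%:Z + p) => b; last by rewrite (@iq_lt0 _ _ (Negz b))//; ring.
by rewrite cz0 -PoszM e_nat; ring.
Qed.

Let z_sum p : has_sum (z p) (rsum (z p)).
Proof. by rewrite -gram00; exact: gram_sum. Qed.

Let z_ge0 p a : 0 <= z p a.
Proof. by rewrite !mulr_ge0 ?exprn_ge0. Qed.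

Let z_rec p : rsum (z (p + 1)) = rsum (z p).
Proof.
(* Intermediate between the two families: z (p + 1) at a is f1 at a plus z p - f1 at a + 1. *)
pose f1 a := iq a * iq (a + p) * e (a * (a + p + 1)) ^+ 2.
have s1 : has_sum f1 (rsum f1).
  apply: has_sum_dom _ (z_sum p) => a; rewrite /f1 /z.
  case: a => a; last by rewrite iq_lt0// !mul0r normr0.
  rewrite ger0_norm ?mulr_ge0 ?exprn_ge0// ler_wpM2l ?mulr_ge0//.
  rewrite mulrDr mulr1 eD exprMn ler_piMr ?exprn_ge0// exprn_ile1//.
  exact: e_le1.
have s2 := has_sumB (z_sum p) s1.
apply: has_sum_unique (z_sum _) _.
apply: has_sum_val (eq_has_sum (has_sumD s1 (has_sum_shift 1 s2)) _) _ => [a|].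
  have E1 : iq a = (1 - e (a + 1) ^+ 2) * iq (a + 1) by rewrite iq_rec addrK.
  have E2 : iq (a + p) = (1 - e (a + p + 1) ^+ 2) * iq (a + p + 1).
    by rewrite iq_rec addrK.
  rewrite /f1 /z (_ : a + 1 + p = a + p + 1); last lia.
  rewrite [a + (p + 1)]addrA E2 E1.
  have -> : (a + 1) * (a + p + 1 + 1) = (a + 1) * (a + p + 1) + (a + 1) by ring.
  have -> : (a + 1) * (a + p + 1) = a * (a + p + 1) + (a + p + 1) by ring.
  rewrite [e (_ + (a + 1))]eD ![e (_ + (a + p + 1))]eD.
  ring.
by rewrite subrKC.
Qed.

(** The sum does not depend on p, and as p tends to infinity only a = 0 contributes, with limit 1 /
    P. *)
Lemma z_total p : rsum (z p) = P^-1.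
Proof.
have zE (n : nat) (r : int) : rsum (z (r + n%:Z)) = rsum (z r).
  elim: n => [|n ih]; first by rewrite addr0.
  by rewrite intS [1 + _]addrC addrA z_rec.
have -> : rsum (z p) = rsum (z 0).
  by case: p => n; [rewrite -(zE n 0) add0r|rewrite -(zE n.+1 (Negz n)) NegzE addNr].
have := @has_sum_geometric_int R q; rewrite q_ge0 => /(_ q_lt1) [l hl].
have dom (n : nat) a : `|z n a| <= P^-1 * P^-1 * q ^+ `|a|%N.
  rewrite ger0_norm// /z; case: a => a; last first.
    by rewrite iq_lt0// !mul0r !mulr_ge0// exprn_ge0.
  rewrite ler_pM ?mulr_ge0 ?exprn_ge0// ?ler_pM// -eM -PoszD -!PoszM e_nat /=.
  by rewrite ler_wiXn2l ?ltW//; nia.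
have lim a : z n a @[n --> \oo] --> (if a == 0 then P^-1 else 0 : R).
  case: a => a; last first.
    by rewrite /z; under eq_fun do rewrite iq_lt0// !mul0r; exact: cvg_cst.
  case: a => [|a].
    apply: cvg_trans (iq_cvg hq hQ); apply: near_eq_cvg; apply: nearW => n /=.
    by rewrite /z mul0r e0 expr1n mulr1 add0r iq0 mul1r.
  have h0 : P^-1 * P^-1 * q ^+ n @[n --> \oo] --> P^-1 * P^-1 * 0.
    by apply: cvgMr; apply: cvg_expr; rewrite ger0_norm.
  rewrite mulr0 in h0; apply: (squeeze_cvgr _ (cvg_cst 0) h0).
  apply: nearW => n; rewrite z_ge0 /= /z.
  rewrite ler_pM ?mulr_ge0 ?exprn_ge0// ?ler_pM// -eM -PoszD -!PoszM e_nat /=.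
  by rewrite ler_wiXn2l ?ltW//; nia.
have [c _] := tannery (f := fun n : nat => z n) (has_sumZ (P^-1 * P^-1) hl) dom lim.
have c2 : rsum (z (n : nat)) @[n --> \oo] --> rsum (z 0).
  have -> : (fun n : nat => rsum (z n)) = fun=> rsum (z 0); last exact: cvg_cst.
  by apply/funext => n; rewrite -(zE n 0) add0r.
rewrite (cvg_unique _ c2 c)//.
have := @has_sum1 R int 0 (fun a : int => if a == 0 then P^-1 else 0).
by rewrite eqxx => H; case: H => // i /eqP/negPf ->.
Qed.

Lemma gram_total (x y : nat) (p : int) :
  rsum (gram x y p) = if x == y then pq x / P else 0.
Proof.
elim: x y => [|x ih] y.
  case: y => [|y]; first by rewrite gram00 z_total pq0 mul1r.
  by rewrite gramC intS addrC gram_rec// e0 expr1n subrr mul0r.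
rewrite intS addrC gram_rec//; case: y => [|y].
  by rewrite e0 expr1n subrr mul0r.
rewrite (_ : y.+1%:Z - 1 = y); last lia.
rewrite ih eqSS; case: eqP => [->|]; last by rewrite mulr0.
by rewrite (e_sqr hQ) pqS; ring.
Qed.

Definition cg_weight (i : int) : R := Num.sqrt (iq i).
Local Notation wt := cg_weight.

Definition cg (x a b : int) : R := Num.sqrt P * wt x * wt a * wt b * cz x a b.
Local Notation Cz := cg.

Lemma wt_sqr i : wt i * wt i = iq i.
Proof. by rewrite -expr2 /wt sqr_sqrtr ?iq_ge0. Qed.

Lemma Cz_x_lt0 x a b : x < 0 -> Cz x a b = 0.
Proof. by move=> x0; rewrite /Cz cz_x_lt0 ?mulr0. Qed.

Lemma Cz_a_lt0 x a b : a < 0 -> Cz x a b = 0.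
Proof. by move=> x0; rewrite /Cz cz_a_lt0 ?mulr0. Qed.

Lemma Cz_b_lt0 x a b : b < 0 -> Cz x a b = 0.
Proof. by move=> x0; rewrite /Cz cz_b_lt0 ?mulr0. Qed.

Lemma Cz_sym x a b : Cz x a b = Cz x b a.
Proof. by rewrite /Cz cz_sym; ring. Qed.

Lemma Cz_coupling (x a b c r : int) :
  has_sum (fun s => h (x + b - a - c) (r + s - a - c) * (Cz x s c * Cz s a b))
    (Cz x a r * Cz r b c).
Proof.
have sP : Num.sqrt P * Num.sqrt P = P by rewrite -expr2 sqr_sqrtr// ltW.
have H := has_sumZ (P * wt x * wt a * wt b * wt c) (coupling hq hQ x a b c r).
apply: has_sum_val (eq_has_sum H _) _ => [s|].
  by rewrite /lsum /Cz; set sp := Num.sqrt P in sP *; rewrite -sP -(wt_sqr s); ring.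
by rewrite /rterm /Cz; set sp := Num.sqrt P in sP *; rewrite -sP -(wt_sqr r); ring.
Qed.

Lemma Cz_orth (x y : int) (p : int) :
  has_sum (fun a => Cz x a (a + p) * Cz y a (a + p)) ((x == y) && (0 <= x))%:R.
Proof.
have sP : Num.sqrt P * Num.sqrt P = P by rewrite -expr2 sqr_sqrtr// ltW.
have [x0|x0] := ltP x 0.
  by rewrite andbF; apply: eq_has_sum (@has_sum0 _ _) _ => a; rewrite Cz_x_lt0// mul0r.
rewrite andbT; have [y0|y0] := ltP y 0.
  rewrite (_ : x == y = false); last lia.
  by apply: eq_has_sum (@has_sum0 _ _) _ => a; rewrite (Cz_x_lt0 _ _ y0) mulr0.
case: x x0 => // x _; case: y y0 => // y _.
apply: has_sum_val (eq_has_sum (has_sumZ (P * wt x * wt y) (gram_sum x y p)) _) _ => [a|].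
  rewrite /gram /Cz; set sp := Num.sqrt P in sP *.
  by rewrite -sP -(wt_sqr a) -(wt_sqr (a + p)); ring.
rewrite gram_total eqz_nat; case: eqP => [->|]; last by rewrite mulr0.
rewrite -[P * _ * _]mulrA wt_sqr.
have -> : iq y = (pq y)^-1 by [].
by rewrite mulr1n; field; rewrite P_neq0 (pq_neq0 hq hQ).
Qed.

Lemma Cz_norm (x a b : int) : `|Cz x a b| <= 1.
Proof.
have [x0|x0] := ltP x 0; first by rewrite Cz_x_lt0// normr0.
have := Cz_orth x x (b - a); rewrite eqxx x0 /= => H.
have := has_sum_term a _ H; rewrite [a + _]addrC subrK -expr2 => /(_ (fun a => sqr_ge0 _)).
by rewrite mulr1n expr2 ler_norml => c; apply/andP; split; nra.
Qed.

Lemma qpoch_split (p k : nat) : pq p * qpoch (Q ^+ p.+1) Q k = pq (p + k).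
Proof.
elim: k => [|k ih]; first by rewrite addn0 /qpoch big_ord0 mulr1.
by rewrite qpochS mulrA ih addnS pqS -exprD addSn.
Qed.

Lemma qpoch_shift (p k : nat) : qpoch (Q ^+ p.+1) Q k = pq (p + k) / pq p.
Proof. by rewrite -qpoch_split mulrAC mulfV ?mul1r// (pq_neq0 hq hQ). Qed.

Lemma qpoch_infE (p : nat) : qpoch_inf (Q ^+ p.+1) Q = P * iq p.
Proof.
apply/cvg_lim => //.
have c : pq (n + p)%N / pq p @[n --> \oo] --> P / pq p.
  by apply: cvgMl; rewrite cvg_shiftn; exact: (pq_cvg hq hQ).
apply: cvg_trans c; apply: near_eq_cvg; apply: nearW => n /=.
by rewrite qpoch_shift addnC.
Qed.

(* The terminating basic hypergeometric series of the Clebsch-Gordan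
   coefficient. *)
Definition wall (x k p : nat) : R := \sum_(j < k.+1)
  qpoch (q ^- (2 * k)) Q j / (pq j * qpoch (Q ^+ p.+1) Q j) * q ^+ (2 * (x + 1) * j).

Lemma qpochSl (a : R) (j : nat) : qpoch a Q j.+1 = (1 - a) * qpoch (a * Q) Q j.
Proof.
rewrite /qpoch big_ord_recl expr0 mulr1; congr (_ * _).
by apply: eq_bigr => i _; rewrite /= -mulrA -exprS.
Qed.

Lemma wall_rec (x k p : nat) : wall x k p - wall x k.+1 p =
  e (2%:Z * (x%:Z - k%:Z)) / (1 - Q ^+ p.+1) * wall x k p.+1.
Proof.
(* The term j = k + 1 may be added, because (q^(-2k); Q)_(k+1) contains the factor 1 - q^(-2k) Q^k =
   0. *)
have E : wall x k p = \sum_(j < k.+2) qpoch (q ^- (2 * k)) Q j /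
   (pq j * qpoch (Q ^+ p.+1) Q j) * q ^+ (2 * (x + 1) * j).
  rewrite /wall [RHS]big_ord_recr /= [X in _ = _ + X](_ : _ = 0) ?addr0//.
  rewrite /qpoch (bigD1 (inord k : 'I_k.+1))//= inordK// hQ -exprM mulVf ?subrr.
    by rewrite !mul0r.
  by rewrite expf_neq0.
have qp0 a : qpoch a Q 0 = 1 by rewrite /qpoch big_ord0.
rewrite E /wall -sumrB big_ord_recl /= !qp0 subrr add0r.
rewrite mulr_sumr; apply: eq_bigr => j _ /=.
rewrite /bump /= add1n.
have -> : qpoch (q ^- (2 * k)) Q j.+1 = qpoch (q ^- (2 * k)) Q j * (1 - q ^- (2 * k) * Q ^+ j).
  by rewrite qpochS.
have QE n : Q ^+ n = q ^+ (2 * n) by rewrite hQ exprM.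
have -> : qpoch (q ^- (2 * k.+1)) Q j.+1 = (1 - q ^- (2 * k.+1)) * qpoch (q ^- (2 * k)) Q j.
  rewrite qpochSl; congr (_ * qpoch _ _ _).
  by rewrite hQ mulnS exprD invfM mulrAC mulVf ?mul1r// expf_neq0.
rewrite pqS qpochSl -exprSr.
have -> : e (2%:Z * (x%:Z - k%:Z)) = q ^+ (2 * x) / q ^+ (2 * k).
  by rewrite mulrBr eD eN -!PoszM !e_nat.
have n1 n : 1 - Q ^+ n.+1 != 0.
  by rewrite gt_eqF// subr_gt0 hQ -exprM exprn_ilt1.
have n2 : qpoch (Q ^+ p.+2) Q j != 0.
  by rewrite qpoch_shift mulf_neq0 ?invr_neq0 ?(pq_neq0 hq hQ).
have n3 := pq_neq0 hq hQ j.
have -> : q ^+ (2 * (x + 1) * j.+1) = q ^+ (2 * (x + 1) * j) * q ^+ (2 * x) * q ^+ 2.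
  by rewrite -!exprD; congr (_ ^+ _); lia.
have n4 : q ^+ (2 * k) != 0 by rewrite expf_neq0.
have -> : q ^- (2 * k.+1) = (q ^+ 2 * q ^+ (2 * k))^-1 by rewrite mulnS exprD.
have := n1 j; have := n1 p; rewrite [Q ^+ j.+1]exprS -hQ => n5 n6.
have n7 : Q != 0 by rewrite hQ expf_neq0.
by field; rewrite n3 n4 n2 n5 n7 n6.
Qed.

(** Induction on k: in this form [G_raise] at b = k + p + 1 is the contiguous relation
    [wall_rec]. *)
Lemma G_wall (x k p : nat) : cg_poly q Q x k (k + p) =
  (-1) ^+ k * e ((p%:Z + 1) * (x%:Z - k%:Z) - x%:Z) * pq (k + p) / pq p * wall x k p.
Proof.
elim: k p => [|k ih] p.
  rewrite G0 add0n /wall big_ord1 /qpoch !big_ord0 muln0 !expr0.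
  rewrite (_ : (p%:Z + 1) * (x%:Z - 0) - x%:Z = (x * p)%N); last by rewrite PoszM; ring.
  by rewrite e_nat mulfK ?mul1r ?mulr1 ?divr1 ?mulfV ?(pq_neq0 hq hQ).
have nE : (k.+1 + p = k + p.+1)%N by rewrite addSnnS.
have := G_raise hq hQ x k (k + p.+1); rewrite addnS /= -addnS !ih => H.
have -> : cg_poly q Q x k.+1 (k.+1 + p) =
    (q ^+ (k + p.+1) * cg_poly q Q x k.+1 (k + p.+1)) / q ^+ (k + p.+1).
  by rewrite nE [_ * cg_poly _ _ _ _ _]mulrC mulfK// expf_neq0.
move/(canRL (addrK _)) : H => ->.
have -> : wall x k.+1 p = wall x k p - e (2%:Z * (x%:Z - k%:Z)) / (1 - Q ^+ p.+1) * wall x k p.+1.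
  by rewrite -wall_rec; ring.
have n1 : 1 - Q ^+ p.+1 != 0 by rewrite gt_eqF// subr_gt0 hQ -exprM exprn_ilt1.
have -> : pq (k.+1 + p) = pq (k + p) * (1 - Q ^+ (k + p.+1)) by rewrite nE addnS pqS.
have -> : pq (k + p.+1) = pq (k + p) * (1 - Q ^+ (k + p.+1)) by rewrite addnS pqS.
rewrite pqS.
set E := e ((p%:Z + 1) * (x%:Z - k%:Z) - x%:Z); set D := e (x%:Z - k%:Z).
have -> : e ((p.+1%:Z + 1) * (x%:Z - k%:Z) - x%:Z) = E * D.
  by rewrite -eD; congr e; rewrite intS; ring.
have -> : e ((p%:Z + 1) * (x%:Z - k.+1%:Z) - x%:Z) = E / (q ^+ p * q).
  rewrite -[q ^+ p]e_nat -[in RHS](e1 q) -eD -eN -eD; congr e; rewrite intS; ring.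
have -> : e (2%:Z * (x%:Z - k%:Z)) = D * D by rewrite -eD; congr e; ring.
have -> : q ^+ x = D * q ^+ k by rewrite -!e_nat -eD; congr e; ring.
rewrite [(-1) ^+ k.+1]exprS [q ^+ (k + p.+1)]exprD [q ^+ p.+1]exprS.
move: (wall x k p.+1) (wall x k p) => w1 w0.
by field; rewrite n1 q_neq0 !expf_neq0// (pq_neq0 hq hQ).
Qed.

(** For a <= b one has mu = a and p = b - a, and the radicand is a square times P iq(x) iq(a) iq(b);
    symmetry covers the other case. *)
Lemma clebschE (x a b : nat) : clebsch q x a b = Cz x a b.
Proof.
wlog ab : a b / (a <= b)%N.
  move=> H; have [/H//|/ltnW/H E] := leqP a b.
  by rewrite Cz_sym -E /clebsch minnC distnC.
rewrite -(subnKC ab); move: (b - a)%N => p {ab b}.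
rewrite /clebsch (minn_idPl (leq_addr _ _)).
have -> : `|(a + p)%:Z - a%:Z|%N = p by lia.
rewrite -hQ; have -> : q ^+ (2 * p + 2) = Q ^+ p.+1.
  by rewrite hQ -exprM; congr (_ ^+ _); lia.
rewrite -/(wall x a p) qpoch_infE qpoch_shift /Cz czE G_wall.
have -> : q ^ ((2%:Z * (p%:Z + 1)) * (x%:Z - a%:Z)) * (P * iq p) * (pq (p + a) / pq p) / (pq a * pq x) =
  (e ((p%:Z + 1) * (x%:Z - a%:Z)) * pq (a + p) / pq p) ^+ 2 *
  (P * (iq x * (iq a * iq (a + p)%N))).
  have -> : q ^ ((2%:Z * (p%:Z + 1)) * (x%:Z - a%:Z)) = e ((p%:Z + 1) * (x%:Z - a%:Z)) ^+ 2.
    by rewrite -eM /e; congr (_ ^ _); ring.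
  rewrite /iq addnC; field; rewrite !(pq_neq0 hq hQ)//.
have Ppos : 0 <= P by exact: ltW.
rewrite sqrtrM ?sqr_ge0// sqrtr_sqr sqrtrM// sqrtrM// sqrtrM//.
rewrite ger0_norm; last first.
  by rewrite !mulr_ge0 ?invr_ge0// ltW// (pq_gt0 hq hQ).
rewrite -!/(wt _) m_nat exprD eD [e (- x%:Z)]eN.
by field; rewrite e_neq0 (pq_neq0 hq hQ).
Qed.

End Orthonormality.

Lemma has_sum_bounded (R : realType) (I : choiceType) (f : I -> R) (C : R) :
  (forall i, 0 <= f i) ->
  (forall s : seq I, uniq s -> \sum_(i <- s) f i <= C) ->
  has_sum f (rsum f) /\ rsum f <= C.
Proof.
move=> f0 fC.
have le : (nsum f <= C%:E)%E.
  apply: ge_ereal_sup => _ [X [finX _] <-].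
  by rewrite fsbig_finite//= sumEFin lee_fin fC.
have := nsum_fin f0 le (ltry _) => /(has_sum_nsum _ f0) H.
split; first exact: has_sum_rsum H.
by rewrite (has_sum_unique (has_sum_rsum H) H) -lee_fin -(nsum_fin f0 le (ltry _)).
Qed.

Lemma has_sum_fubini_dom (R : realType) (I J : choiceType) (f : I * J -> R)
    (g d : I -> R) (D : R) :
  (forall i, has_sum (fun j => f (i, j)) (g i)) ->
  (forall i, rsum (fun j => `|f (i, j)|) <= d i) -> has_sum d D ->
  has_sum f (rsum f).
Proof.
move=> fg fd dD; pose g' i := rsum (fun j => `|f (i, j)|).
have s1 i : has_sum (fun j => `|f (i, j)|) (g' i) by exact: has_sum_norm (fg i).
have s2 : has_sum g' (rsum g').
  apply: has_sum_dom_nneg _ dD => i; rewrite fd andbT.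
  exact: has_sum_ge0 (s1 i).
have s3 := proj2 (@has_sum_nfubini _ _ _ (fun z => `|f z|) _ _ (fun z => normr_ge0 _) s1) s2.
exact: has_sum_dom s3.
Qed.

(** When u and w run through two rows of norm at most 1, the bound adds up to at most |t|; this
    dominates the double sum in [Cz_rotate]. *)
Lemma norm_mul_le (R : realType) (t c u w : R) : `|c| <= 1 ->
  `|t * c * (u * w)| <= `|t| / 2 * (u * u + w * w).
Proof.
move=> c1; have uw : `|u * w| <= (u * u + w * w) / 2.
  have a1 := sqr_ge0 (u + w); have a2 := sqr_ge0 (u - w).
  by move: a1 a2; rewrite !expr2 ler_norml => a1 a2; apply/andP; split; nra.
rewrite !(normrM (t * c)) (normrM t) -!mulrA ler_wpM2l// mulrC [leRHS]mulrC.
by rewrite (le_trans _ uw)// ler_piMr.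
Qed.

(** * The limit of large labels *)

Section Limit.
Variables (R : realType) (q Q : R).
Hypothesis hq : 0 < q < 1.
Hypothesis hQ : Q = q ^+ 2.
Local Notation e := (qpow q).
Local Notation m := (mqpow q).
Local Notation iq := (inv_qfac Q).
Local Notation P := (qfac_inf Q).
Local Notation h := (bessel q Q).
Local Notation Cz := (cg q Q).
Local Notation pq := (qpoch Q Q).
Local Notation wt := (cg_weight Q).

Let q_gt0 : 0 < q. Proof. by case/andP: hq. Qed.
Let q_lt1 : q < 1. Proof. by case/andP: hq. Qed.
Let q_neq0 : q != 0. Proof. by rewrite gt_eqF. Qed.
Let q_ge0 : 0 <= q. Proof. exact: ltW. Qed.
Let eD := eD hq.
Let mD := mD hq.
Let e_neq0 := e_neq0 hq.
Let e_ge0 := e_ge0 hq.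
Let iq_ge0 := iq_ge0 hq hQ.
Let iq_le := iq_le hq hQ.
Let P_gt0 := P_gt0 hq hQ.
Let Pv_ge0 : 0 <= P^-1. Proof. by rewrite invr_ge0 ltW. Qed.
Let pq_neq0 := pq_neq0 hq hQ.
Let Q_gt0 : 0 < Q. Proof. by case/andP: (Q_bounds hq hQ). Qed.
Let Q_lt1 : Q < 1. Proof. by case/andP: (Q_bounds hq hQ). Qed.
Let Q_ge0 : 0 <= Q. Proof. exact: ltW. Qed.

(** This is Q^(nj) (Q^(-n); Q)_j, the multiple of the shifted factorial that stays bounded as n
    grows. *)
Let v (n j : nat) : R := \prod_(i < j) (Q ^+ n - Q ^+ i).

Let v_lim (a j : nat) : v (a + n)%N j @[n --> \oo] --> (-1) ^+ j * Q ^+ (j * j.-1)./2.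
Proof.
have cQ : Q ^+ (a + n)%N @[n --> \oo] --> (0 : R).
  have c : Q ^+ (n + a)%N @[n --> \oo] --> (0 : R).
    by rewrite (cvg_shiftn a (fun n => Q ^+ n)); apply: cvg_expr; rewrite ger0_norm.
  by apply: cvg_trans c; apply: near_eq_cvg; apply: nearW => n /=; rewrite addnC.
elim: j => [|j ih].
  rewrite /v; under eq_fun do rewrite big_ord0.
  by rewrite !expr0 mulr1; exact: cvg_cst.
rewrite /v; under eq_fun do rewrite big_ord_recr /=.
rewrite bin2S exprS exprD.
have -> : -1 * (-1) ^+ j * (Q ^+ j * Q ^+ (j * j.-1)./2) =
  ((-1) ^+ j * Q ^+ (j * j.-1)./2) * (0 - Q ^+ j) :> R by ring.
by apply: cvgM => //; apply: cvgB => //; exact: cvg_cst.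
Qed.

Let v_bound (n j : nat) : (j <= n.+1)%N -> `|v n j| <= Q ^+ (j * j.-1)./2.
Proof.
elim: j => [|j ih] jn; first by rewrite /v big_ord0 normr1.
rewrite /v big_ord_recr /= -/(v n j) normrM bin2S exprD mulrC.
apply: ler_pM => //; last by apply: ih; exact: ltnW.
have : Q ^+ n <= Q ^+ j by rewrite ler_wiXn2l ?ltW.
have : 0 <= Q ^+ n by rewrite exprn_ge0.
by move=> h0 h1; rewrite ler0_norm; lra.
Qed.

Let wall_lim (x a p : nat) :
  wall q Q (x + n)%N (a + n)%N p @[n --> \oo] --> pq p * bessel_series q Q p (x%:Z - a%:Z).
Proof.
pose u : R := e (x%:Z - a%:Z + 1) ^+ 2.
have u0 : 0 <= u by rewrite exprn_ge0.
(* The power of q in the series is u^j Q^((a+n)j), and its second factor turns the shifted factorial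
   into v. The finite sum is extended by 0 for [tannery]. *)
pose f n j := (if (j < (a + n).+1)%N then v (a + n) j * u ^+ j * (iq j * iq (p + j)%N) else 0).
have [l hl] := gauss_sum hq hQ u0.
have fg n j : `|f n j| <= P^-1 * P^-1 * (Q ^+ (j * j.-1)./2 * u ^+ j).
  rewrite /f; case: ifP => ja; last first.
    by rewrite normr0 !mulr_ge0 ?exprn_ge0.
  rewrite normrM mulrC; apply: ler_pM => //.
    by rewrite ger0_norm ?mulr_ge0// ler_pM.
  rewrite normrM (ger0_norm (exprn_ge0 _ u0)) ler_wpM2r ?exprn_ge0//.
  by apply: v_bound; exact: ltnW.
have fl j : f n j @[n --> \oo] --> bessel_term q Q p (x%:Z - a%:Z) j.
  have c : v (a + n)%N j * u ^+ j * (iq j * iq (p + j)%N) @[n --> \oo] -->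
     ((-1) ^+ j * Q ^+ (j * j.-1)./2) * u ^+ j * (iq j * iq (p + j)%N).
    by apply: cvgMl; apply: cvgMl; exact: v_lim.
  rewrite /bessel_term /euler_coef -PoszD -/u (_ : _ * iq j * u ^+ j * _ =
    ((-1) ^+ j * Q ^+ (j * j.-1)./2) * u ^+ j * (iq j * iq (p + j)%N)); last by ring.
  apply: cvg_trans c; apply: near_eq_cvg; exists j => // n /= jn.
  by rewrite /f ifT//; clear -jn; lia.
have [c _] := tannery (has_sumZ (P^-1 * P^-1) hl) fg fl.
have {}c : pq p * rsum (f n) @[n --> \oo] --> pq p * bessel_series q Q p (x%:Z - a%:Z).
  by apply: cvgMr.
apply: cvg_trans c; apply: near_eq_cvg; apply: nearW => n /=.
have := has_sum_seq (fun j => v (a + n) j * u ^+ j * (iq j * iq (p + j)%N))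
   (iota_uniq 0 (a + n).+1).
under eq_fun do rewrite mem_iota /= add0n.
move=> H; rewrite (has_sum_unique (has_sum_rsum H) H).
rewrite -{1}[(a + n).+1]subn0 -/(index_iota 0 _) big_mkord mulr_sumr /wall.
apply: eq_bigr => j _; rewrite (qpoch_shift hq hQ) -!/(iq _).
have -> : q ^+ (2 * (x + n + 1) * j) = u ^+ j * (Q ^+ (a + n)) ^+ j.
  rewrite -exprMn exprM; congr (_ ^+ j).
  rewrite mulnC exprM -(e_nat q) /u -(e_sqr hQ) -exprMn -eD; congr (e _ ^+ 2); rewrite !PoszD; ring.
have -> : v (a + n) j = qpoch (q ^- (2 * (a + n))) Q j * (Q ^+ (a + n)) ^+ j.
  have -> : (Q ^+ (a + n)) ^+ j = \prod_(i < j) Q ^+ (a + n).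
    by rewrite prodr_const card_ord.
  rewrite /v /qpoch -big_split /=.
  apply: eq_bigr => i _; rewrite mulrBl mul1r mulrAC hQ -(exprM q 2 (a + n)).
  by rewrite mulVf ?mul1r// expf_neq0.
by rewrite /iq; field; rewrite !pq_neq0.
Qed.

Let wt_lim (a : nat) : wt (a + n)%N @[n --> \oo] --> Num.sqrt P^-1.
Proof.
have c : iq (n + a)%N @[n --> \oo] --> P^-1.
  by rewrite (cvg_shiftn a (fun n : nat => iq n)); exact: (iq_cvg hq hQ).
have {}c : iq (a + n)%N @[n --> \oo] --> P^-1.
  by apply: cvg_trans c; apply: near_eq_cvg; apply: nearW => n /=; rewrite addnC.
by apply: continuous_cvg c; exact: sqrt_continuous.
Qed.

Let Cz_lim_nat (x a p : nat) :
  Cz (x + n)%N (a + n)%N (a + n + p)%N @[n --> \oo] --> h p (x%:Z - a%:Z).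
Proof.
have cpq : pq (a + n + p)%N @[n --> \oo] --> P.
  have c : pq (n + (a + p))%N @[n --> \oo] --> P.
    by rewrite (cvg_shiftn (a + p) pq); exact: (pq_cvg hq hQ).
  apply: cvg_trans c; apply: near_eq_cvg; apply: nearW => n /=.
  by rewrite addnCA addnA.
have cw : wt (a + n + p)%N @[n --> \oo] --> Num.sqrt P^-1.
  apply: cvg_trans (@wt_lim (a + p)%N); apply: near_eq_cvg; apply: nearW => n /=.
  by rewrite addnAC.
have c := cvgM (cvgM (cvgM (cvgM (@wt_lim x) (@wt_lim a)) cw) cpq) (@wall_lim x a p).
pose k := Num.sqrt P * (m (x%:Z - a%:Z) * e (p%:Z * (x%:Z - a%:Z)) / pq p).
pose L := k * (Num.sqrt P^-1 * Num.sqrt P^-1 * Num.sqrt P^-1 * P *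
  (pq p * bessel_series q Q p (x%:Z - a%:Z))).
have {}c : k * (wt (x + n)%N * wt (a + n)%N * wt (a + n + p)%N * pq (a + n + p)%N *
    wall q Q (x + n)%N (a + n)%N p) @[n --> \oo] --> L by apply: cvgMr; exact: c.
have <- : L = h p (x%:Z - a%:Z).
  have sP : Num.sqrt P * Num.sqrt P = P by rewrite -expr2 sqr_sqrtr// ltW.
  have sn : Num.sqrt P != 0 by rewrite sqrtr_eq0 -ltNge.
  rewrite /L /k /bessel sqrtrV ?(ltW P_gt0)//.
  by move: sP sn; set sp := Num.sqrt P => <- sn; field; rewrite sn pq_neq0.
apply: cvg_trans c; apply: near_eq_cvg; apply: nearW => n /=.
rewrite /k /cg czE (G_wall hq hQ) !PoszD.
have -> : m (x%:Z + n%:Z) = m (x%:Z - a%:Z) * m (a + n)%N by rewrite -mD; congr m; rewrite PoszD; ring.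
have -> : (p%:Z + 1) * (x%:Z + n%:Z - (a%:Z + n%:Z)) - (x%:Z + n%:Z) =
  p%:Z * (x%:Z - a%:Z) - (a + n)%N%:Z by rewrite PoszD; ring.
rewrite m_nat eD eN.
have s1 : (-1) ^+ (a + n) * (-1) ^+ (a + n) = 1 :> R.
  by rewrite -exprMn mulrNN mulr1 expr1n.
rewrite -!PoszD.
rewrite -[LHS]mul1r -[X in X * _]s1.
set g := (-1) ^+ (a + n); field.
by rewrite e_neq0 pq_neq0.
Qed.

Lemma Cz_lim (x a b : int) :
  Cz (x + n%:Z) (a + n%:Z) (b + n%:Z) @[n --> \oo] --> h (b - a) (x - a).
Proof.
wlog ab : a b / a <= b.
  move=> H; have [/H//|/ltW/H E] := leP a b.
  under eq_fun do rewrite Cz_sym.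
  by rewrite -(opprB a b) (h_opp hq hQ) (_ : x - a + (a - b) = x - b)//; ring.
(* From n = N on, all labels are natural numbers. *)
pose N := (absz a + absz x)%N.
have := @Cz_lim_nat (absz (x + N%:Z)) (absz (a + N%:Z)) (absz (b - a)).
have -> : (absz (x + N%:Z))%:Z - (absz (a + N%:Z))%:Z = x - a by clear -N; lia.
have -> : (absz (b - a))%:Z = b - a by clear -ab; lia.
move=> c; rewrite -(cvg_shiftn N).
apply: cvg_trans c; apply: near_eq_cvg; apply: nearW => n /=.
by congr (Cz _ _ _); clear -N ab; lia.
Qed.

(** A Fatou argument: each finite sum of squares is a limit of finite parts of the sums in
    [Cz_orth], which are at most 1. *)
Lemma h_sq_sum (nu : int) :
  has_sum (fun y => h nu y ^+ 2) (rsum (fun y => h nu y ^+ 2)) /\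
  rsum (fun y => h nu y ^+ 2) <= 1.
Proof.
apply: has_sum_bounded => [y|s us]; first exact: sqr_ge0.
have c : \sum_(y <- s) Cz (0 + n%:Z) (- y + n%:Z) (- y + nu + n%:Z) ^+ 2 @[n --> \oo]
    --> \sum_(y <- s) h nu y ^+ 2.
  apply: cvg_big => [|y _]; first exact: add_continuous.
  have := @Cz_lim 0 (- y) (- y + nu).
  rewrite sub0r opprK (_ : - y + nu + y = nu); last ring.
  by move=> c; rewrite expr2; under eq_fun do rewrite expr2; exact: cvgM.
apply: (cvgr_to_le c); apply: nearW => n.
have := Cz_orth hq hQ n n nu; rewrite eqxx => H.
have us' : uniq [seq - y + n%:Z | y <- s] by rewrite map_inj_uniq// => y y' /addIr/oppr_inj.
have H' := has_sum_seq (fun a => Cz n a (a + nu) * Cz n a (a + nu)) us'.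
rewrite big_map in H'; rewrite add0r.
have -> : \sum_(y <- s) Cz n (- y + n%:Z) (- y + nu + n%:Z) ^+ 2 =
  \sum_(y <- s) Cz n (- y + n%:Z) (- y + n%:Z + nu) * Cz n (- y + n%:Z) (- y + n%:Z + nu).
  by apply: eq_bigr => y _; rewrite expr2 addrAC.
apply: ler_has_sum H' H => a; case: ifP => // _.
by rewrite -expr2 sqr_ge0.
Qed.

Lemma h_norm (nu y : int) : `|h nu y| <= 1.
Proof.
have [H le1] := h_sq_sum nu.
have := has_sum_term y (fun y => sqr_ge0 (h nu y)) H => /le_trans/(_ le1).
by rewrite expr2 ler_norml => c; apply/andP; split; nra.
Qed.

(** For y >= 0 the series gives the decay. For y < 0, [h_rec] divided by q^y gains a factor q^|y|
    over the uniform bound [h_norm]. *)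
Lemma h_l1 (nu : int) : exists l, has_sum (fun y => `|h nu y|) l.
Proof.
have [K hK] := h_bound0 hq hQ nu.
have := @has_sum_geometric_int R q; rewrite q_ge0 => /(_ q_lt1) [l hl].
have K0 : 0 <= K by have := hK 0 (lexx _); rewrite e0 mulr1; exact: le_trans.
exists (rsum (fun y => `|h nu y|)).
apply: has_sum_dom _ (has_sumZ (K + (1 + e nu)) hl) => y; rewrite normr_id.
case: y => y.
  apply: le_trans (hK _ _) _ => //; rewrite e_nat /= ler_wpM2r ?exprn_ge0//.
  by rewrite lerDl addr_ge0.
have -> : h nu (Negz y) = (e (Negz y))^-1 *
    (h (nu - 1) (Negz y) + e nu * h (nu - 1) (Negz y - 1)).
  by rewrite (h_rec hq hQ) mulKf.
rewrite -eN normrM (ger0_norm (e_ge0 _)) mulrC.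
have -> : e (- Negz y) = q ^+ `|Negz y|%N by rewrite NegzE opprK e_nat.
rewrite ler_wpM2r ?exprn_ge0//; apply: le_trans (ler_normD _ _) _.
rewrite (normrM (e nu)) (ger0_norm (e_ge0 _)).
have h1 := h_norm (nu - 1) (Negz y); have h2 := h_norm (nu - 1) (Negz y - 1).
have : e nu * `|h (nu - 1) (Negz y - 1)| <= e nu * 1 by rewrite ler_wpM2l.
lra.
Qed.

(* The limit of [Cz_coupling] when all labels tend to infinity. *)
Lemma pentagon (x a b c r : int) :
  has_sum (fun s => h (x + b - a - c) (r + s - a - c) * (h (c - s) (x - s) * h (b - a) (s - a)))
    (h (r - a) (x - a) * h (c - b) (r - b)).
Proof.
pose f (n : nat) (s : int) := h (x + b - a - c) (r + s - a - c) *
  (Cz (x + n%:Z) (s + n%:Z) (c + n%:Z) * Cz (s + n%:Z) (a + n%:Z) (b + n%:Z)).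
have fs n : has_sum (f n) (Cz (x + n%:Z) (a + n%:Z) (r + n%:Z) *
    Cz (r + n%:Z) (b + n%:Z) (c + n%:Z)).
  have H := Cz_coupling hq hQ (x + n%:Z) (a + n%:Z) (b + n%:Z) (c + n%:Z) (r + n%:Z).
  apply: eq_has_sum (has_sum_shift n%:Z H) _ => s /=.
  by rewrite /f; congr (h _ _ * _); ring.
have [l hl] := h_l1 (x + b - a - c).
have {}hl := has_sum_shift (r - a - c) hl.
(* The bound is uniform in n: [h_l1] supplies the decay in s, and [Cz_norm] bounds the two
   coefficients by 1. *)
have dom n s : `|f n s| <= `|h (x + b - a - c) (s + (r - a - c))|.
  rewrite /f (_ : s + (r - a - c) = r + s - a - c); last ring.
  rewrite normrM ler_piMr// normrM -[leRHS]mul1r.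
  by apply: ler_pM => //; exact: (Cz_norm hq hQ).
have lim s : f n s @[n --> \oo] --> h (x + b - a - c) (r + s - a - c) *
    (h (c - s) (x - s) * h (b - a) (s - a)).
  by apply: cvgMr; apply: cvgM; exact: Cz_lim.
have [c1 H] := tannery hl dom lim.
have c2 : Cz (x + n%:Z) (a + n%:Z) (r + n%:Z) * Cz (r + n%:Z) (b + n%:Z) (c + n%:Z)
    @[n --> \oo] --> h (r - a) (x - a) * h (c - b) (r - b).
  by apply: cvgM; exact: Cz_lim.
have {}c2 : rsum (f n) @[n --> \oo] --> h (r - a) (x - a) * h (c - b) (r - b).
  apply: cvg_trans c2; apply: near_eq_cvg; apply: nearW => n /=.
  by apply: has_sum_unique (fs n) (has_sum_rsum (fs n)).
by apply: has_sum_val H _; apply: cvg_unique c1 c2.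
Qed.

(* Expanding the second factor by [Cz_coupling], only [s = s0] survives. *)
Lemma Cz_rotate (x s0 d p r : int) :
  has_sum (fun a => Cz s0 a (a + d) * (Cz x a (a + p) * Cz (a + p) (a + d) r))
    (h (x + d - r) (p + s0 - r) * Cz x s0 r).
Proof.
pose F (z : int * int) : R := h (x + d - r) (p + z.1 - r) * Cz x z.1 r *
  (Cz s0 z.2 (z.2 + d) * Cz z.1 z.2 (z.2 + d)).
have sF s : has_sum (fun a => F (s, a))
    (h (x + d - r) (p + s - r) * Cz x s r * ((s0 == s) && (0 <= s0))%:R).
  have H := has_sumZ (h (x + d - r) (p + s - r) * Cz x s r) (Cz_orth hq hQ s0 s d).
  by apply: eq_has_sum H _ => a.
have [l hl] := h_l1 (x + d - r).
have {}hl := has_sum_shift (p - r) hl.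
(* For fixed s the sum over a is controlled by the norms of the rows s0 and s; the sum over s then
   converges by [h_l1]. *)
have FT : has_sum F (rsum F).
  apply: (has_sum_fubini_dom (d := fun s => `|h (x + d - r) (s + (p - r))|) sF _ hl) => s.
  have H1 := Cz_orth hq hQ s0 s0 d; have H2 := Cz_orth hq hQ s s d.
  have := has_sumZ (`|h (x + d - r) (s + (p - r))| / 2) (has_sumD H1 H2) => H3.
  apply: (@le_trans _ _ _ _ _ (ler_has_sum _ (has_sum_norm (sF s)) H3)).
    move=> a; rewrite /F /= (_ : p + s - r = s + (p - r)); last ring.
    exact: norm_mul_le (Cz_norm hq hQ _ _ _).
  rewrite -[leRHS]mulr1 -mulrA ler_wpM2l//.
  by rewrite !eqxx /=; case: (0 <= s0); case: (0 <= s); rewrite /= ?mulr1n ?mulr0n; lra.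
have s1 := has_sum_fubini FT sF.
have E : rsum F = h (x + d - r) (p + s0 - r) * Cz x s0 r.
  have H := @has_sum1 _ _ s0 (fun s => h (x + d - r) (p + s - r) * Cz x s r *
    ((s0 == s) && (0 <= s0))%:R).
  rewrite (has_sum_unique s1 (H _)); last first.
    by move=> s /eqP; rewrite eq_sym => /negPf ->; rewrite mulr0.
  rewrite eqxx /=; have [n0|n0] := ltP s0 0; first by rewrite Cz_a_lt0// !mulr0.
  by rewrite mulr1.
rewrite -E; apply: has_sum_fubini (has_sum_swap FT) _ => a /=.
have H := has_sumZ (Cz s0 a (a + d)) (Cz_coupling hq hQ x a (a + d) r (a + p)).
apply: eq_has_sum H _ => s; rewrite /F /=.
rewrite (_ : x + (a + d) - a - r = x + d - r); last ring.
rewrite (_ : a + p + s - a - r = p + s - r); last ring.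
ring.
Qed.

End Limit.

(** * Convolution of products of q-Bessel functions *)

Section TupleSums.
Variable R : realType.

Lemma has_sum_tuple0 (T : choiceType) (f : 0.-tuple T -> R) :
  has_sum f (f [tuple]).
Proof. by apply: has_sum1 => t; rewrite tuple0. Qed.

Let consT (T : choiceType) (k : nat) (z : T * k.-tuple T) : k.+1.-tuple T :=
  [tuple of z.1 :: z.2].

Let consT_inj (T : choiceType) (k : nat) : injective (@consT T k).
Proof.
move=> [x s] [y t] /(congr1 val) /= [-> st]; congr (_, _); exact: val_inj.
Qed.

Let consT_surj (T : choiceType) (k : nat) (f : k.+1.-tuple T -> R) t :
  (forall z, consT z <> t) -> f t = 0.
Proof.
move=> H; exfalso; apply: (H (thead t, [tuple of behead t])).
by rewrite [RHS]tuple_eta; apply: val_inj.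
Qed.

Lemma has_sum_tupleS (T : choiceType) (k : nat) (f : seq T -> R) (l : R) :
  has_sum (fun t : k.+1.-tuple T => f t) l <->
  has_sum (fun z : T * k.-tuple T => f (z.1 :: z.2)) l.
Proof.
exact: (has_sum_inj l (@consT_inj T k) (@consT_surj T k (fun t => f t))).
Qed.

Lemma nsum_tuple0 (T : choiceType) (f : seq T -> R) : 0 <= f [::] ->
  nsum (fun t : 0.-tuple T => f t) = (f [::])%:E.
Proof.
move=> f0; apply/has_sum_nsum => [t|]; first by rewrite tuple0.
exact: (@has_sum_tuple0 T (fun t => f t)).
Qed.

Lemma nsum_pair_le1 (I J : choiceType) (f : I * J -> R) (g : I -> R)
    (f' : I -> J -> R) :
  (forall x, 0 <= g x) -> (forall x t, 0 <= f' x t) ->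
  (forall x t, f (x, t) = g x * f' x t) ->
  (nsum g <= 1)%E -> (forall x, nsum (f' x) <= 1)%E -> (nsum f <= 1)%E.
Proof.
move=> g0 f'0 fE g1 f'1.
rewrite /nsum (_ : [set: I * J] = [set: I] `*`` (fun=> [set: J]));
  last by apply/seteqP; split.
rewrite (_ : (fun z => (f z)%:E) = fun z => (g z.1 * f' z.1 z.2)%:E); last first.
  by apply/funext => -[x t]; rewrite fE.
rewrite -(@esum_esum _ _ _ [set: I] (fun=> [set: J])
  (fun x t => (g x * f' x t)%:E)); last first.
  by move=> x t _ _; rewrite lee_fin mulr_ge0.
apply: le_trans _ g1; apply: le_esum => x _.
rewrite -/(nsum (fun t => g x * f' x t)) nsumZ//.
by rewrite -[leRHS]mule1; apply: lee_wpmul2l; rewrite ?lee_fin.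
Qed.

Lemma nsum_tupleS_le1 (T : choiceType) (k : nat) (f : seq T -> R) (g : T -> R)
    (f' : T -> seq T -> R) :
  (forall x, 0 <= g x) -> (forall x t, 0 <= f' x t) ->
  (forall x (t : k.-tuple T), f (x :: t) = g x * f' x t) ->
  (nsum g <= 1)%E ->
  (forall x, nsum (fun t : k.-tuple T => f' x t) <= 1)%E ->
  (nsum (fun t : k.+1.-tuple T => f t) <= 1)%E.
Proof.
move=> g0 f'0 fE g1 f'1.
rewrite (nsum_inj (@consT_inj T k) (@consT_surj T k (fun t => f t))).
exact: (@nsum_pair_le1 _ _ _ g (fun x (t : k.-tuple T) => f' x t)).
Qed.

Lemma nsum_rcons_le1 (T : choiceType) (k : nat) (f : seq T -> R) (g : T -> R)
    (f' : T -> seq T -> R) :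
  (forall x, 0 <= g x) -> (forall x t, 0 <= f' x t) ->
  (forall x (t : k.-tuple T), f (rcons t x) = g x * f' x t) ->
  (nsum g <= 1)%E ->
  (forall x, nsum (fun t : k.-tuple T => f' x t) <= 1)%E ->
  (nsum (fun t : k.+1.-tuple T => f t) <= 1)%E.
Proof.
move=> g0 f'0 fE g1 f'1.
pose e (z : T * k.-tuple T) : k.+1.-tuple T := [tuple of rcons z.2 z.1].
rewrite (@nsum_inj R _ _ e (fun t => f t)).
- exact: (@nsum_pair_le1 _ _ _ g (fun x (t : k.-tuple T) => f' x t)).
- move=> [x s] [y t] /(congr1 val) /= /eqP; rewrite eqseq_rcons => /andP[/eqP E /eqP ->].
  by congr (_, _); exact: val_inj.
- move=> [t /= tk] H; exfalso; case/lastP: t tk H => // t x tk H.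
  have tk' : size t == k by move: (tk); rewrite size_rcons eqSS.
  by apply: (H (x, Tuple tk')); exact: val_inj.
Qed.

(** This lemma and the next three isolate the leaves that a contraction replaces: positions 1, 2
    become 1 for the right comb, and 2, 3 become 2 for the mixed tree. The other leaves, which stay
    fixed, come first in the pair. *)
Lemma has_sum_tuple_1 (T : choiceType) (k : nat) (f : seq T -> R) (l : R) :
  has_sum (fun t : k.+1.-tuple T => f t) l <->
  has_sum (fun z : k.-tuple T * T => f (z.2 :: z.1)) l.
Proof.
pose e (z : k.-tuple T * T) : k.+1.-tuple T := [tuple of z.2 :: z.1].
apply: (has_sum_inj (e := e)).
- by move=> [s x] [t y] /(congr1 val) /= [-> E]; congr (_, _); exact: val_inj.
- move=> t H; exfalso; apply: (H ([tuple of behead t], thead t)).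
  by rewrite [RHS]tuple_eta; apply: val_inj.
Qed.

Lemma has_sum_tuple_12 (T : choiceType) (k : nat) (f : seq T -> R) (l : R) :
  has_sum (fun t : k.+2.-tuple T => f t) l <->
  has_sum (fun z : k.-tuple T * (T * T) => f (z.2.1 :: z.2.2 :: z.1)) l.
Proof.
pose e (z : k.-tuple T * (T * T)) : k.+2.-tuple T := [tuple of z.2.1 :: z.2.2 :: z.1].
apply: (has_sum_inj (e := e)).
- move=> [s [x x']] [t [y y']] /(congr1 val) /= [-> -> E].
  by congr (_, _); exact: val_inj.
- move=> [[//|x [//|y t]] /= tk] H; exfalso.
  by apply: (H (Tuple (tk : size t == k), (x, y))); exact: val_inj.
Qed.

Lemma has_sum_tuple_2 (T : choiceType) (k : nat) (f : seq T -> R) (l : R) :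
  has_sum (fun t : k.+2.-tuple T => f t) l <->
  has_sum (fun z : (T * k.-tuple T) * T => f (z.1.1 :: z.2 :: z.1.2)) l.
Proof.
pose e (z : (T * k.-tuple T) * T) : k.+2.-tuple T :=
  [tuple of z.1.1 :: z.2 :: z.1.2].
apply: (has_sum_inj (e := e)).
- move=> [[x s] x'] [[y t] y'] /(congr1 val) /= [-> -> E].
  by congr (_, _, _); exact: val_inj.
- move=> [[//|x [//|y t]] /= tk] H; exfalso.
  by apply: (H (x, Tuple (tk : size t == k), y)); exact: val_inj.
Qed.

Lemma has_sum_tuple_23 (T : choiceType) (k : nat) (f : seq T -> R) (l : R) :
  has_sum (fun t : k.+3.-tuple T => f t) l <->
  has_sum (fun z : (T * k.-tuple T) * (T * T) =>
    f (z.1.1 :: z.2.1 :: z.2.2 :: z.1.2)) l.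
Proof.
pose e (z : (T * k.-tuple T) * (T * T)) : k.+3.-tuple T :=
  [tuple of z.1.1 :: z.2.1 :: z.2.2 :: z.1.2].
apply: (has_sum_inj (e := e)).
- move=> [[x s] [x' x'']] [[y t] [y' y'']] /(congr1 val) /= [-> -> -> E].
  by congr (_, _, _); exact: val_inj.
- move=> [[//|x [//|y [//|z t]]] /= tk] H; exfalso.
  by apply: (H (x, Tuple (tk : size t == k), (y, z))); exact: val_inj.
Qed.

(** A cherry prescribes the difference of its two leaves, so a sum over both is a sum over Z along a
    diagonal. *)
Lemma has_sum_diag (d : int) (G : int -> R) (l : R) :
  (forall a, a < 0 -> G a = 0) -> (forall a, a + d < 0 -> G a = 0) ->
  has_sum G l ->
  has_sum (fun z : nat * nat => if z.2%:Z == z.1%:Z + d then G z.1 else 0) l.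
Proof.
move=> G1 G2 Gl.
pose F (z : int * int) := if z.2 == z.1 + d then G z.1 else 0.
have FG : has_sum F l.
  apply/(has_sum_inj (e := fun a => (a, a + d))).
  - by move=> a b [].
  - move=> [a b] H; rewrite /F /=; case: eqP => // E.
    by exfalso; apply: (H a); rewrite E.
  - by apply: eq_has_sum Gl _ => a; rewrite /F /= eqxx.
apply: (proj1 (has_sum_inj (e := fun z : nat * nat => (z.1%:Z, z.2%:Z)) _ _ _) FG).
- by move=> [a b] [c d'] [-> ->].
- move=> [[a|a] [b|b]] H; rewrite /F /=; case: eqP => // E.
  + by exfalso; apply: (H (a, b)).
  + by apply: G2; rewrite -E.
  + exact: G1.
  + exact: G1.
Qed.

Lemma has_sum_cauchy (I : choiceType) (f g : I -> R) :
  (nsum (fun i => (f i ^+ 2)%R) <= 1)%E -> (nsum (fun i => (g i ^+ 2)%R) <= 1)%E ->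
  has_sum (fun i => f i * g i) (rsum (fun i => f i * g i)).
Proof.
move=> f1 g1.
have [sf sg] : has_sum (fun i => f i ^+ 2) (rsum (fun i => f i ^+ 2)) /\
               has_sum (fun i => g i ^+ 2) (rsum (fun i => g i ^+ 2)).
  split; apply: has_sum_rsum; apply/has_sum_nsum; do ?[by move=> i; exact: sqr_ge0].
    by apply: nsum_fin f1 (ltry _) => i; exact: sqr_ge0.
  by apply: nsum_fin g1 (ltry _) => i; exact: sqr_ge0.
apply: has_sum_dom _ (has_sumD sf sg) => i /=.
by rewrite ler_norml; apply/andP; split; nra.
Qed.

End TupleSums.

(** * Products of the functions h and their convolution *)

Section Products.
Variables (R : realType) (q Q : R).
Hypothesis hq : 0 < q < 1.
Hypothesis hQ : Q = q ^+ 2.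
Local Notation h := (bessel q Q).

(** The recursion is a contraction: the leaves n1, n2 merge into a leaf s1 and the node r1
    disappears. The default of [head] makes r2 the last leaf when no internal node is left. *)
Fixpoint prodR (x : int) (n r s : seq int) : R :=
  match r, s, n with
  | r1 :: r', s1 :: s', n1 :: n2 :: n' =>
      let r2 := head (head 0 n') r' in
      h (x + n2 - n1 - r2) (r1 + s1 - n1 - r2) * prodR x (s1 :: n') r' s'
  | _, _, _ => 1
  end.

(** Here n2, n3 merge into a leaf t1 and the node s1 disappears. The next node of the left comb is
    the root x when s' is empty. *)
Fixpoint prodS (x : int) (n t s : seq int) : R :=
  match t, s, n with
  | t1 :: t', s1 :: s', n1 :: n2 :: n3 :: n' =>
      h (head x s' + n2 - n1 - n3) (t1 + s1 - n1 - n3) *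
        prodS x (n1 :: t1 :: n') t' s'
  | _, _, _ => 1
  end.

Lemma pentagon_labels (x n1 n2 n3 r1 r2 r3 s1 s2 : int) :
  has_sum (fun t => h (s2 + n2 - n1 - n3) (t + s1 - n1 - n3) *
      (h (r1 + n3 - n2 - r3) (r2 + t - n2 - r3) *
       h (x + t - n1 - r3) (r1 + s2 - n1 - r3)))
    (h (x + n2 - n1 - r2) (r1 + s1 - n1 - r2) *
     h (x + n3 - s1 - r3) (r2 + s2 - s1 - r3)).
Proof.
(* The arguments are found by matching the indices of h, four of them after a reversal of the order
   by [h_opp]. *)
have H := pentagon hq hQ (r1 + s2 - x) (r1 + n3 - r2) (n2 + r3 - r2)
  (n1 + r3 - x) (s1 + r1 + r3 - r2 - x).
apply: has_sum_val (eq_has_sum H _) _ => [t|].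
  congr (_ * _); first by congr (h _ _); ring.
  rewrite mulrC; congr (_ * _).
    rewrite (_ : n2 + r3 - r2 - _ = - (r1 + n3 - n2 - r3)); last ring.
    by rewrite (h_opp hq hQ); congr (h _ _); ring.
  rewrite (_ : n1 + r3 - x - t = - (x + t - n1 - r3)); last ring.
  by rewrite (h_opp hq hQ); congr (h _ _); ring.
rewrite mulrC; congr (_ * _).
  rewrite (_ : n1 + r3 - x - _ = - (x + n2 - n1 - r2)); last ring.
  by rewrite (h_opp hq hQ); congr (h _ _); ring.
rewrite (_ : s1 + r1 + r3 - r2 - x - _ = - (x + n3 - s1 - r3)); last ring.
by rewrite (h_opp hq hQ); congr (h _ _); ring.
Qed.

Lemma h_sq_nsum (nu c : int) : (nsum (fun y => (h nu (y + c) ^+ 2)%R) <= 1)%E.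
Proof.
have [H le1] := h_sq_sum hq hQ nu.
have := has_sum_shift c H => /(has_sum_nsum _ (fun y => sqr_ge0 _)) ->.
by rewrite lee_fin.
Qed.

(** The first factor contains only the first summation variable, and its squares sum to at most 1;
    the other factors are a product of the same kind, bounded uniformly in that variable. *)
Lemma prodR_sq_nsum (k : nat) (x : int) (n r : seq int) :
  size r = k -> size n = k.+2 ->
  (nsum (fun t : k.-tuple int => (prodR x n r t ^+ 2)%R) <= 1)%E.
Proof.
elim: k n r => [|k ih] n r.
  case: r => // _ _.
  rewrite (nsum_tuple0 (f := fun t => prodR x n [::] t ^+ 2)) ?sqr_ge0// lee_fin.
  by rewrite /= expr1n.
case: r => // r1 r [rk]; case: n => // n1 [//|n2 n] [nk].
pose r2 := head (head 0 n) r.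
apply: (nsum_tupleS_le1 (f := fun t => prodR x (n1 :: n2 :: n) (r1 :: r) t ^+ 2)
  (g := fun t1 => h (x + n2 - n1 - r2) (t1 + (r1 - n1 - r2)) ^+ 2)
  (f' := fun t1 t => prodR x (t1 :: n) r t ^+ 2)).
- by move=> t1; exact: sqr_ge0.
- by move=> t1 t; exact: sqr_ge0.
- move=> t1 t; rewrite /= exprMn -/r2; congr (h _ _ ^+ 2 * _); ring.
- exact: h_sq_nsum.
- by move=> t1; apply: ih => //=; rewrite nk.
Qed.

Lemma prodS_sq_nsum (k : nat) (x r1 : int) (n s : seq int) :
  size s = k.+1 -> size n = k.+3 ->
  (nsum (fun t : k.-tuple int => (prodS x n (rcons t r1) s ^+ 2)%R) <= 1)%E.
Proof.
elim: k n s => [|k ih] n s.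
  case: s => // s1 [|//] _; case: n => // n1 [//|n2 [//|n3 [|//]]] _.
  rewrite (nsum_tuple0 (f := fun t => prodS x _ (rcons t r1) _ ^+ 2)) ?sqr_ge0// lee_fin.
  rewrite /= mulr1 -real_normK ?num_real// expr_le1//; exact: (h_norm hq hQ).
case: s => // s1 s [sk]; case: n => // n1 [//|n2 [//|n3 n]] [nk].
apply: (nsum_tupleS_le1
  (f := fun t => prodS x (n1 :: n2 :: n3 :: n) (rcons t r1) (s1 :: s) ^+ 2)
  (g := fun t1 => h (head x s + n2 - n1 - n3) (t1 + (s1 - n1 - n3)) ^+ 2)
  (f' := fun t1 t => prodS x (n1 :: t1 :: n) (rcons t r1) s ^+ 2)).
- by move=> t1; exact: sqr_ge0.
- by move=> t1 t; exact: sqr_ge0.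
- move=> t1 t; rewrite /= exprMn; congr (h _ _ ^+ 2 * _); ring.
- exact: h_sq_nsum.
- by move=> t1; apply: ih => //=; rewrite nk.
Qed.

(** Induction on k. For fixed t1 the remaining sum is the claim for the leaves n1, t1, n4, ..., with
    r2 and s1 left out; the sum over t1 is then [pentagon_labels]. *)
Lemma prod_convolution (k : nat) (x r1 : int) (n r s : seq int) :
  size r = k -> size s = k.+1 -> size n = k.+3 ->
  has_sum (fun t : k.-tuple int => prodS x n (rcons t r1) s * prodR r1 (behead n) r t)
    (prodR x n (r1 :: r) s).
Proof.
elim: k n r s => [|k ih] n r s.
  case: r => // _; case: s => // s1 [|//] _.
  case: n => // n1 [//|n2 [//|n3 [|//]]] _.
  exact: has_sum_val (@has_sum_tuple0 _ _ _) (mulr1 _).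
case: r => // r2 r [rk]; case: s => // s1 [//|s2 s] [sk].
case: n => // n1 [//|n2 [//|n3 n]] [nk].
pose F t := prodS x (n1 :: n2 :: n3 :: n) (rcons t r1) (s1 :: s2 :: s) *
  prodR r1 (n2 :: n3 :: n) (r2 :: r) t.
pose r3 := head (head 0 n) r.
pose coef t1 := h (s2 + n2 - n1 - n3) (t1 + s1 - n1 - n3) *
   h (r1 + n3 - n2 - r3) (r2 + t1 - n2 - r3).
have FT : has_sum (fun t : k.+1.-tuple int => F t) (rsum (fun t : k.+1.-tuple int => F t)).
  apply: has_sum_cauchy; last by apply: prodR_sq_nsum; rewrite /= ?rk ?nk.
  by apply: prodS_sq_nsum; rewrite /= ?sk ?nk.
have s1' t1 : has_sum (fun t : k.-tuple int => F (t1 :: t))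
    (coef t1 * prodR x (n1 :: t1 :: n) (r1 :: r) (s2 :: s)).
  have H := ih (n1 :: t1 :: n) r (s2 :: s) rk.
  rewrite /= sk nk in H; have {}H := has_sumZ (coef t1) (H erefl erefl).
  by apply: eq_has_sum H _ => t; rewrite /F /coef /= -/r3; ring.
have s2' := has_sum_fubini (proj1 (has_sum_tupleS _ _ _) FT) s1'.
apply: has_sum_val FT _.
have H := has_sumZ (prodR x (s2 :: n) r s) (pentagon_labels x n1 n2 n3 r1 r2 r3 s1 s2).
apply: has_sum_unique s2' (has_sum_val (eq_has_sum H _) _) => [t1|].
  by rewrite /coef /= -/r3; ring.
by rewrite /= -/r3; ring.
Qed.

End Products.

(** * Tree vectors *)

Section Trees.
Variables (R : realType) (q Q : R).
Hypothesis hq : 0 < q < 1.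
Hypothesis hQ : Q = q ^+ 2.
Local Notation Cz := (cg q Q).

Definition shift_head (e : int) (s : seq int) : seq int :=
  if s is d :: s' then d + e :: s' else [::].

Definition dev_labelings (t : tree int) (y e : int) (a : seq nat) : set (tree nat) :=
  [set l | [/\ tree_shape l = tree_shape t, root_label (tmap Posz l) = y,
    diffs (tmap Posz l) = shift_head e (diffs t) & leaves l = a]].

(* The coefficient at [a] of the vector of the tree [t], when its root is
   relabelled by [y] and the quantity (a) is increased by [e]. *)
Definition dev_vector (t : tree int) (y e : int) (a : seq nat) : R :=
  \sum_(l \in dev_labelings t y e a) clebsch_prod q l.

Lemma tree_vectorE (K : nat) (t : tree int) (a : K.-tuple nat) :
  tree_vector q t a = dev_vector t (root_label t) 0 a.
Proof.
rewrite /tree_vector /dev_vector; congr (\sum_(l \in _) _).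
have sh0 : shift_head 0 (diffs t) = diffs t.
  by case: (diffs t) => //= d s; rewrite addr0.
by apply/seteqP; split => l /=; rewrite /dev_labelings /labelings /= sh0;
  [move=> [[? ? ?] ?]|move=> [? ? ? ?]].
Qed.

Lemma root_tmap (T U : Type) (f : T -> U) (t : tree T) :
  root_label (tmap f t) = f (root_label t).
Proof. by case: t. Qed.

Lemma inner_diffsE (b : bool) (z w : int) (t : tree int) : inner_diffs b z w t =
  if diffs t is d :: s then (if b then z - w - d else z - w + d) :: s else [::].
Proof. by case: t => //= y l r; congr cons; case: b; ring. Qed.

(** When z - w changes, (b) is kept exactly if the difference of the children shifts by that change,
    up to a sign given by the side; the deeper quantities are the same. *)
Lemma shift_head_inner (b : bool) (z w z' w' e : int) (s t : seq int) :
  e = (if b then (z' - w') - (z - w) else (z - w) - (z' - w')) ->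
  (if s is d :: s' then (if b then z' - w' - d else z' - w' + d) :: s' else [::]) =
  (if t is d :: s' then (if b then z - w - d else z - w + d) :: s' else [::]) <->
  s = shift_head e t.
Proof.
move=> ->; case: s t => [|c s] [|d t] //=; split => -[]; case: b => // h1 ->; congr cons; lia.
Qed.

Lemma dev_vector_leaf (m y e : int) (a : seq nat) :
  dev_vector (Leaf m) y e a = (map Posz a == [:: y])%:R.
Proof.
rewrite /dev_vector; case: eqP => [E|N].
  case: a E => [|b [|]] //= [Eb].
  rewrite (_ : dev_labelings _ _ _ _ = [set Leaf b]).
    by rewrite fsbig_set1.
  apply/seteqP; split => l /=; last by move=> ->.
  by move=> []; case: l => //= c _ _ _ [->].
rewrite (_ : dev_labelings _ _ _ _ = set0); first by rewrite fsbig_set0.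
apply/seteqP; split => l //= [].
by case: l => //= c _ Ec _ Ea; apply: N; rewrite -Ea /= Ec.
Qed.

(** The leaf z and the shifted quantity (a) determine the label of the other child. The deviation
    handed down to B is the change of parent minus sibling, from y - m to Y - z. *)
Lemma dev_vector_right (y m : int) (B : tree int) (Y e : int) (z : nat) (a : seq nat) :
  dev_vector (Node y (Leaf m) B) Y e (z :: a) =
  Cz Y z (z%:Z + (root_label B - m + e)) *
    dev_vector B (z%:Z + (root_label B - m + e)) ((Y - z%:Z) - (y - m)) a.
Proof.
set d := root_label B - m + e; rewrite /dev_vector.
case: Y => Y; last first.
  rewrite Cz_x_lt0// mul0r (_ : dev_labelings _ _ _ _ = set0) ?fsbig_set0//.
  by apply/seteqP; split => l //= [] _; rewrite root_tmap.
rewrite mulr_fsumr.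
rewrite (_ : dev_labelings (Node y (Leaf m) B) Y e (z :: a) =
  (fun l => Node Y (Leaf z) l) @` dev_labelings B (z%:Z + d) ((Y%:Z - z%:Z) - (y - m)) a).
  rewrite fsbig_image; last by move=> l l' _ _ [].
  apply: eq_fsbigr => l /set_mem [_ + _ _] /=.
  by rewrite root_tmap mulr1 (clebschE hq hQ) => <-.
apply/seteqP; split => l /=.
  move=> []; case: l => //= Y' [c|? ? ?] // l [Esh] [EY] + [Ec Ea].
  subst Y' c a => -[Ed]; rewrite !inner_diffsE => Ei; exists l => //; split => //.
    by rewrite /d -Ed addrC subrK.
  exact: (proj1 (@shift_head_inner true y m Y%:Z z%:Z _ _ _ erefl) Ei).
move=> [l' [Esh Er Ed El] <-]; split => //=.
- by move: Esh; rewrite /tree_shape /= => ->.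
- rewrite Er; congr cons; first by rewrite /d; ring.
  rewrite !inner_diffsE.
  exact: (proj2 (@shift_head_inner true y m Y%:Z z%:Z _ _ _ erefl) Ed).
- by rewrite El.
Qed.

Lemma dev_vector_left (y m : int) (A : tree int) (Y e : int) (z : nat) (a : seq nat) :
  dev_vector (Node y A (Leaf m)) Y e (rcons a z) =
  Cz Y (z%:Z - (m - root_label A + e)) z *
    dev_vector A (z%:Z - (m - root_label A + e)) ((y - m) - (Y - z%:Z)) a.
Proof.
set d := m - root_label A + e; rewrite /dev_vector.
case: Y => Y; last first.
  rewrite Cz_x_lt0// mul0r (_ : dev_labelings _ _ _ _ = set0) ?fsbig_set0//.
  by apply/seteqP; split => l //= [] _; rewrite root_tmap.
rewrite mulr_fsumr.
rewrite (_ : dev_labelings (Node y A (Leaf m)) Y e (rcons a z) =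
  (fun l => Node Y l (Leaf z)) @` dev_labelings A (z%:Z - d) ((y - m) - (Y%:Z - z%:Z)) a).
  rewrite fsbig_image; last by move=> l l' _ _ [].
  apply: eq_fsbigr => l /set_mem [_ + _ _] /=.
  by rewrite root_tmap mulr1 (clebschE hq hQ) => <-.
apply/seteqP; split => l /=.
  move=> []; case: l => //= Y' l [c|? ? ?] // [Esh] [EY]; rewrite !cats0 => + Ea.
  move: Ea; rewrite cats1 => /eqP; rewrite eqseq_rcons => /andP[/eqP Ea /eqP Ec].
  subst Y' c a => -[Ed]; rewrite !inner_diffsE => Ei; exists l => //; split => //.
    by rewrite /d -Ed; ring.
  exact: (proj1 (@shift_head_inner false y m Y%:Z z%:Z _ _ _ erefl) Ei).
move=> [l' [Esh Er Ed El] <-]; split => //=.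
- by move: Esh; rewrite /tree_shape /= => ->.
- rewrite !cats0 Er; congr cons; first by rewrite /d; ring.
  rewrite !inner_diffsE.
  exact: (proj2 (@shift_head_inner false y m Y%:Z z%:Z _ _ _ erefl) Ed).
- by rewrite El cats1.
Qed.

Definition graft (T : tree int) (s n : seq int) : tree int :=
  foldl (fun t p => Node p.1 t (Leaf p.2)) T (zip s n).

Lemma graft_rcons (T : tree int) (s n : seq int) (y m : int) : size s = size n ->
  graft T (rcons s y) (rcons n m) = Node y (graft T s n) (Leaf m).
Proof. by move=> E; rewrite /graft zip_rcons// foldl_rcons. Qed.

Lemma root_graft (T : tree int) (s n : seq int) : size s = size n ->
  root_label (graft T s n) = last (root_label T) s.
Proof.
elim/last_ind: s n => [|s y _] n; first by case: n.
elim/last_ind: n => [|n m _]; first by rewrite size_rcons.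
by rewrite !size_rcons => -[E]; rewrite graft_rcons// last_rcons.
Qed.

(** The order of the quantifiers matters: w and mu depend on T only through its root label, so T can
    be exchanged for a tree with another number of leaves. Along the spine u - v stays constant. *)
Lemma dev_vector_graft (s n : seq int) (a : seq nat) (rho u v : int) :
  size s = size n -> size a = size s ->
  exists w mu, forall (T : tree int) (a0 : seq nat), root_label T = rho ->
    dev_vector (graft T s n) (last rho s + u) v (a0 ++ a) =
    w * dev_vector T (rho + mu) (mu - (u - v)) a0.
Proof.
elim/last_ind: s n a u v => [|s y ih] n a u v.
  case: n => // _; case: a => // _; exists 1, u => T a0 rT.
  by rewrite cats0 mul1r /graft /= subKr.
elim/last_ind: n => [|n m _]; first by rewrite size_rcons.
elim/last_ind: a => [|a z _]; first by rewrite size_rcons.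
rewrite !size_rcons => -[E1] [E2].
pose u' := z%:Z - m - v; pose v' := z%:Z - m - u.
have [w [mu H]] := ih n a u' v' E1 E2.
exists (Cz (y + u) (last rho s + u') z * w), mu => T a0 rT.
rewrite graft_rcons// -rcons_cat last_rcons dev_vector_left root_graft// rT.
rewrite (_ : z%:Z - _ = last rho s + u'); last by rewrite /u'; ring.
rewrite (_ : y - m - _ = v'); last by rewrite /v'; ring.
rewrite H// mulrA; congr (_ * dev_vector _ _ _ _).
by rewrite /u' /v'; ring.
Qed.

End Trees.

(** * Contraction of leaves in inner products of tree vectors *)

Section Symbols.
Variables (R : realType) (q Q : R).
Hypothesis hq : 0 < q < 1.
Hypothesis hQ : Q = q ^+ 2.
Local Notation h := (bessel q Q).
Local Notation Cz := (cg q Q).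
Local Notation dev_vector := (dev_vector q).
Local Notation prodR := (prodR q Q).
Local Notation prodS := (prodS q Q).

Lemma Cz_sq_nsum (y d : int) :
  (nsum (fun z : nat => (Cz y z (z%:Z + d) ^+ 2)%R) <= 1)%E.
Proof.
have H := Cz_orth hq hQ y y d.
have /has_sum_nat_int H' := H; have {}H' := H' (fun k => ltac:(by rewrite Cz_a_lt0 ?mulr0)).
have -> : (fun z : nat => Cz y z (z%:Z + d) ^+ 2) =
  (fun z : nat => Cz y z (z%:Z + d) * Cz y z (z%:Z + d)).
  by apply/funext => z; rewrite expr2.
have /has_sum_nsum -> := H'; last by move=> z; rewrite -expr2 sqr_ge0.
by rewrite lee_fin; case: (_ && _).
Qed.

(** All y and e are included, because a subtree is reached with deviations that depend on the leaves
    already fixed. The bound makes inner products converge absolutely. *)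
Definition unit_bounded (K : nat) (T : tree int) : Prop := forall y e,
  (nsum (fun a : K.-tuple nat => (dev_vector T y e a ^+ 2)%R) <= 1)%E.

Lemma unit_bounded_leaf (m : int) : unit_bounded 1 (Leaf m).
Proof.
move=> y e.
apply: (nsum_tupleS_le1 (f := fun a => dev_vector (Leaf m) y e a ^+ 2)
  (g := fun z : nat => (z%:Z == y)%:R) (f' := fun _ _ => 1)) => //.
- by move=> z t; rewrite tuple0 dev_vector_leaf /= mulr1 eqseq_cons andbT; case: eqP;
    rewrite ?expr1n ?expr0n.
- case: y => y.
    have := @has_sum1 R _ y (fun z : nat => (z%:Z == y)%:R).
    rewrite eqxx => H; have {}H : has_sum (fun z : nat => (z%:Z == y%:Z)%:R : R) 1.
      by apply: H => z zy; rewrite eqz_nat; case: eqP zy.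
    by have /has_sum_nsum -> := H.
  by rewrite /nsum esum1.
- by move=> _; rewrite (nsum_tuple0 (f := fun=> 1)).
Qed.

Lemma unit_bounded_right (K : nat) (y m : int) (B : tree int) :
  unit_bounded K B -> unit_bounded K.+1 (Node y (Leaf m) B).
Proof.
move=> ubB Y e.
apply: (nsum_tupleS_le1
  (f := fun a => dev_vector (Node y (Leaf m) B) Y e a ^+ 2)
  (g := fun z => Cz Y z (z%:Z + (root_label B - m + e)) ^+ 2)
  (f' := fun z a => dev_vector B (z%:Z + (root_label B - m + e))
     ((Y - z%:Z) - (y - m)) a ^+ 2)).
- by move=> z; exact: sqr_ge0.
- by move=> z t; exact: sqr_ge0.
- by move=> z t; rewrite (dev_vector_right hq hQ) exprMn.
- exact: Cz_sq_nsum.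
- by move=> z; exact: ubB.
Qed.

Lemma unit_bounded_left (K : nat) (y m : int) (A : tree int) :
  unit_bounded K A -> unit_bounded K.+1 (Node y A (Leaf m)).
Proof.
move=> ubA Y e.
apply: (nsum_rcons_le1
  (f := fun a => dev_vector (Node y A (Leaf m)) Y e a ^+ 2)
  (g := fun z => Cz Y z (z%:Z + (- (m - root_label A + e))) ^+ 2)
  (f' := fun z a => dev_vector A (z%:Z - (m - root_label A + e))
     ((y - m) - (Y - z%:Z)) a ^+ 2)).
- by move=> z; exact: sqr_ge0.
- by move=> z t; exact: sqr_ge0.
- by move=> z t; rewrite (dev_vector_left hq hQ) exprMn Cz_sym.
- exact: Cz_sq_nsum.
- by move=> z; exact: ubA.
Qed.

Lemma unit_bounded_graft (K K' : nat) (T : tree int) (s n : seq int) :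
  size s = size n -> (K' = K + size s)%N -> unit_bounded K T ->
  unit_bounded K' (graft T s n).
Proof.
elim/last_ind: s n K' => [|s y ih] n K' /=.
  by case: n => // _ ->; rewrite addn0.
elim/last_ind: n => [|n m _]; first by rewrite size_rcons.
rewrite !size_rcons addnS => -[E] -> ubT; rewrite graft_rcons//.
by apply: unit_bounded_left; exact: ih.
Qed.

Definition right_spine (r n : seq int) (l : int) : tree int :=
  foldr (fun p t => Node p.1 (Leaf p.2) t) (Leaf l) (zip r n).

Lemma root_right_spine (r n : seq int) (l : int) : (size r <= size n)%N ->
  root_label (right_spine r n l) = head l r.
Proof. by case: r n => [|y r] [|m n]. Qed.

Lemma unit_bounded_right_spine (K : nat) (r n : seq int) (l : int) :
  (size r <= size n)%N -> K = (size r).+1 -> unit_bounded K (right_spine r n l).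
Proof.
elim: r n K => [|y r ih] [|m n] K //=; try by move=> _ ->; exact: unit_bounded_leaf.
by move=> rn ->; apply: unit_bounded_right; exact: ih.
Qed.

Lemma right_combE (x : int) (n1 : int) (r n : seq int) : n != [::] ->
  right_comb x r (n1 :: n) = Node x (Leaf n1) (right_spine r n (last 0 n)).
Proof. by case: n. Qed.

Lemma left_combE (x : int) (n1 : int) (s n : seq int) :
  left_comb x s (n1 :: n) = graft (Leaf n1) (rcons s x) n.
Proof. by []. Qed.

Lemma mixed_treeE (x n1 n2 : int) (t n : seq int) :
  mixed_tree x t (n1 :: n2 :: n) = Node x (Leaf n1) (graft (Leaf n2) t n).
Proof. by []. Qed.

Lemma dev_vector_cherry (y m1 m2 Y e : int) (a b : nat) :
  dev_vector (Node y (Leaf m1) (Leaf m2)) Y e [:: a; b] =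
  if b%:Z == a%:Z + (m2 - m1 + e) then Cz Y a (a%:Z + (m2 - m1 + e)) else 0.
Proof.
rewrite (dev_vector_right hq hQ) dev_vector_leaf /= eqseq_cons andbT.
by case: eqP; rewrite ?mulr1 ?mulr0.
Qed.

Lemma has_sum_cherry (x n1 n2 : int) : 0 <= x ->
  has_sum (fun a : 2.-tuple nat =>
    dev_vector (Node x (Leaf n1) (Leaf n2)) x 0 a *
    dev_vector (Node x (Leaf n1) (Leaf n2)) x 0 a) 1.
Proof.
move=> x0; set v := dev_vector _ x 0.
have ub : (nsum (fun a : 2.-tuple nat => (v a ^+ 2)%R) <= 1)%E.
  by apply: unit_bounded_right; exact: unit_bounded_leaf.
have FT := has_sum_cauchy ub ub.
have H := Cz_orth hq hQ x x (n2 - n1 + 0); rewrite eqxx x0 /= in H.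
have s1 (z : 0.-tuple nat) : has_sum (fun w : nat * nat =>
   v (w.1 :: w.2 :: z) * v (w.1 :: w.2 :: z)) 1.
  apply: eq_has_sum (has_sum_diag (d := n2 - n1 + 0) _ _ H) _ => [a a0|a a0|[a b]] /=.
  - by rewrite Cz_a_lt0 ?mul0r.
  - by rewrite Cz_b_lt0 ?mul0r.
  - by rewrite tuple0 /v dev_vector_cherry; case: eqP; rewrite ?mul0r.
have s2 := has_sum_fubini (proj1 (has_sum_tuple_12 _ (fun a => v a * v a) _) FT) s1.
apply: has_sum_val FT _.
exact: has_sum_unique s2 (@has_sum_tuple0 _ _ (fun=> 1)).
Qed.

Lemma has_sum_right_left (k : nat) (x : int) (n r s : seq int) : 0 <= x ->
  size r = k -> size s = k -> size n = k.+2 ->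
  has_sum (fun a : k.+2.-tuple nat =>
      dev_vector (right_comb x r n) x 0 a * dev_vector (left_comb x s n) x 0 a)
    (prodR x n r s).
Proof.
move=> x0; elim: k n r s => [|k ih] n r s.
  case: r => // _; case: s => // _; case: n => // n1 [//|n2 [|//]] _.
  exact: has_sum_cherry.
case: r => // r1 r [rk]; case: s => // s1 s [sk]; case: n => // n1 [//|n2 n] [nk].
have nn : n != [::] by case: n nk.
set B := right_spine r n (last 0 n); pose r2 := head (head 0 n) r.
have rB : root_label B = r2.
  rewrite root_right_spine; last by rewrite rk nk.
  by rewrite /r2; move: rk nk; clear; case: r => //= <-; case: n => //= a [|//].
have nRk : right_comb x (r1 :: r) (n1 :: n2 :: n) = Node x (Leaf n1) (Node r1 (Leaf n2) B).
  by rewrite right_combE// /B; move: nn; clear; case: n.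
have nR' : right_comb x r (s1 :: n) = Node x (Leaf s1) B by rewrite right_combE.
have nL : left_comb x (s1 :: s) (n1 :: n2 :: n) =
  graft (Node s1 (Leaf n1) (Leaf n2)) (rcons s x) n by [].
have nL' : left_comb x s (s1 :: n) = graft (Leaf s1) (rcons s x) n by [].
have sz : size (rcons s x) = size n by rewrite size_rcons sk nk.
set f := fun a => dev_vector (right_comb x (r1 :: r) (n1 :: n2 :: n)) x 0 a *
  dev_vector (left_comb x (s1 :: s) (n1 :: n2 :: n)) x 0 a.
pose f' a := dev_vector (right_comb x r (s1 :: n)) x 0 a *
  dev_vector (left_comb x s (s1 :: n)) x 0 a.
have FT : has_sum (fun a : k.+3.-tuple nat => f a)
    (rsum (fun a : k.+3.-tuple nat => f a)).
  apply: has_sum_cauchy.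
    rewrite nRk; do 2 apply: unit_bounded_right.
    by apply: unit_bounded_right_spine; rewrite ?rk ?nk.
  rewrite nL; apply: (@unit_bounded_graft 2) => //.
    by rewrite size_rcons sk.
  by apply: unit_bounded_right; exact: unit_bounded_leaf.
have FT' : has_sum (fun a : k.+2.-tuple nat => f' a) (prodR x (s1 :: n) r s).
  by apply: ih => //=; rewrite nk.
pose c := h (x + n2 - n1 - r2) (r1 + s1 - n1 - r2).
(* With the other leaves fixed, the sum over the two leaves is c times the sum over the merged leaf;
   summation over a then gives the recursion of [prodR]. *)
have key (a : k.+1.-tuple nat) : exists l,
    has_sum (fun w : nat * nat => f (w.1 :: w.2 :: a)) (c * l) /\
    has_sum (fun z : nat => f' (z :: a)) l.
  have sa : size a = size (rcons s x) by rewrite size_tuple size_rcons sk.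
  have [w [mu H]] := dev_vector_graft hq hQ s1 0 0 sz sa.
  rewrite last_rcons addr0 in H.
  pose l := w * (Cz x (s1 + mu) (r2 + mu) * dev_vector B (r2 + mu) (- mu) a).
  (* The left comb forces the label of the merged leaf. If this label is negative, the sum is empty
     and l is 0 too. *)
  have E1 (b : nat) : f' (b :: a) = if b%:Z == s1 + mu then l else 0.
    rewrite /f' nL' (_ : b :: a = [:: b] ++ a)// H// dev_vector_leaf /= eqseq_cons andbT.
    case: eqP => [bE|_]; last by rewrite !mulr0.
    rewrite mulr1 nR' (dev_vector_right hq hQ) rB addr0 bE /l.
    have -> : s1 + mu + (r2 - s1) = r2 + mu by ring.
    have -> : x - (s1 + mu) - (x - s1) = - mu by ring.
    by rewrite mulrC.
  exists l; split; last first.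
    have [neg|pos] := ltP (s1 + mu) 0.
      have l0 : l = 0 by rewrite /l Cz_a_lt0// mul0r mulr0.
      by rewrite l0; apply: eq_has_sum (@has_sum0 _ _) _ => b; rewrite E1 l0; case: ifP.
    case E : (s1 + mu) pos => [b|] // _.
    have := @has_sum1 R _ b (fun b => f' (b :: a)).
    have -> : f' (b :: a) = l by rewrite E1 E eqxx.
    apply => b' bb'.
    by rewrite E1 E eqz_nat; case: eqP bb'.
  pose d := n2 - n1 + mu.
  (* The cherry of the left comb forces b2 = b1 + d; its coefficient and the first two of the right
     comb form the sum of [Cz_rotate]. *)
  have H0 := Cz_rotate hq hQ x (s1 + mu) d (r1 - n1) (r2 + mu).
  have H1 := has_sumZ (w * dev_vector B (r2 + mu) (- mu) a) H0.
  apply: has_sum_val (eq_has_sum (has_sum_diag (d := d) _ _ H1) _) _.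
  - by move=> b b0; rewrite Cz_a_lt0// mul0r mulr0.
  - by move=> b b0; rewrite Cz_b_lt0// mul0r mulr0.
  - move=> [b1 b2] /=.
    rewrite /f nL (_ : b1 :: b2 :: a = [:: b1; b2] ++ a)// H// dev_vector_cherry.
    rewrite (_ : n2 - n1 + (mu - (0 - 0)) = d); last by rewrite /d; ring.
    case: eqP => [b2E|_]; last by rewrite !mulr0.
    rewrite nRk (dev_vector_right hq hQ) (dev_vector_right hq hQ) /= rB b2E.
    have -> : b1%:Z + (r1 - n1 + 0) = b1%:Z + (r1 - n1) by ring.
    have -> : b1%:Z + d + (r2 - n2 + (x - b1%:Z - (x - n1))) = r2 + mu by rewrite /d; ring.
    have -> : b1%:Z + (r1 - n1) - (b1%:Z + d) - (r1 - n2) = - mu by rewrite /d; ring.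
    by ring.
  - rewrite /l /c (_ : x + d - (r2 + mu) = x + n2 - n1 - r2); last by rewrite /d; ring.
    rewrite (_ : r1 - n1 + (s1 + mu) - (r2 + mu) = r1 + s1 - n1 - r2); last by ring.
    by ring.
have [l hl] := @choice _ _ (fun a l => _) key.
have t1 := has_sum_fubini (proj1 (has_sum_tuple_12 _ f _) FT) (fun a => proj1 (hl a)).
have t2 := has_sum_fubini (proj1 (has_sum_tuple_1 _ f' _) FT') (fun a => proj2 (hl a)).
apply: has_sum_val FT _; exact: has_sum_unique t1 (has_sumZ c t2).
Qed.

Lemma has_sum_mixed_left (k : nat) (x : int) (n t s : seq int) : 0 <= x ->
  size t = k -> size s = k -> size n = k.+2 ->
  has_sum (fun a : k.+2.-tuple nat =>
      dev_vector (mixed_tree x t n) x 0 a * dev_vector (left_comb x s n) x 0 a)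
    (prodS x n t s).
Proof.
move=> x0; elim: k n t s => [|k ih] n t s.
  case: t => // _; case: s => // _; case: n => // n1 [//|n2 [|//]] _.
  exact: has_sum_cherry.
case: t => // t1 t [tk]; case: s => // s1 s [sk].
case: n => // n1 [//|n2 [//|n3 n]] [nk].
pose s2 := head x s; pose s' := behead (rcons s x).
have s'E : rcons s x = s2 :: s' by rewrite /s2 /s'; case: s {sk s2 s'}.
have sz : size s' = size n by rewrite /s' size_behead size_rcons sk nk.
have tz : size t = size n by rewrite tk nk.
have s'x : last s2 s' = x by rewrite -[last s2 s']/(last 0 (s2 :: s')) -s'E last_rcons.
pose rho := last t1 t.
pose A := Node s1 (Leaf n1) (Leaf n2).
have nM : mixed_tree x (t1 :: t) (n1 :: n2 :: n3 :: n) =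
  Node x (Leaf n1) (graft (Node t1 (Leaf n2) (Leaf n3)) t n) by [].
have nM' : mixed_tree x t (n1 :: t1 :: n) = Node x (Leaf n1) (graft (Leaf t1) t n) by [].
have nL : left_comb x (s1 :: s) (n1 :: n2 :: n3 :: n) =
    graft (Node s2 A (Leaf n3)) s' n.
  by rewrite left_combE rcons_cons s'E.
have nL' : left_comb x s (n1 :: t1 :: n) =
    graft (Node s2 (Leaf n1) (Leaf t1)) s' n.
  by rewrite left_combE s'E.
have rM T : root_label T = t1 -> root_label (graft T t n) = rho.
  by move=> TE; rewrite root_graft// TE.
set f := fun a => dev_vector (mixed_tree x (t1 :: t) (n1 :: n2 :: n3 :: n)) x 0 a *
  dev_vector (left_comb x (s1 :: s) (n1 :: n2 :: n3 :: n)) x 0 a.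
pose f' a := dev_vector (mixed_tree x t (n1 :: t1 :: n)) x 0 a *
  dev_vector (left_comb x s (n1 :: t1 :: n)) x 0 a.
have cherry_ub y m1 m2 : unit_bounded 2 (Node y (Leaf m1) (Leaf m2)).
  by apply: unit_bounded_right; exact: unit_bounded_leaf.
have FT : has_sum (fun a : k.+3.-tuple nat => f a)
    (rsum (fun a : k.+3.-tuple nat => f a)).
  apply: has_sum_cauchy.
    rewrite nM; apply: unit_bounded_right.
    by apply: (@unit_bounded_graft 2) => //; rewrite tk.
  rewrite nL; apply: (@unit_bounded_graft 3) => //; first by rewrite sz nk.
  by apply: unit_bounded_left; exact: cherry_ub.
have FT' : has_sum (fun a : k.+2.-tuple nat => f' a) (prodS x (n1 :: t1 :: n) t s).
  by apply: ih => //=; rewrite nk.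
pose c := h (s2 + n2 - n1 - n3) (t1 + s1 - n1 - n3).
(* As for the right comb, except that the first leaf lies outside the contraction and is fixed as
   well. *)
have key (z : nat * k.-tuple nat) : exists l,
    has_sum (fun w : nat * nat => f (z.1 :: w.1 :: w.2 :: z.2)) (c * l) /\
    has_sum (fun y : nat => f' (z.1 :: y :: z.2)) l.
  case: z => a1 a /=; pose u := a1%:Z - n1.
  have sat : size a = size t by rewrite size_tuple tk.
  have sas : size a = size s' by rewrite size_tuple sz nk.
  (* With a1 in place of n1, the right child of the root moves by u and its deviation is - u. *)
  have [w1 [mu1 H1]] := dev_vector_graft hq hQ t1 u (- u) tz sat.
  have [w2 [mu2 H2]] := dev_vector_graft hq hQ s2 0 0 sz sas.
  rewrite -/rho opprK in H1; rewrite s'x !addr0 in H2.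
  pose C1 := Cz x a1 (a1%:Z + (rho - n1 + 0)).
  have M (T : tree int) (b : seq nat) : root_label T = t1 ->
      dev_vector (Node x (Leaf n1) (graft T t n)) x 0 (a1 :: b ++ a) =
      C1 * (w1 * dev_vector T (t1 + mu1) (mu1 - (u + u)) b).
    move=> TE; rewrite (dev_vector_right hq hQ) rM//; congr (_ * _).
    rewrite -H1//; congr (dev_vector _ _ _ _); rewrite /u; ring.
  pose l := C1 * w1 * w2 *
    (if t1 + mu1 == a1%:Z + (t1 - n1 + mu2) then Cz (s2 + mu2) a1 (t1 + mu1) else 0).
  have E1 (b : nat) : f' (a1 :: b :: a) = if b%:Z == t1 + mu1 then l else 0.
    rewrite /f' nM' nL' (_ : a1 :: b :: a = a1 :: [:: b] ++ a)// M//.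
    rewrite (_ : a1 :: [:: b] ++ a = [:: a1; b] ++ a)// H2//.
    rewrite dev_vector_leaf dev_vector_cherry /= eqseq_cons andbT /l.
    case: eqP => [->|_]; last by rewrite !mulr0 mul0r.
    by rewrite mulr1; case: eqP => [<-|_]; ring.
  exists l; split; last first.
    have [neg|pos] := ltP (t1 + mu1) 0.
      have l0 : l = 0.
        by rewrite /l; case: ifP => _; rewrite ?Cz_b_lt0// mulr0.
      by rewrite l0; apply: eq_has_sum (@has_sum0 _ _) _ => b; rewrite E1 l0; case: ifP.
    case E : (t1 + mu1) pos => [b|] // _.
    have := @has_sum1 R _ b (fun b => f' (a1 :: b :: a)).
    have -> : f' (a1 :: b :: a) = l by rewrite E1 E eqxx.
    apply => b' bb'.
    by rewrite E1 E eqz_nat; case: eqP bb'.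
  pose d1 := n3 - n2 + (mu1 - (u + u)).
  pose d := n3 - s1 + mu2.
  have fE (b2 b3 : nat) : f (a1 :: b2 :: b3 :: a) =
    if b3%:Z == b2%:Z + d1 then
      if b2%:Z == a1%:Z + (n2 - n1 + (b3%:Z - n3 - mu2)) then
        C1 * w1 * w2 * (Cz (t1 + mu1) b2 b3 *
          (Cz (s2 + mu2) (b3%:Z - d) b3 * Cz (b3%:Z - d) a1 b2))
      else 0 else 0.
    rewrite /f nM nL (_ : a1 :: b2 :: b3 :: a = a1 :: [:: b2; b3] ++ a)// M//.
    rewrite (_ : a1 :: [:: b2; b3] ++ a = rcons [:: a1; b2] b3 ++ a)// H2//.
    rewrite dev_vector_cherry -/d1.
    case: eqP => [b3E|_]; last by rewrite !mulr0 mul0r.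
    rewrite (dev_vector_left hq hQ) /A dev_vector_cherry /= -/d.
    have -> : s2 - n3 - (s2 + mu2 - b3%:Z) = b3%:Z - n3 - mu2 by ring.
    case: eqP => [b2E|_]; last by rewrite !mulr0.
    by rewrite -b3E -b2E; ring.
  (* The shifts prescribed by the two trees have to be compatible; otherwise both sums vanish. *)
  have [cons|incons] := eqVneq mu1 (mu2 + u); last first.
    have l0 : l = 0.
      rewrite /l; case: eqP => [E|_]; last by rewrite mulr0.
      by exfalso; move/eqP : incons; apply; rewrite /u; move: E; clear; lia.
    rewrite l0 mulr0; apply: eq_has_sum (@has_sum0 _ _) _ => -[b2 b3] /=.
    rewrite fE; case: eqP => // E3; case: eqP => // E2; exfalso.
    by move/eqP : incons; apply; rewrite /u; move: E3 E2; rewrite /d1 /u; clear; lia.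
  (* The mirror image of the previous contraction: the sum runs over b3 with b2 = b3 - d1, and
     [Cz_sym] exchanges the children. *)
  have H0 := Cz_rotate hq hQ (s2 + mu2) (t1 + mu1) (- d1) (- d) a1.
  have H1' := has_sum_shift d1 (has_sumZ (C1 * w1 * w2) H0).
  apply: has_sum_val (eq_has_sum (has_sum_diag (d := d1) _ _ H1') _) _.
  - by move=> b b0; rewrite addrK Cz_b_lt0// mul0r mulr0.
  - by move=> b b0; rewrite Cz_a_lt0// mul0r mulr0.
  - move=> [b2 b3] /=; rewrite fE; case: eqP => // E3; rewrite ifT; last first.
      by apply/eqP; rewrite E3 /d1 cons /u; ring.
    rewrite -E3 (_ : b3%:Z - d1 = b2); last by rewrite E3; ring.
    by congr (_ * (_ * (_ * _))); exact: Cz_sym.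
  - rewrite /l ifT; last by apply/eqP; rewrite cons /u; ring.
    rewrite (_ : s2 + mu2 + - d1 - a1%:Z = s2 + n2 - n1 - n3); last first.
      by rewrite /d1 cons /u; ring.
    rewrite (_ : - d + (t1 + mu1) - a1%:Z = t1 + s1 - n1 - n3); last first.
      by rewrite /d cons /u; ring.
    by rewrite (Cz_sym _ _ _ a1) /c; ring.
have [l hl] := @choice _ _ (fun a l => _) key.
have t1' := has_sum_fubini (proj1 (has_sum_tuple_23 _ f _) FT) (fun a => proj1 (hl a)).
have t2' := has_sum_fubini (proj1 (has_sum_tuple_2 _ f' _) FT') (fun a => proj2 (hl a)).
apply: has_sum_val FT _; rewrite (has_sum_unique t1' (has_sumZ c t2')).
rewrite /c /s2 /=; congr (h _ _ * _).
Qed.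

End Symbols.

(** * Evaluation of the symbols *)

Section SymbolProducts.
Variables (R : realType) (q Q : R).
Hypothesis hq : 0 < q < 1.
Hypothesis hQ : Q = q ^+ 2.
Local Notation prodR := (prodR q Q).
Local Notation prodS := (prodS q Q).

Lemma tmap_graft (c : int) (T : tree int) (s n : seq int) :
  tmap (fun y => y + c) (graft T s n) =
  graft (tmap (fun y => y + c) T) [seq y + c | y <- s] [seq y + c | y <- n].
Proof. by elim: s n T => [|y s ih] [|m n] T //=; rewrite ih. Qed.

Lemma tmap_right_spine (c l : int) (r n : seq int) :
  tmap (fun y => y + c) (right_spine r n l) =
  right_spine [seq y + c | y <- r] [seq y + c | y <- n] (l + c).
Proof. by elim: r n => [|y r ih] [|m n] //=; rewrite ih. Qed.

(** Only differences of labels enter h. The length condition ensures that r2 is an actual label and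
    not the default 0, which a translation would not move. *)
Lemma prodR_shift (c x : int) (n r s : seq int) : (size n = (size r).+2)%N ->
  prodR (x + c) [seq y + c | y <- n] [seq y + c | y <- r] [seq y + c | y <- s] =
  prodR x n r s.
Proof.
elim: r n s => [|r1 r ih] n s //; case: n => // n1 [//|n2 [//|n3 n]] [nr].
case: s => // s1 s.
have -> : [seq y + c | y <- s1 :: s] = s1 + c :: [seq y + c | y <- s] by [].
rewrite /= (ih (s1 :: n3 :: n)); last by rewrite /= nr.
have -> : head (n3 + c) [seq y + c | y <- r] = head n3 r + c by case: r {ih nr}.
by congr (bessel _ _ _ _ * _); ring.
Qed.

Lemma prodS_shift (c x : int) (n t s : seq int) :
  prodS (x + c) [seq y + c | y <- n] [seq y + c | y <- t] [seq y + c | y <- s] =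
  prodS x n t s.
Proof.
elim: t n s => [|t1 t ih] n s //; case: s => // s1 s.
case: n => // n1 [//|n2 [//|n3 n]].
rewrite /= -(ih (n1 :: t1 :: n)).
have -> : head (x + c) [seq y + c | y <- s] = head x s + c by case: s.
by congr (bessel _ _ _ _ * _); ring.
Qed.

Lemma symbolRE (k : nat) (x : int) (n r s : seq int) :
  size r = k -> size s = k -> size n = k.+2 -> symbolR q x n r s = prodR x n r s.
Proof.
move=> rk sk nk; rewrite /symbolR /tree_dotp /dotp; set c := Num.max 0 (- x).
have x0 : 0 <= x + c by rewrite /c; lia.
have -> : tmap (fun y => y + c) (right_comb x r n) =
    right_comb (x + c) [seq y + c | y <- r] [seq y + c | y <- n].
  case: n nk => // n1 [//|n2 n] nk.
  rewrite -[right_comb _ _ _]/(right_spine (x :: r) _ _) tmap_right_spine.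
  by rewrite /right_comb /right_spine /= (last_map (fun y => y + c)).
have -> : tmap (fun y => y + c) (left_comb x s n) =
    left_comb (x + c) [seq y + c | y <- s] [seq y + c | y <- n].
  case: n nk => // n1 n nk.
  by rewrite !left_combE tmap_graft map_rcons.
rewrite -(prodR_shift c); last by rewrite nk rk.
rewrite nk.
have H := has_sum_right_left hq hQ x0 (n := [seq y + c | y <- n])
  (r := [seq y + c | y <- r]) (s := [seq y + c | y <- s]) (k := k).
rewrite !size_map in H; have [_ <-] := H rk sk nk.
congr rsum; apply/funext => a; rewrite !tree_vectorE.
have -> : root_label (right_comb (x + c) [seq y + c | y <- r] [seq y + c | y <- n]) = x + c.
  by case: n nk {H a}.
have -> // : root_label (left_comb (x + c) [seq y + c | y <- s] [seq y + c | y <- n]) = x + c.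
case: n nk {H a} => // n1 n [nk].
by rewrite left_combE root_graft ?last_rcons// size_rcons !size_map sk nk.
Qed.

Lemma symbolSE (k : nat) (x : int) (n t s : seq int) :
  size t = k -> size s = k -> size n = k.+2 -> symbolS q x n t s = prodS x n t s.
Proof.
move=> tk sk nk; rewrite /symbolS /tree_dotp /dotp; set c := Num.max 0 (- x).
have x0 : 0 <= x + c by rewrite /c; lia.
have -> : tmap (fun y => y + c) (mixed_tree x t n) =
    mixed_tree (x + c) [seq y + c | y <- t] [seq y + c | y <- n].
  case: n nk => // n1 [//|n2 n] nk.
  by rewrite /= !mixed_treeE /= tmap_graft.
have -> : tmap (fun y => y + c) (left_comb x s n) =
    left_comb (x + c) [seq y + c | y <- s] [seq y + c | y <- n].
  case: n nk => // n1 n nk.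
  by rewrite !left_combE tmap_graft map_rcons.
rewrite -(prodS_shift c) nk.
have H := has_sum_mixed_left hq hQ x0 (n := [seq y + c | y <- n])
  (t := [seq y + c | y <- t]) (s := [seq y + c | y <- s]) (k := k).
rewrite !size_map in H; have [_ <-] := H tk sk nk.
congr rsum; apply/funext => a; rewrite !tree_vectorE.
have -> // : root_label (left_comb (x + c) [seq y + c | y <- s] [seq y + c | y <- n]) = x + c.
case: n nk {H a} => // n1 n [nk].
by rewrite left_combE root_graft ?last_rcons// size_rcons !size_map sk nk.
Qed.

End SymbolProducts.

(** * Renormalization to multivariate q-Bessel functions *)

Section QBessel.
Variables (R : realType) (p q : R).
Hypothesis hp : 0 < p < 1.
Hypothesis hq : q = p ^+ 2.
Local Notation h := (bessel p q).
Local Notation e := (qpow p).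
Local Notation m := (mqpow p).

Let p_gt0 : 0 < p. Proof. by case/andP: hp. Qed.
Let q_bounds : 0 < q < 1. Proof. exact: Q_bounds hp hq. Qed.
Let q_ge0 : 0 <= q. Proof. by case/andP: q_bounds => /ltW. Qed.

Let e_sqr_int (y : int) : q ^ y = e y ^+ 2.
Proof. by rewrite hq /qpow !exprnP !exprz_exp mulrC. Qed.

Let sqr_powR (a : R) (n : nat) : 0 <= a -> (a ^+ 2) `^ (n%:R / 2) = a ^+ n.
Proof.
by move=> a0; rewrite -powR_mulrn// -powRrM mulrCA divff ?mulr1// powR_mulrn.
Qed.

Lemma h_qbessel (n : nat) (y : int) : h n y = m y * qbessel q n%:R (q ^ y).
Proof.
rewrite /bessel /qbessel -!mulrA; congr (_ * _); rewrite mulrA.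
rewrite e_sqr_int sqr_powR ?(e_ge0 hp)// -eM.
rewrite (natr1 n) powR_mulrn// (qpoch_infE hp hq).
rewrite [n%:Z * y]mulrC -!mulrA; congr (_ * _).
rewrite [qfac_inf q * _]mulrCA [qfac_inf q * _]mulrA mulfV ?(P_neq0 hp hq)// mul1r.
have iqn : inv_qfac q n != 0 by rewrite invr_neq0// (pq_neq0 hp hq).
(* The two series differ by the factor (q; q)_n, as (q; q)_(n+k) = (q; q)_n (q^(n+1); q)_k. *)
have H := has_sumZ (inv_qfac q n)^-1 (phi_sum hp hq n y).
rewrite -[LHS](mulVKf iqn); congr (_ * _).
apply/esym/cvg_lim => //.
apply: cvg_trans (has_sum_series H).
apply: near_eq_cvg; apply: nearW => j; apply: eq_bigr => k _.
rewrite /bessel_term /euler_coef (qpoch_shift hp hq).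
rewrite -PoszD /inv_qfac invrK -!e_sqr_int.
have -> : q ^ (y + 1) = q * q ^ y.
  by rewrite !e_sqr_int (eD hp) e1 exprMn -hq mulrC.
by field; rewrite !(pq_neq0 hp hq).
Qed.

(** For negative orders the definition of [qbesselz] is [h_opp]: its prefactor (-1)^n q^(n/2) is
    (-p)^n. *)
Lemma h_qbesselz (nu y : int) : h nu y = m y * qbesselz q nu (q ^ y).
Proof.
case: nu => n; first exact: h_qbessel.
rewrite {1}NegzE (h_opp hp hq) h_qbessel /qbesselz (mD hp) m_nat.
have -> : q `^ (n.+1%:R / 2) = p ^+ n.+1 by rewrite [in LHS]hq sqr_powR// ltW.
rewrite expfzDr ?gt_eqF//; last by case/andP: q_bounds.
by rewrite e_nat -exprnP; ring.
Qed.

End QBessel.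

(** * The recursive products in indexed form *)

Section Factors.
Variables (R : realType) (q Q : R).
Local Notation h := (bessel q Q).
Local Notation prodR := (prodR q Q).
Local Notation prodS := (prodS q Q).

(** The leaf created by one contraction is the entry lambda_(j-1) of the next factor. *)
Lemma prodR_big (x : int) (n r s : seq int) :
  size s = size r -> size n = (size r).+2 ->
  let X := rcons r n`_(size r).+1 in let L := n`_0 :: s in
  prodR x n r s = \prod_(0 <= j < size r)
    h (x + n`_j.+1 - X`_j.+1 - L`_j) (X`_j - X`_j.+1 + L`_j.+1 - L`_j).
Proof.
move=> sr nr X L; rewrite {}/X {}/L.
elim: r n s sr nr => [|r1 r ih] n s sr nr /=; first by rewrite big_nil.
case: n nr => // n1 [//|n2 [//|n3 n]] [nr]; case: s sr => // s1 s [sr].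
rewrite big_nat_recl// (ih (s1 :: n3 :: n)) ?sr//=; last by rewrite nr.
have -> : (rcons r (n3 :: n)`_(size r))`_0 = head n3 r by case: r {ih sr nr}.
by congr (bessel _ _ _ _ * _); ring.
Qed.

Lemma prodS_big (x : int) (n t s : seq int) :
  size s = size t -> size n = (size t).+2 ->
  let T := n`_1 :: t in let S := rcons s x in
  prodS x n t s = \prod_(0 <= j < size t)
    h (S`_j.+1 - n`_0 + T`_j - n`_j.+2) (S`_j + T`_j.+1 - n`_0 - n`_j.+2).
Proof.
move=> sr nr T S; rewrite {}/T {}/S.
elim: t n s sr nr => [|t1 t ih] n s sr nr /=; first by rewrite big_nil.
case: n nr => // n1 [//|n2 [//|n3 n]] [nr]; case: s sr => // s1 s [sr].
rewrite big_nat_recl// (ih (n1 :: t1 :: n)) ?sr//=; last by rewrite nr.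
have -> : (rcons s x)`_0 = head x s by case: s {sr}.
by congr (bessel _ _ _ _ * _); ring.
Qed.
End Factors.

(** * Collecting the powers of -p *)

Section Renormalization.
Variables (R : realType) (p q : R).
Hypothesis hp : 0 < p < 1.
Hypothesis hq : q = p ^+ 2.
Local Notation h := (bessel p q).
Local Notation m := (mqpow p).
Local Notation prodR := (prodR p q).
Local Notation prodS := (prodS p q).

Lemma prod_h (k : nat) (a b : nat -> int) :
  \prod_(0 <= j < k) h (a j) (b j) =
  m (\sum_(0 <= j < k) b j) * \prod_(0 <= j < k) qbesselz q (a j) (q ^ b j).
Proof.
rewrite (big_morph m (mD hp) (m0 p)) -big_split /=.
by apply: eq_bigr => j _; rewrite (h_qbesselz hp hq).
Qed.

Lemma prodR_qbessel (k : nat) (x : int) (n r s : seq int) :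
  (0 < k)%N -> size r = k -> size s = k -> size n = k.+2 ->
  prodR x n r s =
  m (entry r 1 + entry s k - entry n 1 - entry n k.+2) *
  multi_qbessel q (bnu x n) r s.
Proof.
move=> k0 rk sk nk; rewrite prodR_big ?sk ?rk ?nk// prod_h; congr (m _ * _).
  (* The exponents are increments of L_j - X_j, so their sum telescopes. *)
  rewrite (eq_bigr (fun j => ((n`_0 :: s)`_j.+1 - (rcons r n`_k.+1)`_j.+1) -
                           ((n`_0 :: s)`_j - (rcons r n`_k.+1)`_j))); last first.
    by move=> j _; ring.
  rewrite telescope_sumr//= !nth_rcons rk ltnn eqxx k0 /entry.
  by case: k k0 {rk sk nk} => // k _ /=; ring.
rewrite /multi_qbessel big_add1 rk /=; apply: eq_big_nat => j /andP[_ jk].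
have E i : (0 < i <= k)%N -> (bnu x n)`_i = x + n`_i.
  by move=> ik; rewrite nth_mkseq nk; [rewrite /= ltnS ik|lia].
have -> : (bnu x n)`_0 = n`_0 by rewrite nth_mkseq nk.
have -> : (bnu x n)`_k.+1 = n`_k.+1 by rewrite nth_mkseq nk// /= ltnn.
rewrite E//.
Qed.

Lemma prodS_qbessel (k : nat) (x : int) (n t s : seq int) :
  size t = k -> size s = k -> size n = k.+2 ->
  prodS x n t s =
  m (\sum_(a <- s) a + \sum_(a <- t) a - (\sum_(a <- n) a - entry n 2)
     - (k%:Z - 1) * entry n 1) *
  \prod_(1 <= j < k.+1)
    qbesselz q (entry (rcons s x) j.+1 - entry n 1 + (entry n 2 :: t)`_j.-1
                - entry n j.+2)
      (q ^ (entry (rcons s x) j + (entry n 2 :: t)`_j - entry n 1 - entry n j.+2)).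
Proof.
move=> tk sk nk; rewrite prodS_big ?tk ?sk ?nk// prod_h big_add1.
congr (m _ * _).
have -> : \sum_(a <- n) a = n`_0 + n`_1 + \sum_(0 <= j < k) n`_j.+2.
  by rewrite (big_nth 0) nk !big_nat_recl// addrA.
rewrite (big_nth 0 (r := s)) (big_nth 0 (r := t)) sk tk.
rewrite (@eq_big_nat _ _ _ _ _ _ (fun j => s`_j + t`_j - n`_0 - n`_j.+2)); last first.
  by move=> j /andP[_ jk]; rewrite nth_rcons sk jk.
rewrite !sumrB big_split /= sumr_const_nat subn0 /entry/=.
by rewrite -mulr_natl natz; ring.
Qed.

End Renormalization.

Theorem theorem4p7 (R : realType) (q : R) (hq : 0 < q < 1)
    (k : nat) (hk : (2 <= k)%N) (x : int)
    (r s : k.-tuple int) (n : k.+2.-tuple int) :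
  has_sum
    (fun t : k.-1.-tuple int =>
       symbolS q x n (rcons t (entry r 1)) s *
       symbolR q (entry r 1) (behead n) (behead r) t)
    (symbolR q x n r s)
  /\
  has_sum
    (fun t : k.-1.-tuple int =>
       coefA q k x n r s t *
       multi_qbessel q (bnu (entry r 1) (behead n)) (behead r) t)
    (multi_qbessel q (bnu x n) r s).
Proof.
case: k hk r s n => // k k1 r s n.
have k0 : (0 < k)%N by [].
have rE : r = entry r 1 :: behead r :> seq int.
  by case: r => -[].
have [br bn] : size (behead r) = k /\ size (behead n) = k.+2.
  by rewrite !size_behead !size_tuple.
split.
  have := prod_convolution hq (erefl (q ^+ 2)) x (entry r 1) br (size_tuple s) (size_tuple n).
  rewrite -rE (symbolRE hq (erefl _) _ (size_tuple r) (size_tuple s) (size_tuple n)).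
  move=> H; refine (eq_has_sum H _) => t.
  rewrite (symbolSE hq (erefl _) (k := k.+1)) ?size_rcons ?size_tuple//.
  by rewrite (symbolRE hq (erefl _) (k := k)) ?size_tuple.
have [q0 q1] := andP hq.
(* Taking sqrt q in the role of q makes the base q^2 of the q-Bessel functions equal to q. *)
have hp : 0 < Num.sqrt q < 1.
  by rewrite sqrtr_gt0 q0 -[ltRHS]sqrtr1 ltr_sqrt.
have qE : q = Num.sqrt q ^+ 2 by rewrite sqr_sqrtr// ltW.
have := prod_convolution hp qE x (entry r 1) br (size_tuple s) (size_tuple n).
rewrite -rE (prodR_qbessel hp qE (k := k.+1)) ?size_tuple//.
(* The power of - sqrt q on the left is moved to the right, where it combines with those of the two
   factors into the exponent of [coefA]. *)
set E := (X in mqpow _ X) => /(has_sumZ (mqpow (Num.sqrt q) E)^-1).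
rewrite mulKf ?(m_neq0 hp)//.
move=> H; refine (eq_has_sum H _) => t.
rewrite (prodS_qbessel hp qE (k := k.+1)) ?size_rcons ?size_tuple//.
rewrite (prodR_qbessel hp qE (k := k)) ?size_tuple//.
rewrite mulrACA !mulrA -mN -!(mD hp) /coefA; congr (mqpow _ _ * _ * _).
rewrite /E -cats1 big_cat big_seq1 /=.
by rewrite /entry !nth_behead /=; ring.
Qed.
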